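(* Suppose $\mathbb K$ is a computable age with the hereditary property (HP), the joint embedding property (JEP), and the cofinal amalgamation property (CAP). Then $\mathbb K$ has an $\mathscr{EI}(\mathbb K)''$-computable cofinal Fraïssé limit, where $\mathscr{EI}(\mathbb K)''$ is the double Turing jump of the embedding information $\mathscr{EI}(\mathbb K)$.
   Context: Languages and structures. $\mathcal{L}$ is a countable language (relation symbols of positive arity; function symbols of any arity, 0-ary ones being constants) with a computable representation: relation symbols $R_n$ and function symbols $F_m$ are indexed bijectively by disjoint computable subsets of $\omega$, with arity computable from the index. An $\mathcal{L}$-structure $\mathcal{M}$ is c.e. if its underlying set $M$ is a c.e. subset of $\omega$ and the sets $\{(n,\mathbf a): \mathcal M\models R_n(\mathbf a)\}$, $\{(n,\mathbf a): \mathcal M\models \neg R_n(\mathbf a)\}$, $\{(m,\mathbf a,b): \mathcal M\models F_m(\mathbf a)=b\}$ are c.e.; it is computable if moreover $M$ is computable. ''$\mathfrak s$-computable'' versions of notions are obtained by relativizing to the Turing degree $\mathfrak s$. Tuples are finite; $\mathrm{cl}_{\mathcal M}(\mathbf a)$ is the smallest substructure of $\mathcal M$ containing $\mathbf a$. For tuples of the same length, $\mathbf a\sim\mathbf b$ means that coordinates of $\mathbf a$ are equal exactly when the corresponding coordinates of $\mathbf b$ are; for $\mathbf a\in\mathcal A$, $\mathbf b\in\mathcal B$ of the same length, $\mathbf a\simeq\mathbf b$ means that for every atomic $\mathcal L$-formula $\varphi$, $\mathcal A\models\varphi(\mathbf a)$ iff $\mathcal B\models\varphi(\mathbf b)$;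 equivalently $\mathbf a\mapsto\mathbf b$ extends to an isomorphism $\mathrm{cl}(\mathbf a)\to\mathrm{cl}(\mathbf b)$. Ages. An age is a collection of finitely generated $\mathcal L$-structures closed under isomorphism. A computable age (computable representation of an age $\mathcal K$) is a c.e. set $\mathbb K$ of triples $(\mathbf a,\mathcal A,i)$ (computable structures being given by indices), with exactly one triple for each $i\in\omega$, written $\mathbb I(i)=(\mathbf a_i,\mathcal A_i,i)$, such that each $\mathcal A_i$ is a computable $\mathcal L$-structure in $\mathcal K$ with $\mathcal A_i=\mathrm{cl}_{\mathcal A_i}(\mathbf a_i)$, and every $\mathcal B\in\mathcal K$ is isomorphic to some $\mathcal A_i$. $\mathbb K$ is said to have a property of ages if $\mathcal K$ does. The embedding information $\mathscr{EI}(\mathbb K)$ is the set of tuples $(\mathbb I(k_0),\mathbf b_0,\mathbb I(k_1),\mathbf b_1)$ with $\mathbf b_0\in\mathcal A_{k_0}$, $\mathbf b_1\in\mathcal A_{k_1}$ and $\mathbf b_0\simeq\mathbf b_1$. (HP): for all $\mathcal B\in\mathcal K$, $\mathcal A\subseteq\mathcal B$ implies $\mathcal A\in\mathcal K$. (JEP): for all $\mathcal A,\mathcal B\in\mathcal K$ there is $\mathcal C\in\mathcal K$ into which both embed. An amalgamation base is an $\mathcal A'\in\mathcal K$ such that whenever $\mathcal B,\mathcal C\in\mathcal K$ and $f_{\mathcal B}:\mathcal A'\to\mathcal B$, $f_{\mathcal C}:\mathcal A'\to\mathcal C$ are embeddings, there are $\mathcal D\in\mathcal K$ and embeddings $\alpha_{\mathcal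 B}:\mathcal B\to\mathcal D$, $\alpha_{\mathcal C}:\mathcal C\to\mathcal D$ with $\alpha_{\mathcal B}\circ f_{\mathcal B}=\alpha_{\mathcal C}\circ f_{\mathcal C}$. (CAP): every $\mathcal A\in\mathcal K$ embeds into some amalgamation base in $\mathcal K$. Cofinal Fraïssé limits. The age of a structure $\mathcal M$ is the collection of $\mathcal L$-structures isomorphic to a finitely generated substructure of $\mathcal M$. A cofinal collection in $\mathcal M$ is a collection $E$ of finite tuples in $\mathcal M$ such that: for every finite tuple $\mathbf a$ in $\mathcal M$ there is $\mathbf b\in E$ with $\mathbf a\subseteq\mathrm{cl}_{\mathcal M}(\mathbf b)$; if $\mathbf b\in E$ and $\mathbf a\subseteq\mathrm{cl}_{\mathcal M}(\mathbf b)$ is a finite tuple then $\mathbf a\mathbf b\in E$; and if $\mathbf a\in E$ and $\mathbf a\simeq\mathbf b$ then $\mathbf b\in E$. An $\mathfrak s$-computable structure $\mathcal M$ is $\mathfrak s$-computably cofinally ultrahomogeneous if, for some $\mathfrak s$-computable cofinal collection $E$ in $\mathcal M$, there is an $\mathfrak s$-computable $g$ whose domain is the set of pairs $(\mathbf a,\mathbf b)$ of tuples in $\mathcal M$ with $\mathbf a\in E$ and $\mathbf a\sim\mathbf b$, such that $g(\mathbf a,\mathbf b)$ is the index of an $\mathfrak s$-computable bijection $g_{\mathbf a,\mathbf b}:\mathcal M\to\mathcal M$ with $g_{\mathbf a,\mathbf b}(\mathbf a)=\mathbf b$, and if $\mathbf a\simeq\mathbf b$ then $g_{\mathbf a,\mathbf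 b}$ is an automorphism of $\mathcal M$. An $\mathfrak s$-computable structure $\mathcal M$ is an $\mathfrak s$-computable cofinal Fraïssé limit of $\mathbb K$ if $\mathcal M$ is $\mathfrak s$-computably cofinally ultrahomogeneous and $\mathbb K$ is an $\mathfrak s$-computable representation of the age of $\mathcal M$. *)

(* Defs.v *)
From Stdlib Require Import Arith List.
From Stdlib Require Cantor.

Set Implicit Arguments.
Unset Strict Implicit.

Notation "⟨ x , y ⟩" := (Cantor.to_nat (x, y)) (at level 0).

Fixpoint code_tuple (a : list nat) : nat :=
  match a with
  | nil => 0
  | x :: a' => S ⟨x, code_tuple a'⟩
  end.

(** Programs for unary partial functions; several arguments are passed through
    the Cantor pairing. *)
Inductive prog : Type :=
  | PZero | PSucc | PFst | PSnd | POracle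
  | PPair (p q : prog)
  | PComp (p q : prog)
  | PRec (p q : prog)    (* ⟨a,0⟩ |-> p(a);  ⟨a,n+1⟩ |-> q⟨a,⟨n,value at ⟨a,n⟩⟩⟩ *)
  | PMu (p : prog).

(** [None]: no oracle, i.e. plain computability; [Some S]: the oracle [S]. *)
Definition oracle : Type := option (nat -> Prop).

Fixpoint eval (O : oracle) (p : prog) (x y : nat) : Prop :=
  match p with
  | PZero => y = 0
  | PSucc => y = S x
  | PFst => y = fst (Cantor.of_nat x)
  | PSnd => y = snd (Cantor.of_nat x)
  | POracle =>
      match O with
      | None => False
      | Some Q => (Q x /\ y = 1) \/ (~ Q x /\ y = 0)
      end
  | PPair p q => exists u v, eval O p x u /\ eval O q x v /\ y = ⟨u, v⟩
  | PComp p q => exists u, eval O q x u /\ eval O p u y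
  | PRec p q =>
      let a := fst (Cantor.of_nat x) in
      nat_rect (fun _ => nat -> Prop)
        (eval O p a)
        (fun n V z => exists u, V u /\ eval O q ⟨a, ⟨n, u⟩⟩ z)
        (snd (Cantor.of_nat x)) y
  | PMu p =>
      eval O p ⟨x, y⟩ 0 /\ forall z, z < y -> exists k, eval O p ⟨x, z⟩ (S k)
  end.

Fixpoint oracle_free (p : prog) : Prop :=
  match p with
  | POracle => False
  | PPair p q | PComp p q | PRec p q => oracle_free p /\ oracle_free q
  | PMu p => oracle_free p
  | _ => True
  end.

(** Without an oracle only oracle-free programs are admitted, so that an index
    of a computable object is also an index of the same object relative to
    every oracle. *)
Definition legal (O : oracle) (p : prog) : Prop :=
  match O with None => oracle_free p | Some _ => True end.

Fixpoint goedel (p : prog) : nat :=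
  match p with
  | PZero => ⟨0, 0⟩
  | PSucc => ⟨1, 0⟩
  | PFst => ⟨2, 0⟩
  | PSnd => ⟨3, 0⟩
  | POracle => ⟨4, 0⟩
  | PPair p q => ⟨5, ⟨goedel p, goedel q⟩⟩
  | PComp p q => ⟨6, ⟨goedel p, goedel q⟩⟩
  | PRec p q => ⟨7, ⟨goedel p, goedel q⟩⟩
  | PMu p => ⟨8, goedel p⟩
  end.

Definition index (O : oracle) (e : nat) (G : nat -> nat -> Prop) : Prop :=
  exists p, goedel p = e /\ legal O p /\ forall x y, eval O p x y <-> G x y.

Definition map_index (O : oracle) (e : nat) (D : nat -> Prop) (h : nat -> nat) :=
  index O e (fun x y => D x /\ y = h x).

Definition set_index (O : oracle) (e : nat) (Q : nat -> Prop) : Prop :=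
  index O e (fun x y => (Q x /\ y = 1) \/ (~ Q x /\ y = 0)).

Definition ce_index (O : oracle) (e : nat) (Q : nat -> Prop) : Prop :=
  exists G, index O e G /\ forall x, Q x <-> exists y, G x y.

Definition computable_map (O : oracle) (D : nat -> Prop) (h : nat -> nat) : Prop :=
  exists e, map_index O e D h.

Definition computable_set (O : oracle) (Q : nat -> Prop) : Prop :=
  exists e, set_index O e Q.

Definition ce_set (O : oracle) (Q : nat -> Prop) : Prop :=
  exists e, ce_index O e Q.

Definition jump (Q : nat -> Prop) (e : nat) : Prop :=
  exists G y, index (Some Q) e G /\ G e y.

Record language : Type := Language {
  rel_sym : nat -> Prop;
  fun_sym : nat -> Prop;
  arity : nat -> nat;
  sym_disjoint : forall n, rel_sym n -> fun_sym n -> False;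
  rel_arity_pos : forall n, rel_sym n -> 0 < arity n;
  rel_sym_computable : computable_set None rel_sym;
  fun_sym_computable : computable_set None fun_sym;
  arity_computable : computable_map None (fun n => rel_sym n \/ fun_sym n) arity
}.

(** The underlying set of a structure is the subset [dom] of the ambient type
    [U] and may be empty.  [rel] and [fn] are meaningful only on symbols of [L]
    and tuples of the right length in [dom]; their other values are never used. *)
Record structure (L : language) (U : Type) : Type := Structure {
  dom : U -> Prop;
  rel : nat -> list U -> Prop;
  fn : nat -> list U -> U;
  fn_dom : forall m a, fun_sym L m -> length a = arity L m ->
    Forall dom a -> dom (fn m a)
}.

Definition rel_args L U (A : structure L U) (n : nat) (a : list U) : Prop :=
  rel_sym L n /\ length a = arity L n /\ Forall (dom A) a.

Definition fun_args L U (A : structure L U) (m : nat) (a : list U) : Prop :=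
  fun_sym L m /\ length a = arity L m /\ Forall (dom A) a.

Definition substructure L U (A B : structure L U) : Prop :=
  (forall x, dom A x -> dom B x) /\
  (forall n a, rel_args A n a -> (rel A n a <-> rel B n a)) /\
  (forall m a, fun_args A m a -> fn A m a = fn B m a).

Inductive cl L U (A : structure L U) (a : list U) : U -> Prop :=
  | cl_gen x : In x a -> cl A a x
  | cl_fn m b : fun_sym L m -> length b = arity L m ->
      (forall x, In x b -> cl A a x) -> cl A a (fn A m b).

Definition generated_by L U (A : structure L U) (a : list U) : Prop :=
  Forall (dom A) a /\ forall x, dom A x <-> cl A a x.

Definition fin_gen L U (A : structure L U) : Prop :=
  exists a, generated_by A a.

Definition embedding L U V (A : structure L U) (B : structure L V) (f : U -> V) : Prop :=
  (forall x, dom A x -> dom B (f x)) /\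
  (forall x y, dom A x -> dom A y -> f x = f y -> x = y) /\
  (forall n a, rel_args A n a -> (rel A n a <-> rel B n (map f a))) /\
  (forall m a, fun_args A m a -> f (fn A m a) = fn B m (map f a)).

Definition isomorphism L U V (A : structure L U) (B : structure L V) (f : U -> V) : Prop :=
  embedding A B f /\ forall y, dom B y -> exists x, dom A x /\ f x = y.

Definition embeds L U V (A : structure L U) (B : structure L V) : Prop :=
  exists f, embedding A B f.

Definition isomorphic L U V (A : structure L U) (B : structure L V) : Prop :=
  exists f, isomorphism A B f.

Inductive term : Type :=
  | Var (i : nat)
  | App (m : nat) (ts : list term).

Inductive atomic : Type :=
  | AEq (t u : term)
  | ARel (n : nat) (ts : list term).

Inductive is_term (L : language) (k : nat) : term -> Prop :=
  | is_term_var i : i < k -> is_term L k (Var i)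
  | is_term_app m ts : fun_sym L m -> length ts = arity L m ->
      (forall t, In t ts -> is_term L k t) -> is_term L k (App m ts).

Definition is_atomic (L : language) (k : nat) (phi : atomic) : Prop :=
  match phi with
  | AEq t u => is_term L k t /\ is_term L k u
  | ARel n ts =>
      rel_sym L n /\ length ts = arity L n /\ forall t, In t ts -> is_term L k t
  end.

(** The default of [nth] is a dummy: it is not reached when [i < length a]. *)
Fixpoint value L U (A : structure L U) (a : list U) (t : term) : U :=
  match t with
  | Var i => nth i a (fn A 0 nil)
  | App m ts => fn A m (map (value A a) ts)
  end.

Definition sat L U (A : structure L U) (a : list U) (phi : atomic) : Prop :=
  match phi with
  | AEq t u => value A a t = value A a u
  | ARel n ts => rel A n (map (value A a) ts)
  end.

Definition simeq L U V (A : structure L U) (a : list U)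
    (B : structure L V) (b : list V) : Prop :=
  length a = length b /\
  forall phi, is_atomic L (length a) phi -> (sat A a phi <-> sat B b phi).

Definition same_pattern U V (a : list U) (b : list V) : Prop :=
  length a = length b /\
  forall i j, i < length a -> j < length a ->
    (nth_error a i = nth_error a j <-> nth_error b i = nth_error b j).

Definition pos_diagram L (A : structure L nat) (x : nat) : Prop :=
  exists n a, x = ⟨n, code_tuple a⟩ /\ rel_args A n a /\ rel A n a.

Definition neg_diagram L (A : structure L nat) (x : nat) : Prop :=
  exists n a, x = ⟨n, code_tuple a⟩ /\ rel_args A n a /\ ~ rel A n a.

Definition fun_diagram L (A : structure L nat) (x : nat) : Prop :=
  exists m a, x = ⟨m, ⟨code_tuple a, fn A m a⟩⟩ /\ fun_args A m a.

Definition structure_index L (O : oracle) (e : nat) (A : structure L nat) : Prop :=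
  exists d p n f, e = ⟨d, ⟨p, ⟨n, f⟩⟩⟩ /\
    set_index O d (dom A) /\
    ce_index O p (pos_diagram A) /\
    ce_index O n (neg_diagram A) /\
    ce_index O f (fun_diagram A).

Definition computable_structure L (O : oracle) (A : structure L nat) : Prop :=
  exists e, structure_index O e A.

Definition collection (L : language) : Type := forall U : Type, structure L U -> Prop.

Definition is_age L (C : collection L) : Prop :=
  (forall U (A : structure L U), C U A -> fin_gen A) /\
  (forall U V (A : structure L U) (B : structure L V),
     C U A -> isomorphic A B -> C V B).

Definition HP L (C : collection L) : Prop :=
  forall U (A B : structure L U),
    C U B -> substructure A B -> fin_gen A -> C U A.

Definition JEP L (C : collection L) : Prop :=
  forall U V (A : structure L U) (B : structure L V), C U A -> C V B ->
  exists W (D : structure L W), C W D /\ embeds A D /\ embeds B D.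

Definition amalgamation_base L (C : collection L) U (A : structure L U) : Prop :=
  C U A /\
  forall V W (B : structure L V) (B' : structure L W) (f : U -> V) (f' : U -> W),
    C V B -> C W B' -> embedding A B f -> embedding A B' f' ->
    exists X (D : structure L X) (g : V -> X) (g' : W -> X),
      C X D /\ embedding B D g /\ embedding B' D g' /\
      forall x, dom A x -> g (f x) = g' (f' x).

Definition CAP L (C : collection L) : Prop :=
  forall U (A : structure L U), C U A ->
  exists V (B : structure L V), amalgamation_base C B /\ embeds A B.

Definition age_of L U (M : structure L U) : collection L :=
  fun V B => exists A : structure L U, substructure A M /\ fin_gen A /\ isomorphic A B.

(** The set of triples [(gen i, str i, i)], the structure [str i] being given by
    the index [ind i]. *)
Record representation (L : language) : Type := Representation {
  gen : nat -> list nat;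
  str : nat -> structure L nat;
  ind : nat -> nat
}.

Definition triple L (K : representation L) (i : nat) : nat :=
  ⟨code_tuple (gen K i), ⟨ind K i, i⟩⟩.

Definition computable_age L (O : oracle) (K : representation L) (C : collection L) : Prop :=
  is_age C /\
  ce_set O (fun x => exists i, x = triple K i) /\
  (forall i, structure_index O (ind K i) (str K i) /\
     C nat (str K i) /\ generated_by (str K i) (gen K i)) /\
  (forall U (B : structure L U), C U B -> exists i, isomorphic B (str K i)).

Definition EI L (K : representation L) (x : nat) : Prop :=
  exists k0 b0 k1 b1,
    x = ⟨⟨triple K k0, code_tuple b0⟩, ⟨triple K k1, code_tuple b1⟩⟩ /\
    Forall (dom (str K k0)) b0 /\ Forall (dom (str K k1)) b1 /\
    simeq (str K k0) b0 (str K k1) b1.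

Definition cofinal_collection L U (M : structure L U) (E : list U -> Prop) : Prop :=
  (forall a, E a -> Forall (dom M) a) /\
  (forall a, Forall (dom M) a -> exists b, E b /\ Forall (cl M b) a) /\
  (forall a b, E b -> Forall (cl M b) a -> E (a ++ b)) /\
  (forall a b, E a -> Forall (dom M) b -> simeq M a M b -> E b).

Definition computably_cofinally_ultrahomogeneous L (O : oracle) (M : structure L nat) : Prop :=
  exists E : list nat -> Prop,
    cofinal_collection M E /\
    computable_set O (fun x => exists a, x = code_tuple a /\ E a) /\
    let P a b := E a /\ Forall (dom M) b /\ same_pattern a b in
    exists g : nat -> nat,
      computable_map O (fun x => exists a b, x = ⟨code_tuple a, code_tuple b⟩ /\ P a b) g /\
      forall a b, P a b ->
        exists h : nat -> nat,
          map_index O (g ⟨code_tuple a, code_tuple b⟩) (dom M) h /\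
          (forall x, dom M x -> dom M (h x)) /\
          (forall x y, dom M x -> dom M y -> h x = h y -> x = y) /\
          (forall y, dom M y -> exists x, dom M x /\ h x = y) /\
          map h a = b /\
          (simeq M a M b -> isomorphism M M h).

Definition computable_cofinal_fraisse_limit L (O : oracle)
    (M : structure L nat) (K : representation L) : Prop :=
  computable_structure O M /\
  computably_cofinally_ultrahomogeneous O M /\
  computable_age O K (age_of M).

(* Main.v *)
Require Import Defs.
From Stdlib Require Import Arith List Lia Classical ClassicalEpsilon.
From Stdlib Require Cantor.
Import ListNotations.
Set Implicit Arguments.
Unset Strict Implicit.

(** The limit is a Henkin-style union of a chain of pairs [(k_n, b_n)], where [b_n] generates
    the amalgamation base [A_(k_n)] of the age and the type of [b_n] is that of an initial
    segment of [b_(n+1)].  Everything about the chain is expressed by the relation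
    [(k, b) ~ (k', b')], "[b] and [b'] satisfy the same atomic formulas", which the embedding
    information decides.  Being an amalgamation base is a Pi_2 statement over this relation,
    so the double jump decides it and can build the chain, amalgamating at stage [n] with the
    extension asked for by the [n]-th task; (CAP) makes every stage again a base, and (JEP)
    makes every member of the age embed.  The elements of the limit are the coordinates of the
    [b_n], up to equality.  Its cofinal collection consists of the tuples that generate
    amalgamation bases; all tasks over them are met, so similar tuples in the collection are
    matched by a back-and-forth search, whose steps are decidable.  The diagrams of the
    structures of the age are c.e. uniformly in the index, hence decided by one jump. *)

(** No embedding is ever computed. Old tuples are copied to the front of new ones, so a coordinate
    keeps naming the same element although the number that represents it changes from stage to
    stage; maps between stages exist, but only finite tuples and their atomic types are handled.

    Every construction by search rests on one principle: a decidable total relation has a computable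
    choice function. Totality is proved classically, so the mathematics of a step (amalgamation,
    joint embedding, back-and-forth) is separated from its computability, and a relation is given a
    vacuous branch where its precondition fails.

    An element generated by the tuple of a stage need not be a coordinate of it. The limit is still
    closed under the functions because the tuple of a stage generates a base: a task over that whole
    tuple asks for the missing element, which becomes a coordinate later. For the same reason the
    value of a term in the limit is compared with its value in a stage only from some stage on. *)

#[local] Arguments Cantor.to_nat : simpl never.
#[local] Arguments Cantor.of_nat : simpl never.

(** * Encodings of data by natural numbers *)

Class encoding (A : Type) := Encoding {
  code : A -> nat;
  code_inj : forall a b, code a = code b -> a = b;
  code_surj : forall n, exists a, code a = n
}.

#[local] Instance encoding_nat : encoding nat.
Proof. exists (fun n => n); eauto. Defined.

Lemma pair_inj x y x' y' : ⟨x, y⟩ = ⟨x', y'⟩ -> x = x' /\ y = y'.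
Proof.
  intros H. apply (f_equal Cantor.of_nat) in H.
  rewrite !Cantor.cancel_of_to in H. now inversion H.
Qed.

Lemma pair_surj n : exists x y, n = ⟨x, y⟩.
Proof.
  exists (fst (Cantor.of_nat n)), (snd (Cantor.of_nat n)).
  now rewrite <- surjective_pairing, Cantor.cancel_to_of.
Qed.

(** Defined by choice, yet harmless for computability: on codes it is the identity, by [decodeK].
    Codes being surjective, every number decodes, so searches meet no invalid input. *)
Definition decode A `{encoding A} (n : nat) : A :=
  proj1_sig (constructive_indefinite_description _ (code_surj n)).

Lemma decodeK A `{encoding A} n : code (decode n : A) = n.
Proof. unfold decode. now destruct (constructive_indefinite_description _ _). Qed.

Lemma codeK A `{encoding A} (a : A) : decode (code a) = a.
Proof. apply code_inj, decodeK. Qed.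

#[local] Instance encoding_prod A B `{encoding A} `{encoding B} : encoding (A * B).
Proof.
  exists (fun p => ⟨code (fst p), code (snd p)⟩).
  - intros [a b] [a' b'] E. apply pair_inj in E as [E1 E2].
    apply code_inj in E1, E2. simpl in *. congruence.
  - intros n. destruct (pair_surj n) as (x & y & ->).
    destruct (code_surj (A := A) x) as [a <-], (code_surj (A := B) y) as [b <-].
    now exists (a, b).
Defined.

Fixpoint code_list A `{encoding A} (l : list A) : nat :=
  match l with
  | nil => 0
  | x :: l' => S ⟨code x, code_list l'⟩
  end.

#[local] Instance encoding_list A `{encoding A} : encoding (list A).
Proof.
  exists (@code_list A _).
  - intros a. induction a as [|x a IH]; intros [|y b] E; simpl in E; try easy.
    injection E as E. apply pair_inj in E as [E1 E2].
    apply code_inj in E1. apply IH in E2. congruence.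
  - intros n. induction n as [n IH] using lt_wf_ind. destruct n as [|n].
    + now exists nil.
    + destruct (pair_surj n) as (x & y & ->).
      destruct (IH y) as [l <-].
      { pose proof (Cantor.to_nat_non_decreasing x y). lia. }
      destruct (code_surj x) as [a <-]. now exists (a :: l).
Defined.

Lemma code_list_tuple (a : list nat) : code a = code_tuple a.
Proof. induction a as [|x a IH]; simpl in *; congruence. Qed.

Lemma code_tuple_inj a b : code_tuple a = code_tuple b -> a = b.
Proof. rewrite <- !code_list_tuple. apply code_inj. Qed.

Lemma length_le_code A `{encoding A} (l : list A) : length l <= code l.
Proof.
  induction l as [|x l IH]; simpl in *; [lia|].
  pose proof (Cantor.to_nat_non_decreasing (code x) (code_list l)). lia.
Qed.

(** * Program numbers and relativization of indices *)

Lemma goedel_inj p q : goedel p = goedel q -> p = q.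
Proof.
  revert q. induction p; intros [] E; cbn [goedel] in E; try reflexivity;
    apply pair_inj in E as [E1 E2]; try discriminate;
    try (apply pair_inj in E2 as [E2 E3]);
    repeat match goal with
    | IH : forall q, goedel ?p = goedel q -> _, E : goedel ?p = goedel _ |- _ =>
        apply IH in E; subst
    end; reflexivity.
Qed.

Lemma eval_oracle_free Q p : oracle_free p ->
  forall x y, eval (Some Q) p x y <-> eval None p x y.
Proof.
  induction p; simpl; intros Hp x y; try tauto.
  - destruct Hp as [H1 H2].
    split; intros (u & v & Hu & Hv & E); exists u, v;
      (split; [now apply IHp1 | split; [now apply IHp2 | exact E]]).
  - destruct Hp as [H1 H2].
    split; intros (u & Hu & Hv); exists u; (split; [now apply IHp2 | now apply IHp1]).
  - destruct Hp as [H1 H2]. revert y.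
    induction (snd (Cantor.of_nat x)) as [|n IH]; intros y; simpl.
    + now apply IHp1.
    + split; intros (u & Hu & Hv); exists u; (split; [now apply IH | now apply IHp2]).
  - rewrite IHp by assumption.
    split; intros [H0 H]; (split; [exact H0|]); intros z Hz;
      destruct (H z Hz) as [k Hk]; exists k; now apply IHp.
Qed.

Lemma index_relativize Q e G : index None e G -> index (Some Q) e G.
Proof.
  intros (p & Hp & Hl & HG). exists p. split; [exact Hp|]. split; [exact I|].
  intros x y. rewrite eval_oracle_free by exact Hl. apply HG.
Qed.

Lemma index_goedel Q p : index (Some Q) (goedel p) (eval (Some Q) p).
Proof. exists p. repeat split; auto. Qed.

Lemma ce_index_relativize Q e P : ce_index None e P -> ce_index (Some Q) e P.
Proof.
  intros (G & HG & HP). exists G. split; [now apply index_relativize | exact HP].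
Qed.

Lemma structure_index_relativize Q L e (A : structure L nat) :
  structure_index None e A -> structure_index (Some Q) e A.
Proof.
  intros (d & p & n & f & He & Hd & Hp & Hn & Hf). exists d, p, n, f.
  split; [exact He|]. split; [now apply index_relativize|].
  now auto using ce_index_relativize.
Qed.

(** * Computable functions and decidable relations on encoded types, relative to an oracle *)

Definition chi A (P : A -> Prop) (a : A) : nat :=
  if excluded_middle_informative (P a) then 1 else 0.

Lemma chi_1 A (P : A -> Prop) a : chi P a = 1 <-> P a.
Proof. unfold chi. destruct (excluded_middle_informative (P a)); intuition discriminate. Qed.

Lemma chi_0 A (P : A -> Prop) a : chi P a = 0 <-> ~ P a.
Proof. unfold chi. destruct (excluded_middle_informative (P a)); intuition discriminate. Qed.

Lemma chi_ext A B (P : A -> Prop) (R : B -> Prop) a b : (P a <-> R b) -> chi P a = chi R b.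
Proof.
  intros H. unfold chi.
  destruct (excluded_middle_informative (P a)), (excluded_middle_informative (R b)); tauto.
Qed.

Section Computability.

Variable Q : nat -> Prop.

(** The equivalence asks at once that the value exists, is correct and is the only one, so
    determinism of [eval] is not a separate concern. *)
Definition computes A B `{encoding A} `{encoding B} (p : prog) (f : A -> B) : Prop :=
  forall a y, eval (Some Q) p (code a) y <-> y = code (f a).

Definition Comp A B `{encoding A} `{encoding B} (f : A -> B) : Prop :=
  exists p, computes p f.

Definition Dec A `{encoding A} (P : A -> Prop) : Prop := Comp (chi P).

Section Closure.
Context {A B C : Type} `{encoding A} `{encoding B} `{encoding C}.

Lemma Comp_ext (f g : A -> B) : (forall a, f a = g a) -> Comp f -> Comp g.
Proof. intros E [p Hp]. exists p. intros a y. now rewrite <- E. Qed.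

Lemma Comp_comp (g : B -> C) (f : A -> B) : Comp g -> Comp f -> Comp (fun a => g (f a)).
Proof.
  intros [q Hq] [p Hp]. exists (PComp q p). intros a y. simpl. split.
  - intros (u & Hu & Hy). apply Hp in Hu. subst u. now apply Hq.
  - intros ->. exists (code (f a)). split; [now apply Hp | now apply Hq].
Qed.

Lemma Comp_pair (f : A -> B) (g : A -> C) : Comp f -> Comp g -> Comp (fun a => (f a, g a)).
Proof.
  intros [p Hp] [q Hq]. exists (PPair p q). intros a y. simpl. split.
  - intros (u & v & Hu & Hv & ->). apply Hp in Hu. apply Hq in Hv. now subst.
  - intros ->. exists (code (f a)), (code (g a)).
    split; [now apply Hp | split; [now apply Hq | reflexivity]].
Qed.

Lemma Comp_fst (f : A -> B * C) : Comp f -> Comp (fun a => fst (f a)).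
Proof.
  intros [p Hp]. exists (PComp PFst p). intros a y. simpl. split.
  - intros (u & Hu & ->). apply Hp in Hu. subst u. simpl.
    now rewrite Cantor.cancel_of_to.
  - intros ->. exists (code (f a)). split; [now apply Hp|]. simpl.
    now rewrite Cantor.cancel_of_to.
Qed.

Lemma Comp_snd (f : A -> B * C) : Comp f -> Comp (fun a => snd (f a)).
Proof.
  intros [p Hp]. exists (PComp PSnd p). intros a y. simpl. split.
  - intros (u & Hu & ->). apply Hp in Hu. subst u. simpl.
    now rewrite Cantor.cancel_of_to.
  - intros ->. exists (code (f a)). split; [now apply Hp|]. simpl.
    now rewrite Cantor.cancel_of_to.
Qed.

Lemma Comp_id : Comp (fun a : A => a).
Proof.
  (* No primitive program is the identity: the input is rebuilt as the pair of its projections,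
     which is correct at every number because the pairing is surjective. *)
  exists (PComp PFst (PPair (PPair PFst PSnd) PZero)). intros a y. simpl.
  set (x := code a). split.
  - intros (u & (v & w & (v1 & v2 & -> & -> & ->) & -> & ->) & ->).
    rewrite Cantor.cancel_of_to. simpl.
    now rewrite <- surjective_pairing, Cantor.cancel_to_of.
  - intros ->. exists ⟨x, 0⟩. split.
    + exists x, 0. split; [|easy].
      exists (fst (Cantor.of_nat x)), (snd (Cantor.of_nat x)).
      now rewrite <- surjective_pairing, Cantor.cancel_to_of.
    + now rewrite Cantor.cancel_of_to.
Qed.

End Closure.

Lemma Dec_ext A `{encoding A} (P R : A -> Prop) : (forall a, P a <-> R a) -> Dec P -> Dec R.
Proof. intros E. apply Comp_ext. intros a. now apply chi_ext. Qed.

Fixpoint const_prog (n : nat) : prog :=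
  match n with
  | 0 => PZero
  | S n' => PComp PSucc (const_prog n')
  end.

Lemma eval_const_prog n x y : eval (Some Q) (const_prog n) x y <-> y = n.
Proof.
  revert y. induction n as [|n IH]; intros y; simpl; [easy|]. split.
  - intros (u & Hu & ->). apply IH in Hu. congruence.
  - intros ->. exists n. split; [now apply IH | reflexivity].
Qed.

Lemma Comp_const A B `{encoding A} `{encoding B} (b : B) : Comp (fun _ : A => b).
Proof. exists (const_prog (code b)). intros a y. apply eval_const_prog. Qed.

Lemma Comp_S A `{encoding A} (f : A -> nat) : Comp f -> Comp (fun a => S (f a)).
Proof. apply (Comp_comp (g := S)). exists PSucc. intros a y. reflexivity. Qed.

(** The program for [f] serves unchanged. This is how [decode], which has no program of its own,
    enters computable expressions. *)
Lemma Comp_recode A B C `{encoding A} `{encoding B} `{encoding C} (r : B -> C) (f : A -> B) :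
  (forall b, code (r b) = code b) -> Comp f -> Comp (fun a => r (f a)).
Proof.
  intros Hr [p Hp]. exists p. intros a y. rewrite Hr. apply Hp.
Qed.

Lemma Comp_nat_rect A B `{encoding A} `{encoding B}
    (n : A -> nat) (f : A -> B) (g : A -> nat -> B -> B) :
  Comp n -> Comp f -> Comp (fun t : A * (nat * B) => g (fst t) (fst (snd t)) (snd (snd t))) ->
  Comp (fun a => nat_rect (fun _ => B) (f a) (g a) (n a)).
Proof.
  intros Hn [p Hp] [q Hq].
  apply (Comp_comp (f := fun a => (a, n a))
    (g := fun an : A * nat => nat_rect (fun _ => B) (f (fst an)) (g (fst an)) (snd an)));
    [|exact (Comp_pair Comp_id Hn)].
  exists (PRec p q). intros [a m] y. simpl. rewrite Cantor.cancel_of_to. simpl.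
  revert y. induction m as [|m IH]; intros y; simpl; [apply Hp|]. split.
  - intros (u & Hu & Hy). apply IH in Hu. subst u.
    apply (Hq (a, (m, _))) in Hy. exact Hy.
  - intros ->. eexists. split; [now apply IH|]. now apply (Hq (a, (m, _))).
Qed.

Lemma mu_spec p x (f : nat -> nat) :
  (forall n y, eval (Some Q) p ⟨x, n⟩ y <-> y = f n) ->
  forall y, eval (Some Q) (PMu p) x y <-> f y = 0 /\ forall z, z < y -> f z <> 0.
Proof.
  intros Hp y. simpl. rewrite Hp. split; intros [H0 H]; (split; [easy|]).
  - intros z Hz E. destruct (H z Hz) as [k Hk]. apply Hp in Hk. congruence.
  - intros z Hz. specialize (H z Hz). exists (pred (f z)). rewrite Hp. lia.
Qed.

Lemma least_exists (P : nat -> Prop) :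
  (exists n, P n) -> exists n, P n /\ forall m, m < n -> ~ P m.
Proof.
  intros [n Hn]. induction n as [n IH] using lt_wf_ind.
  destruct (classic (exists m, m < n /\ P m)) as [(m & Hm & Pm)|N].
  - eauto.
  - exists n. split; [exact Hn|]. intros m Hm Pm. apply N. eauto.
Qed.

End Computability.

(** * Tactics that follow the shape of a function *)

Ltac comp_base :=
  lazymatch goal with
  | |- @Comp _ _ _ _ _ (fun x => x) => refine (Comp_id _)
  | |- @Comp _ _ _ _ _ (fun x => (@?f x, @?g x)) => refine (Comp_pair _ _)
  | |- @Comp _ _ _ _ _ (fun x => fst (@?f x)) => refine (Comp_fst _)
  | |- @Comp _ _ _ _ _ (fun x => snd (@?f x)) => refine (Comp_snd _)
  | |- @Comp _ _ _ _ _ (fun x => S (@?f x)) => refine (Comp_S _)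
  | |- @Comp _ _ _ _ _ (fun x => ?b) => refine (Comp_const _ b)
  | |- @Comp _ _ _ _ _ (fun x => _) => fail
  | |- @Comp ?Q ?A ?B ?a ?b ?f => change (@Comp Q A B a b (fun x => f x))
  end.
Ltac comp_hyp :=
  match goal with
  | H : @Comp _ _ _ _ _ ?s |- @Comp _ _ _ _ _ (fun x => ?s (@?f x)) => refine (Comp_comp (f := f) H _)
  end.
(** Hooks for rules proved later: [comp_hook] receives those for lists, [comp_user] those local to
    the limit. *)
Ltac comp_hook := fail.
Ltac comp_user := fail.
Ltac comp := cbv beta; repeat first [assumption | comp_user | comp_hook | comp_base | comp_hyp]; cbv beta.

(** * Arithmetic, connectives, search and bounded quantifiers *)

Section Functions.

Variable Q : nat -> Prop.
Local Notation Comp := (Comp Q).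
Local Notation Dec := (Dec Q).

Lemma Comp_pred A `{encoding A} (f : A -> nat) : Comp f -> Comp (fun a => pred (f a)).
Proof.
  intros Hf.
  apply (Comp_ext (f := fun a => nat_rect (fun _ => nat) 0 (fun m _ => m) (f a))).
  - intros a. now destruct (f a).
  - apply (Comp_nat_rect (f := fun _ : A => 0) (g := fun _ m _ => m)); comp.
Qed.

Lemma Comp_sub A `{encoding A} (f g : A -> nat) :
  Comp f -> Comp g -> Comp (fun a => f a - g a).
Proof.
  intros Hf Hg.
  apply (Comp_ext (f := fun a => nat_rect (fun _ => nat) (f a) (fun _ v => pred v) (g a))).
  - intros a. induction (g a) as [|n IH]; simpl; lia.
  - apply (Comp_nat_rect (g := fun _ _ v => pred v)); try (apply Comp_pred); comp.
Qed.

Lemma Comp_add A `{encoding A} (f g : A -> nat) :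
  Comp f -> Comp g -> Comp (fun a => f a + g a).
Proof.
  intros Hf Hg.
  apply (Comp_ext (f := fun a => nat_rect (fun _ => nat) (f a) (fun _ v => S v) (g a))).
  - intros a. induction (g a) as [|n IH]; simpl; lia.
  - apply (Comp_nat_rect (g := fun _ _ v => S v)); comp.
Qed.

Lemma Dec_zero A `{encoding A} (f : A -> nat) : Comp f -> Dec (fun a => f a = 0).
Proof.
  intros Hf. apply (Comp_ext (f := fun a => 1 - f a)).
  - intros a. unfold chi. destruct (excluded_middle_informative (f a = 0)); lia.
  - now auto using Comp_sub, Comp_const.
Qed.

Lemma Dec_le A `{encoding A} (f g : A -> nat) : Comp f -> Comp g -> Dec (fun a => f a <= g a).
Proof.
  intros Hf Hg. apply (Dec_ext (P := fun a => f a - g a = 0)); [intros; lia|].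
  now auto using Dec_zero, Comp_sub.
Qed.

Lemma Dec_lt A `{encoding A} (f g : A -> nat) : Comp f -> Comp g -> Dec (fun a => f a < g a).
Proof. intros Hf Hg. refine (Dec_le _ _); auto using Comp_S. Qed.

Lemma Dec_not A `{encoding A} (P : A -> Prop) : Dec P -> Dec (fun a => ~ P a).
Proof.
  intros HP. apply (Dec_ext (P := fun a => chi P a = 0)); [intros; apply chi_0|].
  now apply Dec_zero.
Qed.

Lemma Dec_or A `{encoding A} (P R : A -> Prop) : Dec P -> Dec R -> Dec (fun a => P a \/ R a).
Proof.
  intros HP HR. apply (Dec_ext (P := fun a => 1 <= chi P a + chi R a)).
  - intros a. unfold chi.
    destruct (excluded_middle_informative (P a)), (excluded_middle_informative (R a));
      intuition lia.
  - refine (Dec_le _ _); [apply Comp_const | now apply Comp_add].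
Qed.

Lemma Dec_and A `{encoding A} (P R : A -> Prop) : Dec P -> Dec R -> Dec (fun a => P a /\ R a).
Proof.
  intros HP HR. apply (Dec_ext (P := fun a => ~ (~ P a \/ ~ R a))).
  - intros a. tauto.
  - now auto using Dec_not, Dec_or.
Qed.

Lemma Dec_impl A `{encoding A} (P R : A -> Prop) : Dec P -> Dec R -> Dec (fun a => P a -> R a).
Proof.
  intros HP HR. apply (Dec_ext (P := fun a => ~ P a \/ R a)).
  - intros a. tauto.
  - now auto using Dec_not, Dec_or.
Qed.

Lemma Dec_iff A `{encoding A} (P R : A -> Prop) : Dec P -> Dec R -> Dec (fun a => P a <-> R a).
Proof. intros HP HR. refine (Dec_and _ _); now apply Dec_impl. Qed.

Lemma Dec_comp A B `{encoding A} `{encoding B} (P : B -> Prop) (f : A -> B) :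
  Dec P -> Comp f -> Dec (fun a => P (f a)).
Proof. intros HP Hf. exact (Comp_comp HP Hf). Qed.

Lemma Comp_code A B `{encoding A} `{encoding B} (f : A -> B) : Comp f -> Comp (fun a => code (f a)).
Proof. now apply Comp_recode. Qed.

Lemma Dec_eq A B `{encoding A} `{encoding B} (f g : A -> B) :
  Comp f -> Comp g -> Dec (fun a => f a = g a).
Proof.
  intros Hf Hg.
  apply (Dec_ext (P := fun a => code (f a) <= code (g a) /\ code (g a) <= code (f a))).
  - intros a. split; [|intros ->; lia]. intros ?. apply code_inj. lia.
  - refine (Dec_and _ _); refine (Dec_le _ _); now apply Comp_code.
Qed.

(** Unbounded search for the least code of a witness. Decidability makes each test effective,
    totality makes the search halt, and totality may be proved by any classical means. *)
Lemma Comp_choice A B `{encoding A} `{encoding B} (R : A -> B -> Prop) :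
  Dec (fun t => R (fst t) (snd t)) -> (forall a, exists b, R a b) ->
  exists f, Comp f /\ forall a, R a (f a).
Proof.
  intros HR Htot.
  pose (d := fun n => decode n : B).
  assert (Hd : forall n, code (d n) = n) by (intros; apply decodeK).
  assert (Hleast : forall a, exists n, R a (d n) /\ forall m, m < n -> ~ R a (d m)).
  { intros a. apply least_exists. destruct (Htot a) as [b Hb]. exists (code b).
    replace (d (code b)) with b; [exact Hb|]. apply code_inj. now rewrite Hd. }
  pose (m := fun a => proj1_sig (constructive_indefinite_description _ (Hleast a))).
  assert (Hm : forall a, R a (d (m a)) /\ forall k, k < m a -> ~ R a (d k)).
  { intros a. unfold m. now destruct (constructive_indefinite_description _ _). }
  exists (fun a => d (m a)). split; [|now intros a; apply Hm].
  (* [PMu] looks for a zero, so the negation of [R] is tested: its characteristic function vanishes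
     exactly at the witnesses. *)
  assert (HD : Dec (fun t : A * nat => ~ R (fst t) (d (snd t)))).
  { apply Dec_not. apply (Dec_comp (f := fun t : A * nat => (fst t, d (snd t))) HR).
    refine (Comp_pair _ _); [comp|].
    refine (Comp_recode (r := d) _ _); [exact Hd|]. comp. }
  destruct HD as [p Hp]. exists (PMu p). intros a y. rewrite Hd.
  rewrite (@mu_spec Q p (code a) (fun n => chi (fun t : A * nat => ~ R (fst t) (d (snd t))) (a, n))).
  - destruct (Hm a) as [H1 H2]. rewrite chi_0. simpl. split.
    + intros [H3 H4]. destruct (Nat.lt_trichotomy y (m a)) as [Hlt|[->|Hlt]]; [|easy|].
      * now apply H2 in Hlt.
      * specialize (H4 _ Hlt). rewrite chi_0 in H4. tauto.
    + intros ->. split; [tauto|]. intros z Hz. rewrite chi_0. simpl.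
      specialize (H2 z Hz). tauto.
  - intros n z. exact (Hp (a, n) z).
Qed.

(** The value is found by search for the only point of the graph over the argument. It serves to
    carry functions up to the jump, where decidability is what gets transported directly. *)
Lemma Comp_graph A B `{encoding A} `{encoding B} (f : A -> B) :
  Dec (fun t => snd t = f (fst t)) -> Comp f.
Proof.
  intros Hf. destruct (Comp_choice (R := fun a b => b = f a)) as (g & Hg & E); eauto.
  now apply (Comp_ext E).
Qed.

Lemma Comp_max A `{encoding A} (f g : A -> nat) :
  Comp f -> Comp g -> Comp (fun a => Nat.max (f a) (g a)).
Proof.
  intros Hf Hg. apply (Comp_ext (f := fun a => f a + (g a - f a))); [intros; lia|].
  now auto using Comp_add, Comp_sub.
Qed.

Lemma Dec_bounded A `{encoding A} (n : A -> nat) (P : A -> nat -> Prop) :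
  Comp n -> Dec (fun t => P (fst t) (snd t)) -> Dec (fun a => forall m, m < n a -> P a m).
Proof.
  intros Hn HP.
  (* The second entry of [t] is the truth value of the conjunction over the numbers below the
     first. *)
  pose (R := fun (a : A) (t : nat * nat) => snd t = 1 /\ P a (fst t)).
  apply (Comp_ext (f := fun a => nat_rect (fun _ => nat) 1 (fun m v => chi (R a) (m, v)) (n a))).
  - intros a. rewrite (chi_ext (R := fun k => forall m, m < k -> P a m) (b := n a)) by easy.
    induction (n a) as [|k IH]; simpl.
    + symmetry. apply chi_1. lia.
    + apply chi_ext. cbn [snd fst]. unfold R at 1. cbn [snd fst]. rewrite IH, chi_1. split.
      * intros [H1 H2] m Hm. destruct (Nat.eq_dec m k) as [->|]; [easy|]. apply H1. lia.
      * intros H1. split; [intros m Hm|]; apply H1; lia.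
  - apply (Comp_nat_rect (f := fun _ : A => 1) (g := fun a m v => chi (R a) (m, v)));
      comp.
    apply (Comp_ext (f := chi (fun t : A * (nat * nat) => R (fst t) (snd t)))).
    { intros t. now apply chi_ext; destruct t as (? & ? & ?). }
    apply Dec_and.
    + refine (Dec_eq _ _); comp.
    + apply (Dec_comp (f := fun t : A * (nat * nat) => (fst t, fst (snd t))) HP); comp.
Qed.

(** * Lists *)

Lemma Comp_cons A B `{encoding A} `{encoding B} (f : A -> B) (g : A -> list B) :
  Comp f -> Comp g -> Comp (fun a => f a :: g a).
Proof.
  intros Hf Hg. destruct (Comp_S (Comp_code (Comp_pair Hf Hg))) as [p Hp].
  exists p. exact Hp.
Qed.

(* [code (x :: r) = S (code (x, r))]: the last step of a recursion on the code of a list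
   finds its head and tail in the counter. *)
Lemma Comp_list_case A B C `{encoding A} `{encoding B} `{encoding C}
    (l : A -> list B) (f : A -> C) (g : A * (B * list B) -> C) :
  Comp l -> Comp f -> Comp g ->
  Comp (fun a => match l a with nil => f a | x :: r => g (a, (x, r)) end).
Proof.
  intros Hl Hf Hg.
  apply (Comp_ext (f := fun a => nat_rect (fun _ => C) (f a)
    (fun m _ => g (a, decode m)) (code (l a)))).
  - intros a. destruct (l a) as [|x r]; [reflexivity|].
    change (code (x :: r)) with (S (code (x, r))). cbn [nat_rect].
    now rewrite codeK.
  - apply (Comp_nat_rect (g := fun a m _ => g (a, decode m))); auto using Comp_code.
    apply (Comp_comp (f := fun t : A * (nat * C) => (fst t, decode (fst (snd t)))) Hg).
    refine (Comp_pair _ _); [comp|].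
    refine (Comp_recode (r := @decode (B * list B) _) _ _); [apply decodeK | comp].
Qed.

(** Recursion is available on numbers only, so the fold runs as a machine whose state is the
    remaining list with the accumulator. It makes as many steps as the code of the list: this is at
    least the length, and an empty list leaves the state fixed. *)
Lemma Comp_fold_left A B C `{encoding A} `{encoding B} `{encoding C}
    (g : A -> C -> B -> C) (l : A -> list B) (c : A -> C) :
  Comp (fun t => g (fst t) (fst (snd t)) (snd (snd t))) -> Comp l -> Comp c ->
  Comp (fun a => fold_left (g a) (l a) (c a)).
Proof.
  intros Hg Hl Hc.
  pose (step := fun (a : A) (s : list B * C) =>
    match fst s with
    | nil => s
    | x :: r => (r, g a (snd s) x)
    end).
  pose (run := fun a s n => nat_rect (fun _ => (list B * C)%type) s (fun _ => step a) n).
  apply (Comp_ext (f := fun a => snd (run a (l a, c a) (code (l a))))).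
  - intros a.
    assert (Hdone : forall n k, run a (nil, k) n = (nil, k)).
    { intros n k. induction n as [|n IH]; [easy|]. unfold run in *. simpl. now rewrite IH. }
    assert (Hshift : forall n s, run a s (S n) = run a (step a s) n).
    { intros n s. induction n as [|n IH]; [reflexivity|].
      change (step a (run a s (S n)) = step a (run a (step a s) n)). now rewrite IH. }
    pose proof (length_le_code (l a)) as Hle. revert Hle.
    generalize (code (l a)) as n. generalize (c a). induction (l a) as [|x r IH]; intros k n Hn.
    + now rewrite Hdone.
    + destruct n as [|n]; simpl in Hn; [lia|]. rewrite Hshift. apply IH. lia.
  - refine (Comp_snd _).
    apply (Comp_nat_rect (f := fun a => (l a, c a)) (g := fun a _ => step a));
      try (apply Comp_code); comp.
    apply (Comp_list_case (l := fun t : A * (nat * (list B * C)) => fst (snd (snd t)))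
      (f := fun t => snd (snd t))
      (g := fun u => (snd (snd u), g (fst (fst u)) (snd (snd (snd (fst u)))) (fst (snd u)))));
      comp.
    apply (Comp_comp (f := fun u : (A * (nat * (list B * C))) * (B * list B) =>
        (fst (fst u), (snd (snd (snd (fst u))), fst (snd u)))) Hg).
    comp.
Qed.

Lemma Comp_rev A B `{encoding A} `{encoding B} (l : A -> list B) :
  Comp l -> Comp (fun a => rev (l a)).
Proof.
  intros Hl.
  apply (Comp_ext (f := fun a => fold_left (fun r x => x :: r) (l a) nil)).
  - intros a. rewrite <- fold_left_rev_right.
    induction (rev (l a)); simpl; congruence.
  - apply (Comp_fold_left (g := fun _ r x => x :: r)); auto using Comp_const, Comp_id.
    refine (Comp_cons _ _); comp.
Qed.

Lemma Comp_app A B `{encoding A} `{encoding B} (l m : A -> list B) :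
  Comp l -> Comp m -> Comp (fun a => l a ++ m a).
Proof.
  intros Hl Hm.
  apply (Comp_ext (f := fun a => fold_left (fun r x => x :: r) (rev (l a)) (m a))).
  - intros a. rewrite <- fold_left_rev_right, rev_involutive.
    induction (l a); simpl; congruence.
  - apply (Comp_fold_left (g := fun _ r x => x :: r)); auto using Comp_rev.
    refine (Comp_cons _ _); comp.
Qed.

Lemma Comp_map A B C `{encoding A} `{encoding B} `{encoding C}
    (f : A -> B -> C) (l : A -> list B) :
  Comp (fun t => f (fst t) (snd t)) -> Comp l -> Comp (fun a => map (f a) (l a)).
Proof.
  intros Hf Hl.
  apply (Comp_ext (f := fun a => fold_left (fun r x => f a x :: r) (rev (l a)) nil)).
  - intros a. rewrite <- fold_left_rev_right, rev_involutive.
    induction (l a); simpl; congruence.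
  - apply (Comp_fold_left (g := fun a r x => f a x :: r)); auto using Comp_const, Comp_id, Comp_rev.
    refine (Comp_cons _ _); [|comp].
    apply (Comp_comp (f := fun t : A * (list C * B) => (fst t, snd (snd t))) Hf).
    comp.
Qed.

Lemma Comp_length A B `{encoding A} `{encoding B} (l : A -> list B) :
  Comp l -> Comp (fun a => length (l a)).
Proof.
  intros Hl. apply (Comp_ext (f := fun a => fold_left (fun n _ => S n) (l a) 0)).
  - intros a. rewrite <- fold_left_rev_right, <- length_rev.
    induction (rev (l a)); simpl; congruence.
  - apply (Comp_fold_left (g := fun _ n _ => S n)); auto using Comp_const, Comp_id.
    comp.
Qed.

Lemma Comp_list_max A `{encoding A} (l : A -> list nat) :
  Comp l -> Comp (fun a => list_max (l a)).
Proof.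
  intros Hl. apply (Comp_ext (f := fun a => fold_left (fun n m => Nat.max m n) (rev (l a)) 0)).
  - intros a. rewrite <- fold_left_rev_right, rev_involutive. reflexivity.
  - apply (Comp_fold_left (g := fun _ n m => Nat.max m n)); auto using Comp_const, Comp_id, Comp_rev.
    refine (Comp_max _ _); comp.
Qed.

Lemma Comp_nth A B `{encoding A} `{encoding B} (i : A -> nat) (l : A -> list B) (d : B) :
  Comp i -> Comp l -> Comp (fun a => nth (i a) (l a) d).
Proof.
  intros Hi Hl.
  pose (drop := fun a => nat_rect (fun _ => list B) (l a) (fun _ => @tl B) (i a)).
  apply (Comp_ext (f := fun a => match drop a with nil => d | x :: r => x end)).
  - intros a.
    assert (E : drop a = skipn (i a) (l a)).
    { unfold drop. induction (i a) as [|n IH]; [reflexivity|]. cbn [nat_rect].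
      rewrite IH. clear. revert n.
      induction (l a) as [|x r IH]; intros [|n]; simpl; try reflexivity. apply IH. }
    rewrite E. clear. generalize (i a).
    induction (l a) as [|x r IH]; intros [|n]; simpl; try reflexivity. apply IH.
  - apply (Comp_list_case (l := drop) (f := fun _ => d) (g := fun u => fst (snd u)));
      comp.
    apply (Comp_nat_rect (g := fun _ _ => @tl B)); comp.
    apply (Comp_list_case (l := fun t : A * (nat * list B) => snd (snd t))
      (f := fun _ => nil) (g := fun u => snd (snd u))); comp.
Qed.

Lemma Dec_Forall A B `{encoding A} `{encoding B} (P : A -> B -> Prop) (l : A -> list B) :
  Dec (fun t => P (fst t) (snd t)) -> Comp l -> Dec (fun a => Forall (P a) (l a)).
Proof.
  intros HP Hl.
  (* The sum counts the entries at which [P] fails. *)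
  apply (Dec_ext (P := fun a => fold_left (fun n x => n + x) (map (fun b => chi (fun t => ~ P (fst t) (snd t)) (a, b)) (l a)) 0 = 0)).
  - intros a.
    enough (G : forall m, fold_left (fun n x => n + x)
      (map (fun b => chi (fun t => ~ P (fst t) (snd t)) (a, b)) (l a)) m = 0 <-> m = 0 /\ Forall (P a) (l a)).
    { rewrite G. tauto. }
    induction (l a) as [|x r IH]; intros m; simpl.
    + intuition.
    + rewrite IH, Forall_cons_iff.
      pose proof (chi_0 (fun t => ~ P (fst t) (snd t)) (a, x)) as E. simpl in E.
      split.
      * intros [E1 F]. assert (m = 0) by lia. assert (P a x) by (apply NNPP, E; lia). auto.
      * intros (-> & Px & F). split; [|exact F]. simpl. apply E. tauto.
  - apply Dec_zero. apply (Comp_fold_left (g := fun _ n x => n + x)); auto using Comp_const, Comp_id.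
    + apply Comp_add; comp.
    + apply (Comp_map (f := fun a b => chi (fun t => ~ P (fst t) (snd t)) (a, b))); [|exact Hl].
      apply (Comp_ext (f := chi (fun t => ~ P (fst t) (snd t)))); [now intros []|].
      now apply Dec_not.
Qed.

Lemma Dec_In A B `{encoding A} `{encoding B} (f : A -> B) (l : A -> list B) :
  Comp f -> Comp l -> Dec (fun a => In (f a) (l a)).
Proof.
  intros Hf Hl. apply (Dec_ext (P := fun a => ~ Forall (fun x => f a <> x) (l a))).
  - intros a. rewrite Forall_forall. split.
    + intros N. apply NNPP. intros N'. apply N. intros x Hx <-. tauto.
    + intros Hin F. now apply (F _ Hin).
  - apply Dec_not, (Dec_Forall (P := fun a x => f a <> x)); [|exact Hl]. apply Dec_not. refine (Dec_eq _ _).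
    + refine (Comp_comp (f := fst) Hf _). comp.
    + comp.
Qed.

(** * Transfer to indices *)

Lemma Dec_decode A `{encoding A} (P : A -> Prop) : Dec P -> Dec (fun x : nat => P (decode x)).
Proof.
  intros HP. refine (Dec_comp (f := fun x : nat => decode x) HP _).
  refine (Comp_recode (r := @decode A _) _ _); [apply decodeK | comp].
Qed.

Lemma Dec_computable_set (P : nat -> Prop) : Dec P -> computable_set (Some Q) P.
Proof.
  intros [p Hp]. exists (goedel p), p. split; [reflexivity|]. split; [exact I|].
  intros x y. rewrite (Hp x y). simpl. unfold chi.
  destruct (excluded_middle_informative (P x)); intuition.
Qed.

(** A search that may diverge: its test is total, so halting amounts to the existence of a witness.
    The jump is later asked about such programs. *)
Lemma Dec_ce_prog A B `{encoding A} `{encoding B} (P : A -> B -> Prop) :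
  Dec (fun t => P (fst t) (snd t)) ->
  exists p, forall a, (exists y, eval (Some Q) p (code a) y) <-> exists b, P a b.
Proof.
  intros HP. destruct (Dec_not HP) as [p Hp]. exists (PMu p). intros a.
  assert (S : forall n y, eval (Some Q) p ⟨code a, n⟩ y <->
    y = chi (fun t => ~ P (fst t) (snd t)) (a, decode n)).
  { intros n y. specialize (Hp (a, decode n) y). simpl in Hp. rewrite decodeK in Hp. exact Hp. }
  split.
  - intros [y Hy]. apply (mu_spec S) in Hy as [Hy _]. exists (decode y).
    apply chi_0 in Hy. now apply NNPP in Hy.
  - intros [b Hb].
    destruct (@least_exists (fun n => P a (decode n))) as (n & Hn & Hmin).
    { exists (code b). now rewrite codeK. }
    exists n. apply (mu_spec S). split.
    + apply chi_0. simpl. tauto.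
    + intros z Hz. rewrite chi_0. simpl. specialize (Hmin z Hz). tauto.
Qed.

Lemma Dec_ce_set (P : nat -> Prop) : Dec P -> ce_set (Some Q) P.
Proof.
  intros HP.
  destruct (@Dec_ce_prog nat nat _ _ (fun x _ => P x)) as [p Hp].
  { refine (Dec_comp (f := fst) HP _); comp. }
  exists (goedel p), (eval (Some Q) p). split; [apply index_goedel|].
  intros x. simpl in Hp. rewrite Hp. split; [exists 0; assumption | now intros []].
Qed.

(** An index of a partial map must diverge outside its domain. The value is paired with a search
    that halts only on [P], and then projected out. *)
Lemma restrict_prog A B `{encoding A} `{encoding B} (P : A -> Prop) (f : A -> B) :
  Dec P -> Comp f ->
  exists p, forall a y, eval (Some Q) p (code a) y <-> P a /\ y = code (f a).
Proof.
  intros HP [p Hp].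
  destruct (@Dec_ce_prog A nat _ _ (fun a _ => P a)) as [q Hq].
  { refine (Dec_comp (f := fst) HP _); comp. }
  exists (PComp PFst (PPair p q)). intros a y. specialize (Hq a). simpl. split.
  - intros (u & (v & w & Hv & Hw & ->) & ->). rewrite Cantor.cancel_of_to. simpl.
    apply Hp in Hv. split; [|exact Hv]. now destruct (proj1 Hq (ex_intro _ w Hw)).
  - intros [Pa ->]. destruct (proj2 Hq) as [w Hw]; [now exists 0|].
    exists ⟨code (f a), w⟩. rewrite Cantor.cancel_of_to. split; [|reflexivity].
    exists (code (f a)), w. split; [now apply Hp | easy].
Qed.

Lemma Comp_computable_map A B `{encoding A} `{encoding B} (P : A -> Prop) (f : A -> B) :
  Dec P -> Comp f ->
  computable_map (Some Q) (fun x => exists a, x = code a /\ P a) (fun x => code (f (decode x))).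
Proof.
  intros HP Hf. destruct (restrict_prog HP Hf) as [p Hp].
  exists (goedel p), p. split; [reflexivity|]. split; [exact I|].
  intros x y. destruct (code_surj (A := A) x) as [a <-]. rewrite Hp, codeK.
  assert (E : (exists a', code a = code a' /\ P a') <-> P a).
  { split; [|eauto]. intros (a' & Ea & Pa). now apply code_inj in Ea as ->. }
  now rewrite E.
Qed.

(* [goedel] tags [PZero] with 0, [PSucc] with 1 and [PComp] with 6. *)
Lemma Comp_goedel_const A B `{encoding A} `{encoding B} (f : A -> B) :
  Comp f -> Comp (fun a => goedel (const_prog (code (f a)))).
Proof.
  intros Hf.
  apply (Comp_ext (f := fun a => nat_rect (fun _ => nat) (code (0, 0))
     (fun _ v => code (6, (code (1, 0), v))) (code (f a)))).
  - intros a. induction (code (f a)) as [|n IH]; [reflexivity|]. cbn [nat_rect].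
    now rewrite IH.
  - apply (Comp_nat_rect (f := fun _ : A => code (0, 0)) (g := fun _ _ v => code (6, (code (1, 0), v))));
      try (apply Comp_code); comp.
Qed.

(** The s-m-n theorem. The parameter is wired in by a constant program, whose number is computable
    from it; [PPair PFst PSnd] passes the remaining argument through. *)
Lemma s_m_n_index A B C `{encoding A} `{encoding B} `{encoding C}
    (P : A -> B -> Prop) (f : A -> B -> C) :
  Dec (fun t => P (fst t) (snd t)) -> Comp (fun t => f (fst t) (snd t)) ->
  exists e : A -> nat, Comp e /\
    forall a, index (Some Q) (e a) (fun x y => exists b, x = code b /\ P a b /\ y = code (f a b)).
Proof.
  intros HP Hf. destruct (restrict_prog HP Hf) as [p Hp].
  pose (s := fun a : A => PComp p (PPair (const_prog (code a)) (PPair PFst PSnd))).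
  exists (fun a => goedel (s a)). split.
  - apply (Comp_ext (f := fun a => code (6, (goedel p,
       code (5, (goedel (const_prog (code a)), goedel (PPair PFst PSnd))))))); [reflexivity|].
    refine (Comp_code (Comp_pair _ _)); [apply Comp_const|].
    refine (Comp_pair _ _); [apply Comp_const|]. refine (Comp_code (Comp_pair _ _)); [apply Comp_const|].
    refine (Comp_pair _ _); [apply Comp_goedel_const, Comp_id | apply Comp_const].
  - intros a. exists (s a). split; [reflexivity|]. split; [exact I|].
    intros x y. destruct (code_surj (A := B) x) as [b <-].
    assert (E : (exists b', code b = code b' /\ P a b' /\ y = code (f a b')) <->
      P a b /\ y = code (f a b)).
    { split; [|eauto]. intros (b' & Eb & Pb). now apply code_inj in Eb as ->. }
    rewrite E, <- (Hp (a, b)). simpl. split.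
    + intros (u & (v & w & Hv & (w1 & w2 & -> & -> & ->) & ->) & Hy).
      apply eval_const_prog in Hv. subst v.
      now rewrite <- surjective_pairing, Cantor.cancel_to_of in Hy.
    + intros Hy. eexists. split; [|exact Hy]. exists (code a), (code b).
      split; [now apply eval_const_prog|]. split; [|reflexivity].
      exists (fst (Cantor.of_nat (code b))), (snd (Cantor.of_nat (code b))).
      now rewrite <- surjective_pairing, Cantor.cancel_to_of.
Qed.

End Functions.

(** * The jump *)

Lemma jump_goedel Q p : jump Q (goedel p) <-> exists y, eval (Some Q) p (goedel p) y.
Proof.
  split.
  - intros (G & y & (q & E & _ & HG) & Hy). apply goedel_inj in E as ->.
    exists y. now apply HG.
  - intros [y Hy]. exists (eval (Some Q) p), y. split; [apply index_goedel | exact Hy].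
Qed.

Lemma Dec_oracle Q : Dec Q (fun x => Q x).
Proof.
  exists POracle. intros a y. simpl. unfold chi.
  destruct (excluded_middle_informative (Q a)); intuition.
Qed.

(* One query to the jump decides whether [p] halts at [n], so no universal program is needed. *)
Lemma jump_comp_const Q p q n : (forall y, eval (Some Q) q (goedel (PComp p q)) y <-> y = n) ->
  (jump Q (goedel (PComp p q)) <-> exists y, eval (Some Q) p n y).
Proof.
  intros Hq. rewrite jump_goedel.
  cbn [eval].
  split.
  - intros (y & u & Hu & Hy). apply Hq in Hu. subst. eauto.
  - intros [y Hy]. exists y, n. split; [now apply Hq | exact Hy].
Qed.

(** The query is the number of the program with index [e a] composed with the constant [x a]. It is
    assembled from these two numbers alone, so the index may vary with [a], and the composed program
    ignores the input that the jump feeds to it. *)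
Lemma Dec_halting Q A `{encoding A} (P : A -> Prop) (e x : A -> nat) :
  Comp (jump Q) e -> Comp (jump Q) x ->
  (forall a, exists G, index (Some Q) (e a) G /\ (P a <-> exists y, G (x a) y)) ->
  Dec (jump Q) P.
Proof.
  intros He Hx HP.
  apply (Dec_ext (P := fun a => jump Q (code (6, (e a, goedel (const_prog (x a))))))).
  - intros a. destruct (HP a) as (G & (p & E & _ & HG) & ->). rewrite <- E.
    change (code (6, (goedel p, goedel (const_prog (x a))))) with (goedel (PComp p (const_prog (x a)))).
    rewrite (jump_comp_const (n := x a)) by (intros; apply eval_const_prog).
    split; intros [y Hy]; exists y; now apply HG.
  - apply (Dec_comp (f := fun a => code (6, (e a, goedel (const_prog (x a))))) (Dec_oracle _)).
    refine (Comp_code (Comp_pair _ _)); [apply Comp_const|].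
    refine (Comp_pair _ _); [exact He|]. exact (Comp_goedel_const Hx).
Qed.

Lemma Dec_jump_exists Q A B `{encoding A} `{encoding B} (P : A -> B -> Prop) :
  Dec Q (fun t => P (fst t) (snd t)) -> Dec (jump Q) (fun a => exists b, P a b).
Proof.
  intros HP. destruct (Dec_ce_prog HP) as [p Hp].
  apply (Dec_halting (Q := Q) (e := fun _ => goedel p) (x := fun a => code a)).
  - apply Comp_const.
  - apply Comp_code, Comp_id.
  - intros a. exists (eval (Some Q) p). split; [apply index_goedel|]. now rewrite Hp.
Qed.

Lemma Dec_jump Q A `{encoding A} (P : A -> Prop) : Dec Q P -> Dec (jump Q) P.
Proof.
  intros HP. apply (Dec_ext (P := fun a => exists _ : nat, P a)).
  - intros a. split; [now intros []|]. exists 0. assumption.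
  - apply (Dec_jump_exists (P := fun a (_ : nat) => P a)).
    refine (Dec_comp (f := fst) HP _); comp.
Qed.

Lemma Comp_jump Q A B `{encoding A} `{encoding B} (f : A -> B) : Comp Q f -> Comp (jump Q) f.
Proof.
  intros Hf. apply Comp_graph, Dec_jump. refine (Dec_eq _ _); [comp|].
  refine (Comp_comp (f := fst) Hf _); comp.
Qed.

Ltac comp_hook ::=
  lazymatch goal with
  | |- @Comp _ _ _ _ _ (fun x => @?f x :: @?g x) => refine (Comp_cons _ _)
  | |- @Comp _ _ _ _ _ (fun x => @?f x ++ @?g x) => refine (Comp_app _ _)
  | |- @Comp _ _ _ _ _ (fun x => map (@?f x) (@?l x)) => refine (Comp_map (f := f) _ _)
  | |- @Comp _ _ _ _ _ (fun x => nth (@?f x) (@?l x) _) => refine (Comp_nth _ _ _)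
  | |- @Comp _ _ _ _ _ (fun x => length (@?l x)) => refine (Comp_length _)
  | |- @Comp _ _ _ _ _ (fun x => list_max (@?l x)) => refine (Comp_list_max _)
  | |- @Comp _ _ _ _ _ (fun x => Nat.max (@?f x) (@?g x)) => refine (Comp_max _ _)
  | |- @Comp _ _ _ _ _ (fun x => @code _ _ (@?f x)) => refine (Comp_code _)
  end.

Ltac dec_hook := fail.
Ltac dec_step :=
  lazymatch goal with
  | |- @Dec _ _ _ (fun x => ~ @?P x) => refine (Dec_not (P := P) _)
  | |- @Dec _ _ _ (fun x => @?P x /\ @?R x) => refine (Dec_and (P := P) (R := R) _ _)
  | |- @Dec _ _ _ (fun x => @?P x \/ @?R x) => refine (Dec_or (P := P) (R := R) _ _)
  | |- @Dec _ _ _ (fun x => @?P x <-> @?R x) => refine (Dec_iff (P := P) (R := R) _ _)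
  | |- @Dec _ _ _ (fun x => @?P x -> @?R x) => refine (Dec_impl (P := P) (R := R) _ _)
  | |- @Dec _ _ _ (fun x => @?f x = @?g x) => refine (Dec_eq _ _)
  | |- @Dec _ _ _ (fun x => @?f x <= @?g x) => refine (Dec_le _ _)
  | |- @Dec _ _ _ (fun x => @?f x < @?g x) => refine (Dec_lt _ _)
  | |- @Dec _ _ _ (fun x => In (@?f x) (@?l x)) => refine (Dec_In _ _)
  | |- @Dec _ _ _ (fun x => Forall (@?P x) (@?l x)) => refine (Dec_Forall (P := P) _ _)
  end.
Ltac dec := cbv beta; repeat (first [assumption | dec_hook | dec_step]; cbv beta); comp.

(** * Terms *)

Lemma term_nested_ind (P : term -> Prop) :
  (forall i, P (Var i)) ->
  (forall m ts, (forall t, In t ts -> P t) -> P (App m ts)) ->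
  forall t, P t.
Proof.
  intros HV HA. fix IH 1. intros [i|m ts]; [apply HV|].
  apply HA. induction ts as [|t ts IHts]; intros u Hu; [destruct Hu|].
  destruct Hu as [<-|Hu]; [apply IH | now apply IHts].
Qed.

Fixpoint term_subst (s : list term) (t : term) : term :=
  match t with
  | Var i => nth i s (Var 0)
  | App m ts => App m (map (term_subst s) ts)
  end.

Definition subst_atomic (s : list term) (phi : atomic) : atomic :=
  match phi with
  | AEq t u => AEq (term_subst s t) (term_subst s u)
  | ARel n ts => ARel n (map (term_subst s) ts)
  end.

Lemma is_term_subst L k s t :
  Forall (is_term L k) s -> is_term L (length s) t -> is_term L k (term_subst s t).
Proof.
  intros Hs. induction t as [i|m ts IH] using term_nested_ind; intros Ht; inversion Ht; subst; simpl.
  - rewrite Forall_forall in Hs. now apply Hs, nth_In.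
  - constructor; [assumption | now rewrite length_map|].
    intros u Hu. apply in_map_iff in Hu as (v & <- & Hv). auto.
Qed.

Lemma is_atomic_subst L k s phi :
  Forall (is_term L k) s -> is_atomic L (length s) phi -> is_atomic L k (subst_atomic s phi).
Proof.
  intros Hs. destruct phi as [t u|n ts]; simpl.
  - intros [Ht Hu]. split; now apply is_term_subst.
  - intros (Hn & Hl & Ht). split; [assumption|]. split; [now rewrite length_map|].
    intros u Hu. apply in_map_iff in Hu as (v & <- & Hv). apply is_term_subst; auto.
Qed.

Lemma map_value_app_l L U (A : structure L U) a b :
  map (value A (a ++ b)) (map Var (seq 0 (length a))) = a.
Proof.
  rewrite map_map. simpl. generalize (fn A 0 nil) as d. intros d.
  apply nth_ext with (d := d) (d' := d); rewrite length_map, length_seq; [easy|].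
  intros n Hn. rewrite nth_indep with (d' := nth 0 (a ++ b) d) by now rewrite length_map, length_seq.
  rewrite (map_nth (fun i => nth i (a ++ b) d)), seq_nth by easy. now apply app_nth1.
Qed.

Lemma map_value_app_r L U (A : structure L U) a b :
  map (value A (a ++ b)) (map Var (seq (length a) (length b))) = b.
Proof.
  rewrite map_map. simpl. generalize (fn A 0 nil) as d. intros d.
  apply nth_ext with (d := d) (d' := d); rewrite length_map, length_seq; [easy|].
  intros n Hn. rewrite nth_indep with (d' := nth 0 (a ++ b) d) by now rewrite length_map, length_seq.
  rewrite (map_nth (fun i => nth i (a ++ b) d)), seq_nth by easy.
  rewrite app_nth2 by lia. f_equal. lia.
Qed.

Section Values.
Context {L : language} {U : Type} (A : structure L U).

Lemma value_subst a s t : is_term L (length s) t ->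
  value A a (term_subst s t) = value A (map (value A a) s) t.
Proof.
  induction t as [i|m ts IH] using term_nested_ind; intros Ht; inversion Ht; subst; simpl.
  - now rewrite nth_indep with (d' := value A a (Var 0)), map_nth by now rewrite length_map.
  - f_equal. rewrite map_map. apply map_ext_in. auto.
Qed.

Lemma sat_subst a s phi : is_atomic L (length s) phi ->
  (sat A a (subst_atomic s phi) <-> sat A (map (value A a) s) phi).
Proof.
  destruct phi as [t u|n ts]; simpl.
  - intros [Ht Hu]. now rewrite !value_subst.
  - intros (_ & _ & Ht). rewrite map_map.
    now rewrite (map_ext_in _ _ ts (fun t H => value_subst a (Ht t H))).
Qed.

Lemma value_dom a t : Forall (dom A) a -> is_term L (length a) t -> dom A (value A a t).
Proof.
  intros Ha. induction t as [i|m ts IH] using term_nested_ind; intros Ht; inversion Ht; subst; simpl.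
  - rewrite Forall_forall in Ha. now apply Ha, nth_In.
  - apply fn_dom; [assumption | now rewrite length_map|].
    apply Forall_map, Forall_forall. auto.
Qed.

Lemma values_dom a s : Forall (dom A) a -> Forall (is_term L (length a)) s ->
  Forall (dom A) (map (value A a) s).
Proof.
  intros Ha Hs. apply Forall_map. revert Hs. apply Forall_impl. intros t. now apply value_dom.
Qed.

Lemma values_exist (P : U -> Prop) a b :
  (forall x, P x -> exists t, is_term L (length a) t /\ value A a t = x) ->
  Forall P b -> exists s, Forall (is_term L (length a)) s /\ map (value A a) s = b.
Proof.
  intros H Hb. induction Hb as [|x b Px _ (s & Hs & E)].
  - exists nil. easy.
  - destruct (H x Px) as (t & Ht & E'). exists (t :: s). simpl. split; [now constructor | congruence].
Qed.

Lemma cl_value a x : cl A a x -> exists t, is_term L (length a) t /\ value A a t = x.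
Proof.
  induction 1 as [x Hx|m b Hm Hb _ IH].
  - destruct (In_nth _ _ (fn A 0 nil) Hx) as (i & Hi & E).
    exists (Var i). split; [now constructor | exact E].
  - apply Forall_forall in IH.
    destruct (@values_exist _ a b (fun x H => H) IH) as (s & Hs & E).
    exists (App m s). rewrite Forall_forall in Hs. split.
    + constructor; auto. now rewrite <- Hb, <- E, length_map.
    + simpl. now rewrite E.
Qed.

Lemma value_cl a t : is_term L (length a) t -> cl A a (value A a t).
Proof.
  induction t as [i|m ts IH] using term_nested_ind; intros Ht; inversion Ht; subst; simpl.
  - now apply cl_gen, nth_In.
  - apply cl_fn; [assumption | now rewrite length_map|].
    intros x Hx. apply in_map_iff in Hx as (t & <- & Hin). auto.
Qed.

Lemma cl_values a b : Forall (cl A a) b ->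
  exists s, Forall (is_term L (length a)) s /\ map (value A a) s = b.
Proof. apply values_exist. apply cl_value. Qed.

Lemma incl_values a b : incl b a ->
  exists s, Forall (is_term L (length a)) s /\ map (value A a) s = b.
Proof. intros H. apply cl_values, Forall_forall. intros x Hx. now apply cl_gen, H. Qed.

Lemma cl_dom a x : Forall (dom A) a -> cl A a x -> dom A x.
Proof. intros Ha Hx. destruct (cl_value Hx) as (t & Ht & <-). now apply value_dom. Qed.

Lemma map_value_vars a : map (value A a) (map Var (seq 0 (length a))) = a.
Proof.
  rewrite <- (app_nil_r a) at 1. apply map_value_app_l.
Qed.

End Values.

(** * The relation [simeq] *)

Lemma simeq_refl L U (A : structure L U) a : simeq A a A a.
Proof. now split. Qed.

Lemma simeq_sym L U V (A : structure L U) (B : structure L V) a b :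
  simeq A a B b -> simeq B b A a.
Proof. intros [Hl H]. split; [easy|]. intros phi. rewrite <- Hl. intros Hp. symmetry. auto. Qed.

Lemma simeq_trans L U V W (A : structure L U) (B : structure L V) (D : structure L W) a b c :
  simeq A a B b -> simeq B b D c -> simeq A a D c.
Proof.
  intros [Hl H] [Hl' H']. split; [congruence|]. intros phi Hp.
  rewrite H by exact Hp. apply H'. now rewrite <- Hl.
Qed.

Lemma simeq_length L U V (A : structure L U) (B : structure L V) a b :
  simeq A a B b -> length a = length b.
Proof. now intros []. Qed.

(** An atomic formula about the values of [s] is, after substitution, an atomic formula about the
    tuple itself. Projections, swaps and repetitions of coordinates are the instances where [s]
    consists of variables. *)
Lemma simeq_values L U V (A : structure L U) (B : structure L V) a b s :
  simeq A a B b -> Forall (is_term L (length a)) s ->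
  simeq A (map (value A a) s) B (map (value B b) s).
Proof.
  intros [Hl H] Hs. split; [now rewrite !length_map|]. intros phi. rewrite length_map. intros Hp.
  rewrite <- !sat_subst by exact Hp. now apply H, is_atomic_subst.
Qed.

Lemma simeq_value_eq L U V (A : structure L U) (B : structure L V) a b t u :
  simeq A a B b -> is_term L (length a) t -> is_term L (length a) u ->
  (value A a t = value A a u <-> value B b t = value B b u).
Proof. intros [_ H] Ht Hu. now apply (H (AEq t u)). Qed.

Lemma simeq_values_eq L U V (A : structure L U) (B : structure L V) a b s s' :
  simeq A a B b -> Forall (is_term L (length a)) s -> Forall (is_term L (length a)) s' ->
  map (value A a) s = map (value A a) s' -> map (value B b) s = map (value B b) s'.
Proof.
  intros H Hs. revert s'. induction Hs as [|t s Ht _ IH]; intros [|t' s'] Hs' E;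
    simpl in *; try discriminate; [reflexivity|].
  apply Forall_cons_iff in Hs' as [Ht' Hs']. injection E as E E'.
  f_equal; [now apply (simeq_value_eq H) | now apply IH].
Qed.

Lemma simeq_app_swap L U V (A : structure L U) (B : structure L V) a1 a2 b1 b2 :
  simeq A (a1 ++ a2) B (b1 ++ b2) -> length a1 = length b1 -> simeq A (a2 ++ a1) B (b2 ++ b1).
Proof.
  intros H Hl.
  assert (Hl2 : length a2 = length b2).
  { apply simeq_length in H. rewrite !length_app in H. lia. }
  set (s := map Var (seq (length a1) (length a2)) ++ map Var (seq 0 (length a1))).
  assert (Hs : Forall (is_term L (length (a1 ++ a2))) s).
  { apply Forall_app. rewrite length_app.
    split; apply Forall_map, Forall_forall; intros i Hi; apply in_seq in Hi; constructor; lia. }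
  generalize (simeq_values H Hs). unfold s. rewrite !map_app, map_value_app_l, map_value_app_r.
  now rewrite Hl, Hl2, map_value_app_l, map_value_app_r.
Qed.

Lemma simeq_app_l L U V (A : structure L U) (B : structure L V) a1 a2 b1 b2 :
  simeq A (a1 ++ a2) B (b1 ++ b2) -> length a1 = length b1 -> simeq A a1 B b1.
Proof.
  intros H Hl.
  rewrite <- (map_value_app_l A a1 a2), <- (map_value_app_l B b1 b2), <- Hl.
  apply (simeq_values H). apply Forall_map, Forall_forall. intros i Hi.
  apply in_seq in Hi. constructor. rewrite length_app. lia.
Qed.

Lemma simeq_app_r L U V (A : structure L U) (B : structure L V) a1 a2 b1 b2 :
  simeq A (a1 ++ a2) B (b1 ++ b2) -> length a1 = length b1 -> simeq A a2 B b2.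
Proof.
  intros H Hl. apply (simeq_app_l (a2 := a1) (b2 := b1)); [now apply simeq_app_swap|].
  apply simeq_length in H. rewrite !length_app in H. lia.
Qed.

(** Pairs keep matching coordinates together, so they may be reordered, repeated or dropped freely.
    The states of the back-and-forth are such lists. *)
Lemma simeq_pairs L U V (A : structure L U) (B : structure L V) (l m : list (U * V)) :
  simeq A (map fst l) B (map snd l) -> incl m l -> simeq A (map fst m) B (map snd m).
Proof.
  intros H Hm.
  assert (G : exists s, Forall (is_term L (length l)) s /\
     map (value A (map fst l)) s = map fst m /\ map (value B (map snd l)) s = map snd m).
  { induction m as [|[x y] m IH]; [now exists nil|].
    apply incl_cons_inv in Hm as [Hx Hm]. destruct (IH Hm) as (s & Hs & E & E').
    destruct (In_nth _ _ (fn A 0 nil, fn B 0 nil) Hx) as (i & Hi & Ei).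
    exists (Var i :: s). split; [constructor; [now constructor | easy]|]. simpl.
    pose proof (map_nth fst l (fn A 0 nil, fn B 0 nil) i) as E1.
    pose proof (map_nth snd l (fn A 0 nil, fn B 0 nil) i) as E2.
    rewrite Ei in E1, E2. simpl in E1, E2. split; congruence. }
  destruct G as (s & Hs & <- & <-). apply (simeq_values H). now rewrite length_map.
Qed.

Lemma simeq_rel L U V (A : structure L U) (B : structure L V) n a b :
  simeq A a B b -> rel_sym L n -> length a = arity L n -> (rel A n a <-> rel B n b).
Proof.
  intros [Hl H] Hn Ha.
  rewrite <- (map_value_vars A a) at 1. rewrite <- (map_value_vars B b) at 1. rewrite <- Hl.
  apply (H (ARel n (map Var (seq 0 (length a))))).
  split; [exact Hn|]. split; [now rewrite length_map, length_seq|].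
  intros t Ht. apply in_map_iff in Ht as (i & <- & Hi). apply in_seq in Hi. constructor. lia.
Qed.

(** The graph of a function symbol is atomic once the value is adjoined as coordinate 0. *)
Lemma simeq_fn L U V (A : structure L U) (B : structure L V) m x a y b :
  simeq A (x :: a) B (y :: b) -> fun_sym L m -> length a = arity L m ->
  (x = fn A m a <-> y = fn B m b).
Proof.
  intros [Hl H] Hm Ha. simpl in Hl. injection Hl as Hl.
  assert (E : forall W (D : structure L W) z c, length c = length a ->
     map (value D (z :: c)) (map Var (seq 1 (length a))) = c).
  { intros W D z c E. transitivity (map (value D c) (map Var (seq 0 (length c))));
      [|apply map_value_vars]. now rewrite <- seq_shift, !map_map, E. }
  assert (Hp : is_atomic L (length (x :: a)) (AEq (Var 0) (App m (map Var (seq 1 (length a)))))).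
  { split; [constructor; simpl; lia|]. constructor; [exact Hm | now rewrite length_map, length_seq|].
    intros t Ht. apply in_map_iff in Ht as (i & <- & Hi). apply in_seq in Hi. constructor. simpl. lia. }
  specialize (H _ Hp). cbn [sat value nth] in H. rewrite !E in H by easy. exact H.
Qed.

(** * Embeddings *)

Section Embeddings.
Context {L : language} {U V : Type} (A : structure L U) (B : structure L V).

Lemma embedding_value f a t : embedding A B f -> Forall (dom A) a -> is_term L (length a) t ->
  value B (map f a) t = f (value A a t).
Proof.
  intros (Hd & _ & _ & Hf) Ha.
  induction t as [i|m ts IH] using term_nested_ind; intros Ht; inversion Ht; subst; simpl.
  - now rewrite nth_indep with (d' := f (fn A 0 nil)), map_nth by now rewrite length_map.
  - rewrite (map_ext_in _ _ ts (fun t H => IH t H (H3 t H))), <- (map_map (value A a) f).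
    symmetry. apply Hf. split; [assumption|]. split; [now rewrite length_map|].
    apply values_dom; [assumption | now apply Forall_forall].
Qed.

Lemma embedding_values f a s : embedding A B f -> Forall (dom A) a ->
  Forall (is_term L (length a)) s ->
  map (value B (map f a)) s = map f (map (value A a) s).
Proof.
  intros Hf Ha Hs. rewrite map_map. apply map_ext_in. intros t Ht.
  apply embedding_value; auto. rewrite Forall_forall in Hs. auto.
Qed.

Lemma embedding_dom f a : embedding A B f -> Forall (dom A) a -> Forall (dom B) (map f a).
Proof. intros [Hd _] Ha. apply Forall_map. revert Ha. now apply Forall_impl. Qed.

Lemma embedding_simeq f a : embedding A B f -> Forall (dom A) a -> simeq A a B (map f a).
Proof.
  intros Hf Ha. split; [now rewrite length_map|]. intros [t u|n ts]; simpl.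
  - intros [Ht Hu]. rewrite !embedding_value by assumption.
    split; [congruence|]. apply Hf; now apply value_dom.
  - intros (Hn & Hl & Ht). apply Forall_forall in Ht. rewrite embedding_values by assumption.
    apply Hf. split; [assumption|]. split; [now rewrite length_map | now apply values_dom].
Qed.

(** Each element is the value of a term at [a] and is sent to the value of that term at [b].
    Equations between terms are atomic, which makes the map well defined and injective. [y0] only
    supplies values outside the domain, since maps are total on the ambient type. *)
Lemma simeq_embedding a b (y0 : V) : generated_by A a -> Forall (dom B) b -> simeq A a B b ->
  exists f, embedding A B f /\ map f a = b.
Proof.
  intros [Ha Hgen] Hb H. pose proof (simeq_length H) as Hl.
  pose (R := fun x y => exists t, is_term L (length a) t /\ value A a t = x /\ value B b t = y).
  assert (Hfun : forall t y, is_term L (length a) t -> R (value A a t) y -> y = value B b t).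
  { intros t y Ht (u & Hu & E & <-). now apply (simeq_value_eq H). }
  pose (f := fun x => epsilon (inhabits y0) (R x)).
  assert (Hf : forall t, is_term L (length a) t -> f (value A a t) = value B b t).
  { intros t Ht. apply Hfun; [exact Ht|]. unfold f. apply epsilon_spec. now exists (value B b t), t. }
  assert (Hfs : forall s, Forall (is_term L (length a)) s ->
     map f (map (value A a) s) = map (value B b) s).
  { intros s Hs. rewrite map_map. apply map_ext_in. intros t Ht. apply Hf.
    rewrite Forall_forall in Hs. auto. }
  assert (Hex : forall x, dom A x -> exists t, is_term L (length a) t /\ value A a t = x).
  { intros x Hx. now apply cl_value, Hgen. }
  exists f. split; [split; [|split; [|split]]|].
  - intros x Hx. destruct (Hex x Hx) as (t & Ht & <-). rewrite Hf by exact Ht.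
    apply value_dom; congruence.
  - intros x y Hx Hy. destruct (Hex x Hx) as (t & Ht & <-). destruct (Hex y Hy) as (u & Hu & <-).
    rewrite !Hf by assumption. now apply (simeq_value_eq H).
  - intros n c (Hn & Hc & Hd). destruct (values_exist Hex Hd) as (s & Hs & <-).
    rewrite Hfs by exact Hs. apply (proj2 H (ARel n s)). rewrite length_map in Hc.
    split; [assumption|]. split; [assumption|]. now apply Forall_forall.
  - intros m c (Hm & Hc & Hd). destruct (values_exist Hex Hd) as (s & Hs & <-).
    rewrite Hfs by exact Hs. change (fn A m (map (value A a) s)) with (value A a (App m s)).
    rewrite Hf; [reflexivity|]. rewrite length_map in Hc. constructor; auto. now apply Forall_forall.
  - rewrite <- (map_value_vars A a) at 1. rewrite Hfs.
    + rewrite Hl. apply map_value_vars.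
    + apply Forall_map, Forall_forall. intros i Hi. apply in_seq in Hi. constructor. lia.
Qed.

End Embeddings.

Lemma embedding_id L U (A : structure L U) : embedding A A (fun x => x).
Proof. repeat split; intros; rewrite ?map_id in *; auto. Qed.

Lemma embedding_comp L U V W (A : structure L U) (B : structure L V) (D : structure L W) f g :
  embedding A B f -> embedding B D g -> embedding A D (fun x => g (f x)).
Proof.
  intros Hf Hg. pose proof Hf as (F1 & F2 & F3 & F4). pose proof Hg as (G1 & G2 & G3 & G4).
  split; [|split; [|split]].
  - auto.
  - intros x y Hx Hy E. apply F2; auto.
  - intros n a Ha. rewrite F3 by exact Ha. rewrite <- (map_map f g). apply G3.
    destruct Ha as (Hn & Hl & Ha). split; [assumption|]. split; [now rewrite length_map|].
    now apply (embedding_dom Hf).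
  - intros m a Ha. rewrite F4 by exact Ha. rewrite <- (map_map f g). apply G4.
    destruct Ha as (Hn & Hl & Ha). split; [assumption|]. split; [now rewrite length_map|].
    now apply (embedding_dom Hf).
Qed.

Lemma isomorphism_inv L U V (A : structure L U) (B : structure L V) f (x0 : U) :
  isomorphism A B f -> exists g, isomorphism B A g /\ (forall x, dom A x -> g (f x) = x).
Proof.
  intros [Hf Hs]. pose proof Hf as (F1 & F2 & F3 & F4).
  pose (g := fun y => epsilon (inhabits x0) (fun x => dom A x /\ f x = y)).
  assert (Hg : forall y, dom B y -> dom A (g y) /\ f (g y) = y).
  { intros y Hy. apply (epsilon_spec (inhabits x0) (fun x => dom A x /\ f x = y)). auto. }
  assert (Hfg : forall a, Forall (dom B) a -> map f (map g a) = a).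
  { intros a Ha. rewrite map_map. rewrite <- map_id. apply map_ext_in. intros y Hy.
    rewrite Forall_forall in Ha. now apply Hg, Ha. }
  assert (Hgd : forall a, Forall (dom B) a -> Forall (dom A) (map g a)).
  { intros a Ha. apply Forall_map. revert Ha. apply Forall_impl. intros y Hy. now apply Hg. }
  assert (Hgf : forall x, dom A x -> g (f x) = x).
  { intros x Hx. apply F2; [apply Hg; auto | assumption | apply Hg; auto]. }
  exists g. split; [|exact Hgf]. split; [split; [|split; [|split]]|].
  - intros y Hy. now apply Hg.
  - intros x y Hx Hy E. rewrite <- (proj2 (Hg x Hx)), <- (proj2 (Hg y Hy)). congruence.
  - intros n a (Hn & Hl & Ha). rewrite <- (Hfg a Ha) at 1. symmetry. apply F3.
    split; [assumption|]. split; [now rewrite length_map | auto].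
  - intros m a (Hm & Hl & Ha). rewrite <- (Hfg a Ha) at 1.
    rewrite <- F4. { apply Hgf. apply fn_dom; [assumption | now rewrite length_map | auto]. }
    split; [assumption|]. split; [now rewrite length_map | auto].
  - intros x Hx. exists (f x). auto.
Qed.

Lemma isomorphism_comp L U V W (A : structure L U) (B : structure L V) (D : structure L W) f g :
  isomorphism A B f -> isomorphism B D g -> isomorphism A D (fun x => g (f x)).
Proof.
  intros [Hf Sf] [Hg Sg]. split; [now apply (embedding_comp Hf Hg)|].
  intros z Hz. destruct (Sg z Hz) as (y & Hy & <-). destruct (Sf y Hy) as (x & Hx & <-). eauto.
Qed.

(** * Amalgamation bases as tuples *)

Lemma cl_incl L U (A : structure L U) a b x : incl a b -> cl A a x -> cl A b x.
Proof.
  intros Hi. induction 1 as [x Hx|m c Hm Hc _ IH]; [now apply cl_gen, Hi | now apply cl_fn].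
Qed.

Lemma generated_by_incl L U (A : structure L U) a b :
  generated_by A a -> incl a b -> Forall (dom A) b -> generated_by A b.
Proof.
  intros [Ha Hg] Hi Hb. split; [exact Hb|]. intros x. split.
  - intros Hx. apply (cl_incl Hi). now apply Hg.
  - now apply cl_dom.
Qed.

Lemma app_inj A (a b c d : list A) : length a = length c -> a ++ b = c ++ d -> a = c /\ b = d.
Proof.
  revert c. induction a as [|x a IH]; intros [|y c] Hl E; try discriminate; [easy|].
  injection E as -> E. injection Hl as Hl. destruct (IH c Hl E). now subst.
Qed.

(** With both memberships included, this is exactly what the embedding information lists. The
    diagonal [eqv K p p] just says that the tuple lies in its structure, and is used in that sense
    to keep membership decidable. *)
Definition eqv L (K : representation L) (p q : nat * list nat) : Prop :=
  Forall (dom (str K (fst p))) (snd p) /\ Forall (dom (str K (fst q))) (snd q) /\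
  simeq (str K (fst p)) (snd p) (str K (fst q)) (snd q).

(* When [b] generates [B], [base K (k, b)] says that [B] is an amalgamation base; for other
   tuples it speaks of the substructure generated by [b], without mentioning it. *)
Definition base L (K : representation L) (p : nat * list nat) : Prop :=
  forall k1 b1 k2 b2, eqv K p (k1, b1) -> eqv K p (k2, b2) ->
  exists k3 f1 f2, embedding (str K k1) (str K k3) f1 /\
    embedding (str K k2) (str K k3) f2 /\ map f1 b1 = map f2 b2.

Section Bases.
Context {L : language} (K : representation L).
Hypothesis gen_str : forall k, generated_by (str K k) (gen K k).

Lemma eqv_refl k b : Forall (dom (str K k)) b -> eqv K (k, b) (k, b).
Proof. intros H. split; [exact H|]. split; [exact H | apply simeq_refl]. Qed.

Lemma eqv_sym p q : eqv K p q -> eqv K q p.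
Proof. intros (H1 & H2 & H). split; [exact H2|]. split; [exact H1 | now apply simeq_sym]. Qed.

Lemma eqv_trans p q r : eqv K p q -> eqv K q r -> eqv K p r.
Proof.
  intros (H1 & _ & H) (_ & H2 & H'). split; [exact H1|]. split; [exact H2|].
  now apply (simeq_trans H).
Qed.

Lemma eqv_length k b k' b' : eqv K (k, b) (k', b') -> length b = length b'.
Proof. intros (_ & _ & H). apply (simeq_length H). Qed.

Lemma eqv_app_l k a b k' a' b' : length a = length a' ->
  eqv K (k, a ++ b) (k', a' ++ b') -> eqv K (k, a) (k', a').
Proof.
  intros Hl (H1 & H2 & H). simpl in *. apply Forall_app in H1 as [H1 _], H2 as [H2 _].
  split; [exact H1|]. split; [exact H2 | now apply (simeq_app_l H)].
Qed.

Lemma eqv_app_r k a b k' a' b' : length a = length a' ->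
  eqv K (k, a ++ b) (k', a' ++ b') -> eqv K (k, b) (k', b').
Proof.
  intros Hl (H1 & H2 & H). simpl in *. apply Forall_app in H1 as [_ H1], H2 as [_ H2].
  split; [exact H1|]. split; [exact H2 | now apply (simeq_app_r H)].
Qed.

Lemma eqv_map k k' f b : embedding (str K k) (str K k') f -> Forall (dom (str K k)) b ->
  eqv K (k, b) (k', map f b).
Proof.
  intros Hf Hb. split; [exact Hb|]. split; [now apply (embedding_dom Hf) | now apply embedding_simeq].
Qed.

Lemma eqv_embedding k b k' b' : generated_by (str K k) b -> eqv K (k, b) (k', b') ->
  exists f, embedding (str K k) (str K k') f /\ map f b = b'.
Proof. intros Hg (_ & H2 & H). now apply (simeq_embedding 0 Hg). Qed.

Lemma base_eqv p q : eqv K p q -> base K p -> base K q.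
Proof. intros H Hp k1 b1 k2 b2 H1 H2. apply Hp; now apply (eqv_trans H). Qed.

(** Tuples generating the same substructure are interchangeable. The terms [r] express [b] over [c]
    and [s] express [c] over [b]. A copy of [c] yields a copy of [b] through [r]; an amalgam that
    identifies two copies of [b] then identifies the values of [s] at them, which are the given
    copies of [c]. *)
Lemma base_cl k b c : Forall (dom (str K k)) b ->
  Forall (cl (str K k) c) b -> Forall (cl (str K k) b) c -> base K (k, b) -> base K (k, c).
Proof.
  intros Hb Hbc Hcb Hbase.
  destruct (cl_values Hbc) as (r & Hr & Er), (cl_values Hcb) as (s & Hs & Es).
  assert (Ls : length b = length r) by now rewrite <- Er, length_map.
  assert (Hrec : forall k1 c1, eqv K (k, c) (k1, c1) ->
     eqv K (k, b) (k1, map (value (str K k1) c1) r) /\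
     map (value (str K k1) (map (value (str K k1) c1) r)) s = c1).
  { intros k1 c1 (_ & H1 & H). simpl in *.
    pose proof (simeq_length H) as Hl. split.
    - split; [exact Hb|]. split; simpl.
      + apply values_dom; [exact H1 | now rewrite <- Hl].
      + rewrite <- Er. now apply simeq_values.
    - transitivity (map (value (str K k1) c1) (map Var (seq 0 (length c1))));
        [|apply map_value_vars]. rewrite <- Hl.
      transitivity (map (value (str K k1) c1) (map (term_subst r) s)).
      + rewrite map_map. apply map_ext_in. intros t Ht. symmetry. apply value_subst.
        rewrite <- Ls. rewrite Forall_forall in Hs. auto.
      (* That going from [c] through [r] and back through [s] is the identity is a system of
         equations between terms at [c], hence also holds at its copy [c1]. *)
      + apply (simeq_values_eq H).
        * apply Forall_map. revert Hs. apply Forall_impl. intros t Ht.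
          apply is_term_subst; [exact Hr | now rewrite <- Ls].
        * apply Forall_map, Forall_forall. intros i Hi. apply in_seq in Hi. constructor. lia.
        * rewrite map_value_vars. transitivity (map (value (str K k) b) s); [|exact Es].
          rewrite map_map. apply map_ext_in. intros t Ht. rewrite value_subst; [now rewrite Er|].
          rewrite <- Ls. rewrite Forall_forall in Hs. auto. }
  intros k1 c1 k2 c2 H1 H2.
  destruct (Hrec _ _ H1) as [E1 F1], (Hrec _ _ H2) as [E2 F2].
  destruct (Hbase _ _ _ _ E1 E2) as (k3 & f1 & f2 & Hf1 & Hf2 & E).
  exists k3, f1, f2. split; [exact Hf1|]. split; [exact Hf2|].
  assert (Hmap : forall j d f, embedding (str K j) (str K k3) f -> eqv K (k, b) (j, d) ->
     map f (map (value (str K j) d) s) = map (value (str K k3) (map f d)) s).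
  { intros j d f Hf H. symmetry. apply (embedding_values Hf); [apply H|].
    now rewrite <- (eqv_length H). }
  rewrite <- F1, <- F2, (Hmap _ _ _ Hf1 E1), (Hmap _ _ _ Hf2 E2). now rewrite E.
Qed.

(** Embeddings are traded for tuples: one defined on [str K k] is determined by the image of the
    generators, and the appended [b1] or [b2] records where the tuple to be identified goes. What
    remains is a universal-existential statement over [eqv]. The length condition fixes where a
    concatenation is cut. *)
Lemma base_tuples p : base K p <->
  forall k1 b1 k2 b2, eqv K p (k1, b1) /\ eqv K p (k2, b2) ->
  exists k3 c1 c2 d, length d = length b1 /\
    eqv K (k1, gen K k1 ++ b1) (k3, c1 ++ d) /\ eqv K (k2, gen K k2 ++ b2) (k3, c2 ++ d).
Proof.
  split.
  - intros Hp k1 b1 k2 b2 [H1 H2].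
    destruct (Hp _ _ _ _ H1 H2) as (k3 & f1 & f2 & Hf1 & Hf2 & E).
    exists k3, (map f1 (gen K k1)), (map f2 (gen K k2)), (map f1 b1).
    rewrite length_map. split; [reflexivity|]. rewrite E at 2. rewrite <- !map_app.
    split; apply eqv_map; try assumption; apply Forall_app; split; try apply gen_str.
    + apply H1.
    + apply H2.
  - intros Hp k1 b1 k2 b2 H1 H2.
    destruct (Hp _ _ _ _ (conj H1 H2)) as (k3 & c1 & c2 & d & Hd & E1 & E2).
    assert (Hl : length b1 = length b2).
    { destruct p. apply eqv_length in H1, H2. congruence. }
    assert (Hext : forall k b c, eqv K (k, gen K k ++ b) (k3, c ++ d) -> length d = length b ->
       exists f, embedding (str K k) (str K k3) f /\ map f b = d).
    { intros k b c H Hlb. destruct (@eqv_embedding _ _ _ _ (generated_by_incl (gen_str k)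
        (incl_appl b (incl_refl _)) (proj1 H)) H) as (f & Hf & E).
      exists f. split; [exact Hf|]. rewrite map_app in E.
      apply app_inj in E as [_ E]; [exact E|].
      apply (f_equal (@length _)) in E. rewrite !length_app, !length_map in E.
      rewrite length_map. lia. }
    destruct (Hext _ _ _ E1 Hd) as (f1 & Hf1 & F1).
    destruct (Hext _ _ _ E2 ltac:(congruence)) as (f2 & Hf2 & F2).
    exists k3, f1, f2. now rewrite F1, F2.
Qed.

End Bases.

(** * Joint embedding and amalgamation inside the representation *)

Section Age.
Context {L : language} (K : representation L) (C : collection L).
Hypothesis hK : computable_age None K C.

Lemma age_gen_str k : generated_by (str K k) (gen K k).
Proof. apply hK. Qed.

Lemma age_str k : C (str K k).
Proof. apply hK. Qed.

Lemma age_represented U (B : structure L U) : C B -> exists k, isomorphic B (str K k).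
Proof. apply hK. Qed.

Lemma age_joint_embedding : JEP C -> forall k1 k2, exists k f1 f2,
  embedding (str K k1) (str K k) f1 /\ embedding (str K k2) (str K k) f2.
Proof.
  intros hJ k1 k2. destruct (hJ _ _ _ _ (age_str k1) (age_str k2)) as (W & D & HD & [f1 Hf1] & [f2 Hf2]).
  destruct (age_represented HD) as (k & h & [Hh _]).
  exists k, (fun x => h (f1 x)), (fun x => h (f2 x)).
  split; now apply (embedding_comp (B := D)).
Qed.

(** The definition ranges over arbitrary universes. A copy of the generators is the same as an
    embedding, which is composed with [f] to fit the definition, and the resulting amalgam is
    replaced by an isomorphic member of the representation. *)
Lemma amalgamation_base_base V (B : structure L V) k f :
  amalgamation_base C B -> isomorphism B (str K k) f -> base K (k, gen K k).
Proof.
  intros [_ HB] [Hf Sf] k1 b1 k2 b2 H1 H2.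
  destruct (eqv_embedding (age_gen_str k) H1) as (e1 & He1 & <-).
  destruct (eqv_embedding (age_gen_str k) H2) as (e2 & He2 & <-).
  destruct (HB _ _ _ _ _ _ (age_str k1) (age_str k2) (embedding_comp Hf He1) (embedding_comp Hf He2))
    as (X & D & g1 & g2 & HD & Hg1 & Hg2 & E).
  destruct (age_represented HD) as (k3 & h & [Hh _]).
  exists k3, (fun x => h (g1 x)), (fun x => h (g2 x)).
  split; [now apply (embedding_comp Hg1)|]. split; [now apply (embedding_comp Hg2)|].
  rewrite !map_map. apply map_ext_in. intros y Hy.
  pose proof (proj1 (age_gen_str k)) as Hd. rewrite Forall_forall in Hd.
  destruct (Sf y (Hd y Hy)) as (x & Hx & <-). now rewrite E.
Qed.

Lemma age_base_above : CAP C -> forall k, exists k' f,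
  embedding (str K k) (str K k') f /\ base K (k', gen K k').
Proof.
  intros hC k. destruct (hC _ _ (age_str k)) as (V & B & HB & [f Hf]).
  destruct (age_represented (proj1 HB)) as (k' & h & Hh).
  exists k', (fun x => h (f x)). split; [now apply (embedding_comp Hf); destruct Hh|].
  now apply (amalgamation_base_base HB Hh).
Qed.

(** * What the embedding information computes *)

Definition triple_code (k : nat) : nat * (nat * nat) := (code_tuple (gen K k), (ind K k, k)).

Lemma EI_code k b k' b' :
  EI K (code ((triple_code k, b), (triple_code k', b'))) <-> eqv K (k, b) (k', b').
Proof.
  assert (E : forall k b, code (triple_code k, b) = ⟨triple K k, code_tuple b⟩).
  { intros j c. rewrite <- code_list_tuple. reflexivity. }
  change (code ((triple_code k, b), (triple_code k', b'))) with
    ⟨code (triple_code k, b), code (triple_code k', b')⟩. rewrite !E. split.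
  - intros (k0 & b0 & k1 & b1 & Ex & H0 & H1 & H).
    apply pair_inj in Ex as [E0 E1]. apply pair_inj in E0 as [E0 F0], E1 as [E1 F1].
    apply code_tuple_inj in F0, F1. apply pair_inj in E0 as [_ E0], E1 as [_ E1].
    apply pair_inj in E0 as [_ E0], E1 as [_ E1]. now subst.
  - intros (H0 & H1 & H). now exists k, b, k', b'.
Qed.

(** The empty tuple is similar to itself, so this diagonal query only tests whether [t] is a genuine
    triple. The embedding information can therefore find the triple of a given number by search, and
    with it the generators. *)
Lemma EI_triple t : EI K (code ((t, @nil nat), (t, @nil nat))) <-> t = triple_code (snd (snd t)).
Proof.
  split.
  - intros (k0 & b0 & k1 & b1 & Ex & _). apply pair_inj in Ex as [E _]. apply pair_inj in E as [E _].
    change (code t = code (triple_code k0)) in E. apply code_inj in E. now rewrite E.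
  - intros ->. apply EI_code, eqv_refl. constructor.
Qed.

Lemma Comp_triple_code : Comp (EI K) triple_code.
Proof.
  destruct (@Comp_choice (EI K) nat (nat * (nat * nat)) _ _
    (fun k t => EI K (code ((t, @nil nat), (t, @nil nat))) /\ snd (snd t) = k)) as (f & Hf & E).
  - dec. refine (Dec_comp (f := fun t : nat * (nat * (nat * nat)) =>
      code ((snd t, @nil nat), (snd t, @nil nat))) (Dec_oracle _) _). comp.
  - intros k. exists (triple_code k). split; [apply EI_code, eqv_refl; constructor | reflexivity].
  - apply (Comp_ext (f := f)); [|exact Hf]. intros k. destruct (E k) as [E1 E2].
    apply EI_triple in E1. congruence.
Qed.

Lemma Comp_gen : Comp (EI K) (gen K).
Proof.
  apply Comp_graph. apply (Dec_ext (P := fun t : nat * list nat => code (snd t) = fst (triple_code (fst t)))).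
  - intros [k l]. change (code l = code_tuple (gen K k) <-> l = gen K k). rewrite code_list_tuple. split; [apply code_tuple_inj | congruence].
  - dec. refine (Comp_comp (f := fst) Comp_triple_code _). comp.
Qed.

Lemma Dec_eqv A `{encoding A} (p q : A -> nat * list nat) :
  Comp (EI K) p -> Comp (EI K) q -> Dec (EI K) (fun a => eqv K (p a) (q a)).
Proof.
  intros Hp Hq.
  apply (Dec_ext (P := fun a => EI K (code ((triple_code (fst (p a)), snd (p a)),
     (triple_code (fst (q a)), snd (q a)))))).
  - intros a. rewrite EI_code. now destruct (p a), (q a).
  - refine (Dec_comp (f := fun a => code ((triple_code (fst (p a)), snd (p a)),
     (triple_code (fst (q a)), snd (q a)))) (Dec_oracle _) _). comp.
    + refine (Comp_comp (f := fun a => fst (p a)) Comp_triple_code _). comp.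
    + refine (Comp_comp (f := fun a => fst (q a)) Comp_triple_code _). comp.
Qed.

(* Being a base is Pi_2 in the embedding information: this is what costs two jumps. *)
Lemma Dec_base : Dec (jump (jump (EI K))) (base K).
Proof.
  pose (R := fun (t : (nat * list nat) * ((nat * list nat) * (nat * list nat)))
    (u : (nat * list nat) * (list nat * list nat)) =>
    length (snd (snd u)) = length (snd (fst (snd t))) /\
    eqv K (fst (fst (snd t)), gen K (fst (fst (snd t))) ++ snd (fst (snd t)))
          (fst (fst u), snd (fst u) ++ snd (snd u)) /\
    eqv K (fst (snd (snd t)), gen K (fst (snd (snd t))) ++ snd (snd (snd t)))
          (fst (fst u), fst (snd u) ++ snd (snd u))).
  (* Both quantifiers become existential, each over a relation decided one jump lower: the amalgam
     [u] is sought first, then a pair [q] of copies without one. *)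
  apply (Dec_ext (P := fun p => ~ exists q, ~ (eqv K p (fst q) /\ eqv K p (snd q) -> exists u, R (p, q) u))).
  - intros p. rewrite (base_tuples age_gen_str). split.
    + intros N k1 b1 k2 b2 H.
      assert (Hu : exists u, R (p, ((k1, b1), (k2, b2))) u).
      { apply NNPP. intros N'. apply N. exists ((k1, b1), (k2, b2)). tauto. }
      destruct Hu as ([[k3 c1] [c2 d]] & Hu). now exists k3, c1, c2, d.
    + intros H [[[k1 b1] [k2 b2]] N]. apply N. simpl. intros E.
      destruct (H _ _ _ _ E) as (k3 & c1 & c2 & d & Hu). now exists ((k3, c1), (c2, d)).
  - apply Dec_not, (Dec_jump_exists (P := fun p q => ~ (eqv K p (fst q) /\ eqv K p (snd q) -> exists u, R (p, q) u))).
    dec.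
    + apply Dec_jump, Dec_eqv; comp.
    + apply Dec_jump, Dec_eqv; comp.
    + refine (Dec_comp (P := fun t => exists u, R t u) _ _); [|comp].
      refine (Dec_jump_exists (P := R) _). unfold R. dec; apply Dec_eqv; comp.
      * refine (Comp_comp Comp_gen _). comp.
      * refine (Comp_comp Comp_gen _). comp.
Qed.

Lemma Dec_eqv_jump A `{encoding A} (p q : A -> nat * list nat) :
  Comp (jump (jump (EI K))) p -> Comp (jump (jump (EI K))) q ->
  Dec (jump (jump (EI K))) (fun a => eqv K (p a) (q a)).
Proof.
  intros Hp Hq. refine (Dec_comp (P := fun t => eqv K (fst t) (snd t)) (f := fun a => (p a, q a)) _ _).
  - apply Dec_jump, Dec_jump, Dec_eqv; comp.
  - comp.
Qed.

Lemma Dec_base_jump A `{encoding A} (p : A -> nat * list nat) :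
  Comp (jump (jump (EI K))) p -> Dec (jump (jump (EI K))) (fun a => base K (p a)).
Proof. exact (Dec_comp Dec_base). Qed.

Lemma Comp_gen_jump A `{encoding A} (k : A -> nat) :
  Comp (jump (jump (EI K))) k -> Comp (jump (jump (EI K))) (fun a => gen K (k a)).
Proof. exact (Comp_comp (Comp_jump (Comp_jump Comp_gen))). Qed.

Lemma age_structure_index k : structure_index None (ind K k) (str K k).
Proof. apply hK. Qed.

(** The index of each diagram is a component, selected by [c], of the index of the structure, and
    the latter is part of its triple. The jump is asked whether the program with that index halts on
    the given code. *)
Lemma Dec_diagram (P : nat -> nat -> Prop) (c : nat * (nat * (nat * nat)) -> nat) :
  (forall k, ce_index None (c (decode (ind K k))) (P k)) ->
  Comp (jump (EI K)) c -> Dec (jump (EI K)) (fun t => P (fst t) (snd t)).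
Proof.
  intros HP Hc.
  apply (@Dec_halting (EI K) _ _ _ (fun t : nat * nat => c (decode (fst (snd (triple_code (fst t))))))
    (fun t => snd t)).
  - refine (Comp_comp Hc _).
    refine (Comp_recode (r := @decode (nat * (nat * (nat * nat))) _) _ _); [apply decodeK|].
    comp. apply Comp_jump. refine (Comp_comp (f := fst) Comp_triple_code _). comp.
  - comp.
  - intros [k x]. simpl. destruct (ce_index_relativize (EI K) (HP k)) as (G & HG & E).
    exists G. split; [exact HG | apply E].
Qed.

Lemma decode_index k : exists d p n f, decode (ind K k) = (d, (p, (n, f))) /\
  ce_index None p (pos_diagram (str K k)) /\ ce_index None n (neg_diagram (str K k)) /\
  ce_index None f (fun_diagram (str K k)).
Proof.
  destruct (age_structure_index k) as (d & p & n & f & E & _ & Hp & Hn & Hf).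
  exists d, p, n, f. split; [|easy].
  change (⟨d, ⟨p, ⟨n, f⟩⟩⟩) with (code (d, (p, (n, f)))) in E. now rewrite E, codeK.
Qed.

Lemma Dec_pos_diagram : Dec (jump (EI K)) (fun t => pos_diagram (str K (fst t)) (snd t)).
Proof.
  apply (Dec_diagram (P := fun k => pos_diagram (str K k)) (c := fun u => fst (snd u))); [|comp].
  intros k. destruct (decode_index k) as (d & p & n & f & -> & Hp & _). exact Hp.
Qed.

Lemma Dec_neg_diagram : Dec (jump (EI K)) (fun t => neg_diagram (str K (fst t)) (snd t)).
Proof.
  apply (Dec_diagram (P := fun k => neg_diagram (str K k)) (c := fun u => fst (snd (snd u)))); [|comp].
  intros k. destruct (decode_index k) as (d & p & n & f & -> & _ & Hn & _). exact Hn.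
Qed.

Lemma Dec_fun_diagram : Dec (jump (EI K)) (fun t => fun_diagram (str K (fst t)) (snd t)).
Proof.
  apply (Dec_diagram (P := fun k => fun_diagram (str K k)) (c := fun u => snd (snd (snd u)))); [|comp].
  intros k. destruct (decode_index k) as (d & p & n & f & -> & _ & _ & Hf). exact Hf.
Qed.

End Age.

(** * The chain *)

(** Selection by positions: along the chain the positions persist while the values at them change.
    The default 0 is not reached for positions below the length. *)
Definition pick (b I : list nat) : list nat := map (fun i => nth i b 0) I.

Lemma pick_app b I J : pick b (I ++ J) = pick b I ++ pick b J.
Proof. apply map_app. Qed.

Lemma pick_app_l c d I : Forall (fun i => i < length c) I -> pick (c ++ d) I = pick c I.
Proof.
  intros H. apply map_ext_in. intros i Hi. apply app_nth1. rewrite Forall_forall in H. auto.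
Qed.

Lemma map_pick f b I : Forall (fun i => i < length b) I -> map f (pick b I) = pick (map f b) I.
Proof.
  intros H. unfold pick. rewrite map_map. apply map_ext_in. intros i Hi.
  rewrite Forall_forall in H. rewrite (nth_indep (map f b) 0 (f 0)) by (rewrite length_map; auto).
  now rewrite map_nth.
Qed.

Lemma pick_incl b I : Forall (fun i => i < length b) I -> incl (pick b I) b.
Proof.
  intros H x Hx. apply in_map_iff in Hx as (i & <- & Hi). rewrite Forall_forall in H.
  apply nth_In. auto.
Qed.

Lemma pick_seq b : pick b (seq 0 (length b)) = b.
Proof.
  apply nth_ext with (d := 0) (d' := 0); unfold pick; rewrite length_map, length_seq; [reflexivity|].
  intros n Hn. rewrite nth_indep with (d' := nth 0 b 0) by now rewrite length_map, length_seq.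
  rewrite (map_nth (fun i => nth i b 0)). now rewrite seq_nth.
Qed.

Lemma incl_pick b u : incl u b -> exists J, Forall (fun i => i < length b) J /\ pick b J = u.
Proof.
  induction u as [|x u IH]; intros H; [now exists nil|].
  apply incl_cons_inv in H as [Hx Hu]. destruct (IH Hu) as (J & HJ & E).
  destruct (In_nth _ _ 0 Hx) as (i & Hi & Ei). exists (i :: J). split; [now constructor|].
  simpl. congruence.
Qed.

Lemma eqv_pick L (K : representation L) k b k' b' I : Forall (fun i => i < length b) I ->
  eqv K (k, b) (k', b') -> eqv K (k, pick b I) (k', pick b' I).
Proof.
  intros HI (Hb & Hb' & H). simpl in *. pose proof (simeq_length H) as Hl.
  assert (HI' : Forall (fun i => i < length b') I) by now rewrite <- Hl.
  split; [|split]; simpl.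
  - now apply (incl_Forall (pick_incl HI)).
  - now apply (incl_Forall (pick_incl HI')).
  - assert (E : forall (A : structure L nat) c, Forall (fun i => i < length c) I ->
      map (value A c) (map Var I) = pick c I).
    { intros A c Hc. rewrite map_map. apply map_ext_in. intros i Hi. apply nth_indep.
      rewrite Forall_forall in Hc. auto. }
    rewrite <- (E (str K k) b HI), <- (E (str K k') b' HI'). apply (simeq_values H).
    apply Forall_map. revert HI. apply Forall_impl. now constructor.
Qed.

(** The interface between the construction and the limit. [chain_extension] is homogeneity over
    bases in terms of coordinates: whatever extends a copy of the tuple at [I] is found, at some
    later stage, over the same positions [I]. *)
Record amalgamation_chain L (K : representation L) (ch : nat -> nat * list nat) : Prop := {
  chain_generated n : generated_by (str K (fst (ch n))) (snd (ch n));
  chain_base n : base K (ch n);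
  chain_coherent n m : n <= m -> exists c d,
    snd (ch m) = c ++ d /\ eqv K (ch n) (fst (ch m), c);
  chain_universal k : exists n v, eqv K (k, gen K k) (fst (ch n), v);
  chain_extension n I k1 b1 u1 :
    Forall (fun i => i < length (snd (ch n))) I ->
    base K (fst (ch n), pick (snd (ch n)) I) ->
    eqv K (fst (ch n), pick (snd (ch n)) I) (k1, b1) ->
    Forall (dom (str K k1)) u1 ->
    exists m J, n <= m /\ Forall (fun i => i < length (snd (ch m))) J /\
      eqv K (k1, b1 ++ u1) (fst (ch m), pick (snd (ch m)) I ++ pick (snd (ch m)) J)
}.

Section Chain.
Context {L : language} (K : representation L) (C : collection L).
Hypothesis hK : computable_age None K C.
Hypothesis hJEP : JEP C.
Hypothesis hCAP : CAP C.

(* A task [(I, ((k1, b1), u1))] asks to realize [u1] over the coordinates [I] of the current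
   tuple, once these look like [b1]; every task is met at infinitely many stages. *)
Definition task : Type := list nat * ((nat * list nat) * list nat).

(** The last conjunct only places [u1] in its structure. All conjuncts are decidable from the double
    jump, so a stage can recognise a meaningless task and then owes it nothing. *)
Definition task_applies (r : task) (s : nat * list nat) : Prop :=
  Forall (fun i => i < length (snd s)) (fst r) /\
  base K (fst s, pick (snd s) (fst r)) /\
  eqv K (fst s, pick (snd s) (fst r)) (fst (snd r)) /\
  eqv K (fst (fst (snd r)), snd (snd r)) (fst (fst (snd r)), snd (snd r)).

Definition task_met (r : task) (s : nat * list nat) (u : list nat) : Prop :=
  eqv K (fst (fst (snd r)), snd (fst (snd r)) ++ snd (snd r)) (fst s, pick (snd s) (fst r) ++ u).

(** Here [y] is [(k, (c, (u, v)))]: [c] copies the old tuple, [u] answers the task, [v] copies the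
    generators of the structure number [n]. The clause comparing [u] with itself keeps it in the
    domain even when the task does not apply. *)
Definition step (n : nat) (s : nat * list nat) (y : nat * (list nat * (list nat * list nat))) : Prop :=
  let k := fst y in let c := fst (snd y) in
  eqv K s (k, c) /\
  (task_applies (snd (decode n : nat * task)) s ->
    task_met (snd (decode n : nat * task)) (k, c) (fst (snd (snd y)))) /\
  eqv K (k, fst (snd (snd y))) (k, fst (snd (snd y))) /\
  eqv K (n, gen K n) (k, snd (snd (snd y))) /\
  base K (k, gen K k).

(** The copy of the old tuple comes first so that old coordinates keep their positions; the
    generators are appended so that the new tuple generates its structure. *)
Definition next (y : nat * (list nat * (list nat * list nat))) : nat * list nat :=
  (fst y, fst (snd y) ++ fst (snd (snd y)) ++ snd (snd (snd y)) ++ gen K (fst y)).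

(** Generation is replaced by containment of the listed generators, which is decidable. *)
Definition good (s : nat * list nat) : Prop :=
  eqv K s s /\ Forall (fun x => In x (snd s)) (gen K (fst s)) /\ base K (fst s, gen K (fst s)).

Lemma good_generated s : good s -> generated_by (str K (fst s)) (snd s).
Proof.
  intros (H & Hi & _). apply (generated_by_incl (age_gen_str hK (fst s))); [|apply H].
  intros x Hx. rewrite Forall_forall in Hi. auto.
Qed.

Lemma base_generating k b c : generated_by (str K k) b -> generated_by (str K k) c ->
  base K (k, b) -> base K (k, c).
Proof.
  intros [Hb Gb] [Hc Gc]. apply base_cl; [exact Hb|..].
  - revert Hb. apply Forall_impl. intros x. apply Gc.
  - revert Hc. apply Forall_impl. intros x. apply Gb.
Qed.

Lemma good_base s : good s -> base K s.
Proof.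
  intros Hs. destruct s as [k b]. apply (base_generating (b := gen K k)).
  - apply (age_gen_str hK).
  - apply (good_generated Hs).
  - apply Hs.
Qed.

Lemma task_realizable r s : good s -> exists k3 f u3,
  embedding (str K (fst s)) (str K k3) f /\ Forall (dom (str K k3)) u3 /\
  (task_applies r s -> task_met r (k3, map f (snd s)) u3).
Proof.
  intros Hs. destruct (classic (task_applies r s)) as [(HI & Hb & H1 & Hu)|N].
  - destruct s as [k b], r as [I [[k1 b1] u1]]. simpl in *.
    assert (H0 : eqv K (k, pick b I) (k, pick b I)) by (apply eqv_refl, H1).
    destruct (Hb _ _ _ _ H0 H1) as (k3 & f & f1 & Hf & Hf1 & E).
    exists k3, f, (map f1 u1). split; [exact Hf|].
    split; [apply (embedding_dom Hf1); apply Hu|]. intros _. unfold task_met. simpl.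
    rewrite <- map_pick, E, <- map_app by exact HI. apply (eqv_map Hf1).
    apply Forall_app. split; [apply H1 | apply Hu].
  - exists (fst s), (fun x => x), nil. split; [apply embedding_id|].
    split; [constructor | contradiction].
Qed.

(** Three embeddings in a row: into [k3] to meet the task, into [k4] to take in the structure number
    [n], into [k5] to be a base again. Embeddings preserve atomic types, so what was achieved
    earlier is kept. *)
Lemma step_exists n s : good s -> exists y, step n s y.
Proof.
  intros Hs. destruct (task_realizable (snd (decode n : nat * task)) Hs) as (k3 & f & u3 & Hf & Hu & Hr).
  destruct (age_joint_embedding hK hJEP k3 n) as (k4 & f4 & g4 & Hf4 & Hg4).
  destruct (age_base_above hK hCAP k4) as (k5 & f5 & Hf5 & Hb5).
  pose proof (embedding_comp Hf4 Hf5) as Hh. set (h := fun x => f5 (f4 x)) in *.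
  destruct s as [k b]. simpl in *.
  exists (k5, (map h (map f b), (map h u3, map (fun x => f5 (g4 x)) (gen K n)))).
  unfold step. simpl. split; [|split; [|split; [|split]]].
  - rewrite map_map. apply (eqv_map (f := fun x => h (f x))); [now apply (embedding_comp Hf)|].
    apply Hs.
  - intros Ha. pose proof (Hr Ha) as Hm. unfold task_met in *. simpl in *.
    apply (eqv_trans Hm). rewrite <- (map_pick h).
    + rewrite <- map_app. apply (eqv_map Hh). apply Hm.
    + rewrite length_map. apply Ha.
  - apply eqv_refl. now apply (embedding_dom Hh).
  - apply (eqv_map (embedding_comp Hg4 Hf5)). apply (age_gen_str hK).
  - exact Hb5.
Qed.

Lemma good_next n s y : step n s y -> good (next y).
Proof.
  intros (H1 & H2 & H3 & H4 & H5). destruct y as [k [c [u v]]]. unfold next, good. simpl in *.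
  split; [|split; [|exact H5]].
  - apply eqv_refl. rewrite !Forall_app.
    split; [apply H1 | split; [apply H3 | split; [apply H4 | apply (age_gen_str hK)]]].
  - apply Forall_forall. intros x Hx. rewrite !in_app_iff. tauto.
Qed.

Ltac dec_hook ::= lazymatch goal with
  | |- @Dec _ _ _ (fun x => eqv _ (@?p x) (@?q x)) => refine (Dec_eqv_jump _ _)
  | |- @Dec _ _ _ (fun x => base _ (@?p x)) => refine (Dec_base_jump hK _)
  end.

Lemma Dec_task_applies A `{encoding A} (r : A -> task) (s : A -> nat * list nat) :
  Comp (jump (jump (EI K))) r -> Comp (jump (jump (EI K))) s ->
  Dec (jump (jump (EI K))) (fun a => task_applies (r a) (s a)).
Proof.
  intros Hr Hs. unfold task_applies, pick. dec.
Qed.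

Lemma Dec_step : Dec (jump (jump (EI K)))
  (fun t => step (fst (fst t)) (snd (fst t)) (snd t)).
Proof.
  assert (Ht : Comp (jump (jump (EI K))) (fun n : nat => (decode n : nat * task))).
  { refine (Comp_recode (r := @decode (nat * task) _) _ _); [apply decodeK | comp]. }
  unfold step, task_met, pick. dec; try (apply Dec_task_applies; comp).
  all: try (refine (Comp_gen_jump _); comp).
  all: refine (Comp_comp Ht _); comp.
Qed.

Lemma Comp_next : Comp (jump (jump (EI K))) next.
Proof. unfold next. comp. refine (Comp_gen_jump _); comp. Qed.

Lemma Dec_good : Dec (jump (jump (EI K))) good.
Proof.
  unfold good. dec; refine (Comp_gen_jump _); comp.
Qed.

Lemma eqv_prefix k b k' c d k2 c2 d2 : eqv K (k, b) (k', c) -> eqv K (k', c ++ d) (k2, c2) ->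
  exists e1 e2, c2 ++ d2 = e1 ++ e2 /\ eqv K (k, b) (k2, e1).
Proof.
  intros H H'. pose proof (eqv_length H') as Hl. rewrite length_app in Hl.
  rewrite <- (firstn_skipn (length c) c2) in H'.
  exists (firstn (length c) c2), (skipn (length c) c2 ++ d2).
  rewrite app_assoc, firstn_skipn. split; [reflexivity|].
  apply (eqv_trans H). apply (eqv_app_l (b := d) (b' := skipn (length c) c2)); [|exact H'].
  rewrite length_firstn. lia.
Qed.

Lemma amalgamation_chain_exists :
  exists ch, Comp (jump (jump (EI K))) ch /\ amalgamation_chain K ch.
Proof.
  (* States that are not good carry no demand, which makes the relation total. *)
  destruct (@Comp_choice (jump (jump (EI K))) (nat * (nat * list nat)) _ _ _
    (fun t y => good (snd t) -> step (fst t) (snd t) y)) as (F & HF & E).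
  { dec.
    - refine (Dec_comp (f := fun t => snd (fst t)) Dec_good _). comp.
    - exact Dec_step. }
  { intros [n s]. simpl. destruct (classic (good s)) as [Hs|Hs].
    - destruct (step_exists n Hs) as [y Hy]. now exists y.
    - now exists (0, (nil, (nil, nil))). }
  destruct (age_base_above hK hCAP 0) as (k0 & _ & _ & Hk0).
  pose (ch := fun n => nat_rect (fun _ => (nat * list nat)%type) (k0, gen K k0)
    (fun n s => next (F (n, s))) n).
  assert (Hgood : forall n, good (ch n)).
  { induction n as [|n IH]; [|apply (good_next (n := n) (s := ch n)); now apply (E (n, ch n))].
    split; [apply eqv_refl, (age_gen_str hK)|]. split; [apply Forall_forall; auto | exact Hk0]. }
  assert (Hstep : forall n, step n (ch n) (F (n, ch n))) by (intros n; apply (E (n, ch n)), Hgood).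
  assert (Hcoh : forall n m, n <= m -> exists c d,
    snd (ch m) = c ++ d /\ eqv K (ch n) (fst (ch m), c)).
  { intros n m Hnm. induction Hnm as [|m Hnm (c & d & Em & IH)].
    - exists (snd (ch n)), nil. rewrite app_nil_r, <- surjective_pairing.
      split; [reflexivity | apply Hgood].
    - destruct (Hstep m) as [Hm _]. change (ch (S m)) with (next (F (m, ch m))).
      set (y := F (m, ch m)) in *. rewrite (surjective_pairing (ch m)), Em in Hm.
      rewrite (surjective_pairing (ch n)) in *. cbn [fst snd] in *.
      exact (eqv_prefix _ IH Hm). }
  exists ch. split.
  { apply (Comp_nat_rect (n := fun n => n) (f := fun _ => (k0, gen K k0))
      (g := fun _ n s => next (F (n, s)))); comp.
    refine (Comp_comp Comp_next _). refine (Comp_comp HF _). comp. }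
  split.
  - intros n. now apply good_generated.
  - intros n. now apply good_base.
  - exact Hcoh.
  - intros k. destruct (Hstep k) as (_ & _ & _ & H & _). exists (S k). eexists. exact H.
  - intros n I k1 b1 u1 HI Hb H1 Hu.
    (* Pairing the task with [n] makes the stage that serves it no earlier than [n]. *)
    set (r := (I, ((k1, b1), u1)) : task). set (m := code (n, r)).
    assert (Hnm : n <= m).
    { unfold m. simpl. pose proof (Cantor.to_nat_non_decreasing n (code r)). simpl in *. lia. }
    destruct (Hcoh n m Hnm) as (c & d & Em & Hc).
    rewrite (surjective_pairing (ch n)) in Hc. cbn [fst snd] in Hc.
    assert (HIc : Forall (fun i => i < length c) I) by now rewrite <- (eqv_length Hc).
    assert (Hpick : pick (snd (ch m)) I = pick c I) by now rewrite Em, pick_app_l.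
    pose proof (eqv_pick HI Hc) as Hc'.
    assert (Ha : task_applies r (ch m)).
    { unfold task_applies, r. cbn [fst snd]. rewrite Hpick. split; [|split; [|split]].
      - rewrite Em. revert HIc. apply Forall_impl. intros i Hi. rewrite length_app. lia.
      - now apply (base_eqv Hc').
      - now apply (eqv_trans (eqv_sym Hc')).
      - now apply eqv_refl. }
    destruct (Hstep m) as (H & Hmet & _).
    assert (Edec : snd (decode m : nat * task) = r) by (unfold m; now rewrite codeK).
    rewrite Edec in Hmet. specialize (Hmet Ha).
    set (y := F (m, ch m)) in *.
    assert (ES : ch (S m) = next y) by reflexivity.
    assert (Hi : incl (fst (snd (snd y))) (snd (ch (S m)))).
    { rewrite ES. unfold next. simpl. intros x Hx. rewrite !in_app_iff. tauto. }
    destruct (incl_pick Hi) as (J & HJ & EJ).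
    exists (S m), J. split; [lia|]. split; [exact HJ|]. rewrite EJ.
    replace (pick (snd (ch (S m))) I) with (pick (fst (snd y)) I); [exact Hmet|].
    rewrite ES. unfold next. simpl. symmetry. apply pick_app_l.
    rewrite (surjective_pairing (ch m)) in H. rewrite <- (eqv_length H). apply Ha.
Qed.

End Chain.

(** * The limit of a chain *)

Section Limit.
Context {L : language} (K : representation L) (ch : nat -> nat * list nat).
Hypothesis Hch : amalgamation_chain K ch.

Local Notation A t := (str K (fst (ch t))).

(* A slot codes a pair of a stage [s] and a coordinate [i] of the tuple of stage [s]; it names
   the common value of the coordinate [i] at all stages from [s] on. *)
Definition stage (u : nat) : nat := fst (decode u : nat * nat).
Definition coord (u : nat) : nat := snd (decode u : nat * nat).
Definition slot (u : nat) : Prop := coord u < length (snd (ch (stage u))).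
Definition val (t u : nat) : nat := nth (coord u) (snd (ch t)) 0.
Definition stages (a : list nat) : nat := list_max (map stage a).

Lemma stages_le a t : stages a <= t <-> Forall (fun u => stage u <= t) a.
Proof. unfold stages. now rewrite list_max_le, Forall_map. Qed.

Lemma stages_app a b : stages (a ++ b) = Nat.max (stages a) (stages b).
Proof. unfold stages. now rewrite map_app, list_max_app. Qed.

Lemma val_pick t a : map (val t) a = pick (snd (ch t)) (map coord a).
Proof. unfold pick. now rewrite map_map. Qed.

Lemma chain_pick s t I : s <= t -> Forall (fun i => i < length (snd (ch s))) I ->
  eqv K (fst (ch s), pick (snd (ch s)) I) (fst (ch t), pick (snd (ch t)) I).
Proof.
  intros Hst HI. destruct (chain_coherent Hch Hst) as (c & d & E & H).
  rewrite (surjective_pairing (ch s)) in H.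
  assert (HI' : Forall (fun i => i < length c) I) by now rewrite <- (eqv_length H).
  rewrite E, pick_app_l by exact HI'. now apply eqv_pick.
Qed.

Lemma chain_length s t : s <= t -> length (snd (ch s)) <= length (snd (ch t)).
Proof.
  intros Hst. destruct (chain_coherent Hch Hst) as (c & d & E & H).
  rewrite (surjective_pairing (ch s)) in H. rewrite (eqv_length H), E, length_app. lia.
Qed.

Lemma slots_coord a t : Forall slot a -> stages a <= t ->
  Forall (fun i => i < length (snd (ch t))) (map coord a).
Proof.
  intros Ha Ht. apply stages_le in Ht. apply Forall_map. rewrite Forall_forall in *.
  intros u Hu. pose proof (chain_length (Ht u Hu)). specialize (Ha u Hu). unfold slot in Ha. lia.
Qed.

Lemma val_eqv a s t : Forall slot a -> stages a <= s -> s <= t ->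
  eqv K (fst (ch s), map (val s) a) (fst (ch t), map (val t) a).
Proof. intros Ha Hs Hst. rewrite !val_pick. apply chain_pick; [exact Hst|]. now apply slots_coord. Qed.

Lemma val_dom a t : Forall slot a -> stages a <= t -> Forall (dom (A t)) (map (val t) a).
Proof. intros Ha Ht. apply (val_eqv Ha Ht (le_n t)). Qed.

Lemma val_eq_stable u v s t : slot u -> slot v -> stage u <= s -> stage v <= s -> s <= t ->
  (val s u = val s v <-> val t u = val t v).
Proof.
  intros Hu Hv Lu Lv Hst.
  assert (H : eqv K (fst (ch s), map (val s) [u; v]) (fst (ch t), map (val t) [u; v])).
  { apply val_eqv; [now repeat constructor | | exact Hst]. apply stages_le. now repeat constructor. }
  destruct H as (_ & _ & H).
  apply (simeq_value_eq (t := Var 0) (u := Var 1) H); constructor; simpl; lia.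
Qed.

Definition same (u v : nat) : Prop :=
  val (Nat.max (stage u) (stage v)) u = val (Nat.max (stage u) (stage v)) v.

Lemma same_val u v t : slot u -> slot v -> stage u <= t -> stage v <= t ->
  (same u v <-> val t u = val t v).
Proof. intros Hu Hv Lu Lv. apply val_eq_stable; trivial; lia. Qed.

(* Least slots represent the elements, which keeps the domain decidable. *)
Definition limit_dom (u : nat) : Prop :=
  slot u /\ forall v, v < u -> ~ (slot v /\ same v u).

Lemma limit_dom_slots a : Forall limit_dom a -> Forall slot a.
Proof. apply Forall_impl. now intros u []. Qed.

Lemma representative u : slot u ->
  exists v, limit_dom v /\ forall t, stage u <= t -> stage v <= t -> val t v = val t u.
Proof.
  intros Hu. destruct (@least_exists (fun v => slot v /\ same v u)) as (v & [Hv Hs] & Hmin).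
  { exists u. now split. }
  exists v. split.
  - split; [exact Hv|]. intros w Hw [Sw E]. apply (Hmin w Hw). split; [exact Sw|].
    set (t := Nat.max (stage u) (Nat.max (stage v) (stage w))).
    assert (Lu : stage u <= t) by lia. assert (Lv : stage v <= t) by lia.
    assert (Lw : stage w <= t) by lia.
    rewrite (same_val (t := t)) in E by assumption.
    rewrite (same_val (t := t)) in Hs by assumption.
    rewrite (same_val (t := t)) by assumption. congruence.
  - intros t Lu Lv. now apply same_val.
Qed.

Lemma representatives a : Forall slot a -> exists c, Forall limit_dom c /\
  forall t, stages a <= t -> stages c <= t -> map (val t) c = map (val t) a.
Proof.
  induction 1 as [|u a Hu _ (c & Hc & E)]; [now exists nil|].
  destruct (representative Hu) as (v & Hv & F). exists (v :: c). split; [now constructor|].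
  intros t La Lc. rewrite stages_le in La, Lc. apply Forall_cons_iff in La as [Lu La].
  apply Forall_cons_iff in Lc as [Lv Lc]. simpl. f_equal; [auto|].
  apply E; now apply stages_le.
Qed.

Lemma limit_dom_unique u v t : limit_dom u -> limit_dom v -> stage u <= t -> stage v <= t ->
  val t u = val t v -> u = v.
Proof.
  intros [Hu Mu] [Hv Mv] Lu Lv E.
  destruct (Nat.lt_trichotomy u v) as [Hlt|[|Hlt]]; [exfalso|assumption|exfalso].
  - apply (Mv u Hlt). split; [exact Hu|]. now apply (same_val (t := t)).
  - apply (Mu v Hlt). split; [exact Hv|]. now apply (same_val (t := t)).
Qed.

Definition slots_of (t : nat) : list nat := map (fun i => code (t, i)) (seq 0 (length (snd (ch t)))).

Lemma slot_code t i : i < length (snd (ch t)) -> slot (code (t, i)).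
Proof. intros Hi. unfold slot, coord, stage. now rewrite codeK. Qed.

Lemma stages_code t J : stages (map (fun i => code (t, i)) J) <= t.
Proof.
  apply stages_le, Forall_map, Forall_forall. intros i _. unfold stage. rewrite codeK. simpl. lia.
Qed.

Lemma slots_code t J : Forall (fun i => i < length (snd (ch t))) J ->
  Forall slot (map (fun i => code (t, i)) J).
Proof. intros H. apply Forall_map. revert H. apply Forall_impl. intros i. apply slot_code. Qed.

Lemma val_code s t J : map (val s) (map (fun i => code (t, i)) J) = pick (snd (ch s)) J.
Proof.
  unfold pick. rewrite map_map. apply map_ext. intros i. unfold val, coord. now rewrite codeK.
Qed.

Lemma slots_of_slots t : Forall slot (slots_of t).
Proof. apply slots_code, Forall_forall. intros i Hi. apply in_seq in Hi. lia. Qed.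

Lemma val_slots_of t : map (val t) (slots_of t) = snd (ch t).
Proof. unfold slots_of. rewrite val_code. apply pick_seq. Qed.

(** Carries [chain_extension] from coordinates to elements: the new positions are slots of the stage
    found, and these are replaced by their least representatives. *)
Lemma limit_extension n a k1 b1 u1 : Forall slot a -> stages a <= n ->
  base K (fst (ch n), map (val n) a) -> eqv K (fst (ch n), map (val n) a) (k1, b1) ->
  Forall (dom (str K k1)) u1 ->
  exists v s, Forall limit_dom v /\ n <= s /\ stages v <= s /\
    eqv K (k1, b1 ++ u1) (fst (ch s), map (val s) (a ++ v)).
Proof.
  intros Ha Hn Hb H1 Hu. rewrite val_pick in Hb, H1.
  destruct (chain_extension Hch (slots_coord Ha Hn) Hb H1 Hu) as (m & J & Hnm & HJ & E).
  destruct (representatives (slots_code HJ)) as (v & Hv & Ev).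
  (* No bound on the stages of the representatives is assumed, so [s] waits for them. *)
  set (s := Nat.max m (stages v)).
  exists v, s. split; [exact Hv|]. split; [lia|]. split; [lia|].
  apply (eqv_trans E). rewrite map_app, Ev by (try (pose proof (stages_code m J)); lia).
  rewrite val_code, val_pick, <- !pick_app. apply chain_pick; [lia|].
  apply Forall_app. split; [|exact HJ]. apply slots_coord; [exact Ha | lia].
Qed.

(** The tuple [a] may fail to generate a base, but the whole tuple of stage [t] does: it is put in
    front, the extension is made over both, and it is dropped again. *)
Lemma limit_realize t a x : Forall slot a -> stages a <= t -> Forall (dom (A t)) x ->
  exists v s, Forall limit_dom v /\ t <= s /\ stages v <= s /\
    eqv K (fst (ch t), map (val t) a ++ x) (fst (ch s), map (val s) (a ++ v)).
Proof.
  intros Ha Ht Hx.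
  assert (Hs : Forall slot (slots_of t ++ a)) by (apply Forall_app; split; [apply slots_of_slots | exact Ha]).
  assert (Hl : stages (slots_of t ++ a) <= t).
  { rewrite stages_app. pose proof (stages_code t (seq 0 (length (snd (ch t))))).
    unfold slots_of. lia. }
  pose proof (chain_generated Hch t) as [Gd Gc].
  assert (Hb : base K (fst (ch t), map (val t) (slots_of t ++ a))).
  { rewrite map_app, val_slots_of.
    apply (base_cl (b := snd (ch t))).
    - exact Gd.
    - apply Forall_forall. intros y Hy. apply cl_gen, in_app_iff. now left.
    - apply Forall_app. split; [now apply Forall_forall; intros; apply cl_gen|].
      generalize (val_dom Ha Ht). apply Forall_impl. intros y. apply Gc.
    - rewrite <- surjective_pairing. apply (chain_base Hch). }
  assert (H1 := eqv_refl (val_dom Hs Hl)).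
  destruct (limit_extension Hs Hl Hb H1 Hx) as (v & s & Hv & Hts & Hvs & E).
  exists v, s. split; [exact Hv|]. split; [exact Hts|]. split; [exact Hvs|].
  rewrite !map_app, <- !app_assoc in E. rewrite map_app. revert E. apply eqv_app_r.
  now rewrite !length_map.
Qed.

Definition fn_spec (m : nat) (a : list nat) (u : nat) : Prop :=
  limit_dom u /\
  val (Nat.max (stage u) (stages a)) u =
    fn (A (Nat.max (stage u) (stages a))) m (map (val (Nat.max (stage u) (stages a))) a).

Lemma fn_val_stable m a u s t : fun_sym L m -> length a = arity L m ->
  slot u -> Forall slot a -> stage u <= s -> stages a <= s -> s <= t ->
  (val s u = fn (A s) m (map (val s) a) <-> val t u = fn (A t) m (map (val t) a)).
Proof.
  intros Hm Hl Hu Ha Lu La Hst.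
  assert (H : eqv K (fst (ch s), map (val s) (u :: a)) (fst (ch t), map (val t) (u :: a))).
  { apply val_eqv; [now constructor | | exact Hst]. apply stages_le. constructor; [exact Lu|].
    now apply stages_le. }
  destruct H as (_ & _ & H). cbn [fst snd map] in H. apply (simeq_fn H Hm). now rewrite length_map.
Qed.

Lemma fn_spec_val m a u t : fun_sym L m -> length a = arity L m -> Forall slot a ->
  limit_dom u -> stage u <= t -> stages a <= t ->
  (fn_spec m a u <-> val t u = fn (A t) m (map (val t) a)).
Proof.
  intros Hm Hl Ha Hu Lu La. unfold fn_spec.
  rewrite (fn_val_stable Hm Hl (u := u) (t := t)); try assumption; try lia; [tauto | apply Hu].
Qed.

(** The value lives in the structure of the stage of [a], perhaps without being a coordinate there.
    It is realized by an element of the limit, and the equation defining it is atomic and so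
    survives. *)
Lemma fn_spec_exists m a : fun_sym L m -> length a = arity L m -> Forall slot a ->
  exists u, fn_spec m a u.
Proof.
  intros Hm Hl Ha. set (t := stages a). set (x := fn (A t) m (map (val t) a)).
  assert (Hx : Forall (dom (A t)) [x]).
  { repeat constructor. apply fn_dom; [exact Hm | now rewrite length_map | now apply val_dom]. }
  destruct (limit_realize Ha (le_n t) Hx) as (v & s & Hv & Hts & Hvs & E).
  pose proof (eqv_length E) as Hlen. rewrite map_app, !length_app, !length_map in Hlen.
  destruct v as [|u [|]]; try (simpl in Hlen; lia). clear Hlen.
  apply Forall_cons_iff in Hv as [Hu _]. apply stages_le, Forall_cons_iff in Hvs as [Hus _].
  exists u. apply (fn_spec_val (t := s)); trivial; try lia.
  destruct E as (_ & _ & E). rewrite map_app in E. cbn [fst snd] in E.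
  apply simeq_app_swap in E; [|now rewrite !length_map].
  apply (simeq_fn E Hm); [now rewrite length_map | reflexivity].
Qed.

Definition limit_fn (m : nat) (a : list nat) : nat := epsilon (inhabits 0) (fn_spec m a).

Lemma limit_fn_spec m a : fun_sym L m -> length a = arity L m -> Forall slot a ->
  fn_spec m a (limit_fn m a).
Proof. intros Hm Hl Ha. apply (epsilon_spec (inhabits 0) (fn_spec m a)). now apply fn_spec_exists. Qed.

Definition limit : structure L nat.
Proof.
  refine (@Structure L nat limit_dom
    (fun n a => rel (A (stages a)) n (map (val (stages a)) a)) limit_fn _).
  intros m a Hm Hl Ha. apply (limit_fn_spec Hm Hl). now apply limit_dom_slots.
Defined.

Lemma limit_fn_val m a t : fun_sym L m -> length a = arity L m -> Forall limit_dom a ->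
  stage (fn limit m a) <= t -> stages a <= t ->
  val t (fn limit m a) = fn (A t) m (map (val t) a).
Proof.
  intros Hm Hl Ha Lu La. apply limit_dom_slots in Ha.
  pose proof (limit_fn_spec Hm Hl Ha) as H. apply (fn_spec_val Hm Hl Ha); try assumption. apply H.
Qed.

Lemma eventually_forall (P : term -> nat -> Prop) ts :
  (forall t, In t ts -> exists n, forall m, n <= m -> P t m) ->
  exists n, forall m, n <= m -> forall t, In t ts -> P t m.
Proof.
  induction ts as [|t ts IH]; intros H; [now exists 0|].
  destruct (H t (or_introl eq_refl)) as [n Hn].
  destruct IH as [n' Hn']; [intros u Hu; apply H; now right|].
  exists (Nat.max n n'). intros m Hm u [<-|Hu]; [apply Hn | apply Hn']; try assumption; lia.
Qed.

(** The values of subterms are elements whose slots may appear late, hence a threshold [n] that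
    depends on the term. *)
Lemma limit_value a t : Forall limit_dom a -> is_term L (length a) t ->
  exists n, forall s, n <= s -> stage (value limit a t) <= s /\
    val s (value limit a t) = value (A s) (map (val s) a) t.
Proof.
  intros Ha. induction t as [i|m ts IH] using term_nested_ind; intros Ht; inversion Ht; subst.
  - exists (stages a). intros s Hs. cbn [value].
    rewrite (nth_indep (map (val s) a) _ (val s (fn limit 0 nil))) by now rewrite length_map.
    rewrite map_nth. split; [|reflexivity].
    apply stages_le in Hs. rewrite Forall_forall in Hs. now apply Hs, nth_In.
  - destruct (eventually_forall (P := fun t s => stage (value limit a t) <= s /\
      val s (value limit a t) = value (A s) (map (val s) a) t) (ts := ts)) as [n Hn]; [auto|].
    exists (Nat.max n (stage (value limit a (App m ts)))). intros s Hs. split; [lia|].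
    cbn [value] in *. rewrite limit_fn_val.
    + rewrite map_map. f_equal. apply map_ext_in. intros t Ht'. apply Hn; [lia | exact Ht'].
    + assumption.
    + now rewrite length_map.
    + apply (values_dom (A := limit)); [exact Ha | now apply Forall_forall].
    + lia.
    + apply stages_le, Forall_map, Forall_forall. intros t Ht'. apply Hn; [lia | exact Ht'].
Qed.

(** A formula is first evaluated at a stage late enough to contain the values of all its terms. It
    then moves back to [t], since from the stages of [a] on every stage gives [a] the same atomic
    type. *)
Lemma limit_simeq a t : Forall limit_dom a -> stages a <= t ->
  simeq limit a (A t) (map (val t) a).
Proof.
  intros Ha Ht. pose proof (limit_dom_slots Ha) as Hsl.
  split; [now rewrite length_map|]. intros phi Hphi.
  assert (Hbig : exists s, t <= s /\ (sat limit a phi <-> sat (A s) (map (val s) a) phi)).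
  { destruct phi as [u v|n ts].
    - destruct Hphi as [Hu Hv].
      destruct (limit_value Ha Hu) as [n1 H1], (limit_value Ha Hv) as [n2 H2].
      set (s := Nat.max t (Nat.max n1 n2)). exists s. split; [lia|]. cbn [sat].
      destruct (H1 s) as [L1 E1]; [lia|]. destruct (H2 s) as [L2 E2]; [lia|].
      rewrite <- E1, <- E2. split; [congruence|]. apply limit_dom_unique; try assumption;
        now apply (value_dom (A := limit)).
    - destruct Hphi as (Hn & Hl & Hts).
      destruct (eventually_forall (P := fun t s => stage (value limit a t) <= s /\
        val s (value limit a t) = value (A s) (map (val s) a) t) (ts := ts)) as [n1 H1].
      { intros u Hu. apply limit_value; auto. }
      assert (Hd : Forall limit_dom (map (value limit a) ts)).
      { apply (values_dom (A := limit)); [exact Ha | now apply Forall_forall]. }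
      set (w := map (value limit a) ts) in *.
      set (s := Nat.max t (Nat.max n1 (stages w))). exists s. split; [lia|].
      cbn [sat]. fold w. cbn [rel limit].
      replace (map (value (A s) (map (val s) a)) ts) with (map (val s) w).
      + apply limit_dom_slots in Hd. assert (Hws : stages w <= s) by lia.
        pose proof (val_eqv Hd (le_n _) Hws) as (_ & _ & H).
        cbn [fst snd] in H. apply (simeq_rel H Hn). unfold w. now rewrite !length_map.
      + unfold w. rewrite map_map. apply map_ext_in. intros u Hu. apply H1; [lia | exact Hu]. }
  destruct Hbig as (s & Hts & ->).
  destruct (val_eqv Hsl Ht Hts) as (_ & _ & [_ H]). symmetry. apply H.
  cbn [snd]. now rewrite length_map.
Qed.

(** * Homogeneity and age of the limit *)

Definition limit_base (a : list nat) : Prop :=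
  Forall limit_dom a /\ base K (fst (ch (stages a)), map (val (stages a)) a).

Lemma simeq_eqv a k b t : Forall limit_dom a -> Forall (dom (str K k)) b -> stages a <= t ->
  simeq limit a (str K k) b -> eqv K (fst (ch t), map (val t) a) (k, b).
Proof.
  intros Ha Hb Ht H. split; [|split]; cbn [fst snd].
  - apply val_dom; [now apply limit_dom_slots | exact Ht].
  - exact Hb.
  - apply (simeq_trans (simeq_sym (limit_simeq Ha Ht)) H).
Qed.

Lemma eqv_simeq a k b t : Forall limit_dom a -> stages a <= t ->
  eqv K (k, b) (fst (ch t), map (val t) a) -> simeq limit a (str K k) b.
Proof.
  intros Ha Ht (_ & _ & H). apply (simeq_trans (limit_simeq Ha Ht)). now apply simeq_sym.
Qed.

(** By invariance of [base] under [eqv], neither the stage at which [limit_base] is read off nor the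
    copy chosen in the age matters. *)
Lemma limit_base_iff a k b : Forall limit_dom a -> Forall (dom (str K k)) b ->
  simeq limit a (str K k) b -> (limit_base a <-> base K (k, b)).
Proof.
  intros Ha Hb H. pose proof (simeq_eqv Ha Hb (le_n _) H) as E. split.
  - intros [_ Hbase]. now apply (base_eqv E).
  - intros Hbase. split; [exact Ha|]. now apply (base_eqv (eqv_sym E)).
Qed.

Lemma limit_simeq_dom a t : Forall limit_dom a -> stages a <= t ->
  Forall (dom (A t)) (map (val t) a).
Proof. intros Ha Ht. apply val_dom; [now apply limit_dom_slots | exact Ht]. Qed.

Lemma limit_homogeneous a k b u : limit_base a -> Forall (dom (str K k)) b ->
  simeq limit a (str K k) b -> Forall (dom (str K k)) u ->
  exists v, Forall limit_dom v /\ simeq limit (a ++ v) (str K k) (b ++ u).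
Proof.
  intros [Ha Hbase] Hb H Hu.
  destruct (limit_extension (limit_dom_slots Ha) (le_n _) Hbase (simeq_eqv Ha Hb (le_n _) H) Hu)
    as (v & s & Hv & Hs & Hvs & E).
  exists v. split; [exact Hv|]. apply (eqv_simeq (t := s)); [|rewrite stages_app; lia | exact E].
  now apply Forall_app.
Qed.

(** The tuple of the stage of [a] generates a base containing the values of [a]; a realization of
    this whole tuple over [a] is appended to [a]. *)
Lemma limit_cover a : Forall limit_dom a -> exists c k w, Forall limit_dom c /\ incl a c /\
  base K (k, w) /\ generated_by (str K k) w /\ simeq limit c (str K k) w.
Proof.
  intros Ha. set (t := stages a).
  pose proof (limit_simeq_dom Ha (le_n _)) as Hd. fold t in Hd.
  pose proof (chain_generated Hch t) as Hg.
  destruct (limit_realize (t := t) (a := a) (x := snd (ch t)) (limit_dom_slots Ha) (le_n _) (proj1 Hg))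
    as (v & s & Hv & Hts & Hvs & E).
  assert (Hw : generated_by (A t) (map (val t) a ++ snd (ch t))).
  { apply (generated_by_incl Hg); [intros x Hx; apply in_app_iff; now right|].
    apply Forall_app. split; [exact Hd | apply Hg]. }
  exists (a ++ v), (fst (ch t)), (map (val t) a ++ snd (ch t)).
  split; [now apply Forall_app|]. split; [apply incl_appl, incl_refl|].
  split; [|split; [exact Hw|]].
  - apply (base_generating (b := snd (ch t))); [exact Hg | exact Hw|].
    rewrite <- surjective_pairing. apply (chain_base Hch).
  - apply (eqv_simeq (t := s)); [now apply Forall_app | rewrite stages_app; lia | exact E].
Qed.

Lemma limit_universal (gen_str : forall k, generated_by (str K k) (gen K k)) k :
  exists f, embedding (str K k) limit f.
Proof.
  destruct (chain_universal Hch k) as (n & v & H).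
  destruct (limit_realize (t := n) (a := nil) (x := v)) as (w & s & Hw & Hns & Hws & E).
  - constructor.
  - unfold stages. simpl. lia.
  - apply H.
  - destruct (simeq_embedding 0 (gen_str k) (B := limit) (b := w) Hw) as (f & Hf & _).
    + apply simeq_sym. apply (eqv_simeq (t := s)); [exact Hw | exact Hws|]. now apply (eqv_trans H).
    + now exists f.
Qed.

End Limit.

(** * Computability of the limit *)

Section LimitComputable.
Context {L : language} (K : representation L) (C : collection L).
Hypothesis hK : computable_age None K C.
Variable ch : nat -> nat * list nat.
Hypothesis Hch : amalgamation_chain K ch.
Hypothesis ch_computable : Comp (jump (jump (EI K))) ch.

Local Notation O2 := (jump (jump (EI K))).
Local Notation M := (limit Hch).
Local Notation A t := (str K (fst (ch t))).

Lemma Comp_decode T B `{encoding T} `{encoding B} Q (f : T -> nat) :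
  Comp Q f -> Comp Q (fun x => decode (f x) : B).
Proof. intros Hf. refine (Comp_recode (r := @decode B _) _ Hf). apply decodeK. Qed.

Lemma Comp_stage T `{encoding T} Q (u : T -> nat) : Comp Q u -> Comp Q (fun x => stage (u x)).
Proof. intros Hu. unfold stage. comp. now apply Comp_decode. Qed.

Lemma Comp_stages T `{encoding T} Q (a : T -> list nat) : Comp Q a -> Comp Q (fun x => stages (a x)).
Proof. intros Ha. unfold stages. comp. apply Comp_stage. comp. Qed.

Lemma Comp_val T `{encoding T} (t u : T -> nat) : Comp O2 t -> Comp O2 u ->
  Comp O2 (fun x => val ch (t x) (u x)).
Proof.
  intros Ht Hu. unfold val, coord. comp. now apply Comp_decode.
Qed.

Lemma Comp_vals T `{encoding T} (t : T -> nat) (a : T -> list nat) : Comp O2 t -> Comp O2 a ->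
  Comp O2 (fun x => map (val ch (t x)) (a x)).
Proof.
  intros Ht Ha. refine (Comp_map (f := fun x => val ch (t x)) _ Ha).
  apply Comp_val; comp.
Qed.

Ltac comp_user ::=
  lazymatch goal with
  | |- @Comp _ _ _ _ _ (fun x => decode (@?f x)) => refine (Comp_decode _)
  | |- @Comp _ _ _ _ _ (fun x => stage (@?f x)) => refine (Comp_stage _)
  | |- @Comp _ _ _ _ _ (fun x => stages (@?f x)) => refine (Comp_stages _)
  | |- @Comp _ _ _ _ _ (fun x => map (val _ (@?t x)) (@?a x)) => refine (Comp_vals _ _)
  | |- @Comp _ _ _ _ _ (fun x => val _ (@?t x) (@?u x)) => refine (Comp_val _ _)
  end.

Lemma Dec_slot T `{encoding T} (u : T -> nat) : Comp O2 u -> Dec O2 (fun x => slot ch (u x)).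
Proof.
  intros Hu. unfold slot, coord. dec.
Qed.

Lemma Dec_same T `{encoding T} (u v : T -> nat) : Comp O2 u -> Comp O2 v ->
  Dec O2 (fun x => same ch (u x) (v x)).
Proof.
  intros Hu Hv. unfold same. dec.
Qed.

Lemma Dec_limit_dom T `{encoding T} (u : T -> nat) : Comp O2 u ->
  Dec O2 (fun x => limit_dom ch (u x)).
Proof.
  intros Hu. unfold limit_dom. refine (Dec_and _ _); [now apply Dec_slot|].
  refine (Dec_bounded (P := fun x v => ~ (slot ch v /\ same ch v (u x))) Hu _).
  dec; [apply Dec_slot | apply Dec_same]; comp.
Qed.

Lemma Dec_limit_doms T `{encoding T} (a : T -> list nat) : Comp O2 a ->
  Dec O2 (fun x => Forall (limit_dom ch) (a x)).
Proof.
  intros Ha. refine (Dec_Forall (P := fun _ => limit_dom ch) _ Ha). apply Dec_limit_dom. comp.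
Qed.

Lemma Dec_limit_base T `{encoding T} (a : T -> list nat) : Comp O2 a ->
  Dec O2 (fun x => limit_base K ch (a x)).
Proof.
  intros Ha. refine (Dec_and _ _); [now apply Dec_limit_doms|].
  refine (Dec_base_jump hK _). comp.
Qed.

(** At a common stage, similarity in the limit becomes a query about two tuples of one structure of
    the age. *)
Lemma Dec_limit_simeq T `{encoding T} (a b : T -> list nat) : Comp O2 a -> Comp O2 b ->
  Dec O2 (fun x => Forall (limit_dom ch) (a x) /\ Forall (limit_dom ch) (b x) /\
    simeq M (a x) M (b x)).
Proof.
  intros Ha Hb.
  pose (t := fun x => stages (a x ++ b x)).
  assert (Ht : Comp O2 t) by (apply Comp_stages; comp).
  apply (Dec_ext (P := fun x => Forall (limit_dom ch) (a x) /\ Forall (limit_dom ch) (b x) /\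
    eqv K (fst (ch (t x)), map (val ch (t x)) (a x)) (fst (ch (t x)), map (val ch (t x)) (b x)))).
  - intros x. assert (Hta : stages (a x) <= t x /\ stages (b x) <= t x).
    { unfold t. rewrite stages_app. lia. }
    destruct Hta as [La Lb]. split; intros (Da & Db & Hs); (split; [exact Da | split; [exact Db|]]).
    + apply (simeq_trans (limit_simeq Hch Da La)).
      apply (simeq_trans (proj2 (proj2 Hs))). apply simeq_sym. now apply limit_simeq.
    + apply (simeq_eqv (Hch := Hch) (a := a x)); trivial.
      * now apply limit_simeq_dom.
      * apply (simeq_trans Hs). now apply limit_simeq.
  - refine (Dec_and _ (Dec_and _ _)); [now apply Dec_limit_doms | now apply Dec_limit_doms|].
    refine (Dec_eqv_jump _ _); comp.
Qed.

Lemma rel_args_vals n a t : stages a <= t -> Forall (limit_dom ch) a ->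
  (rel_args M n a <-> rel_args (A t) n (map (val ch t) a)).
Proof.
  intros Ht Ha. unfold rel_args. rewrite length_map.
  pose proof (limit_simeq_dom Hch Ha Ht). simpl. tauto.
Qed.

(** [D] and [P] are either the positive diagram with [rel] or the negative one with its negation,
    which share the argument: a tuple of the limit is looked up at its own stage. *)
Lemma Dec_rel_diagram (D : forall A : structure L nat, nat -> Prop)
    (P : forall A : structure L nat, nat -> list nat -> Prop) :
  (forall A x, D A x <-> exists n a, x = ⟨n, code_tuple a⟩ /\ rel_args A n a /\ P A n a) ->
  Dec O2 (fun t => D (str K (fst t)) (snd t)) ->
  (forall n a, rel_args M n a -> (P M n a <-> P (A (stages a)) n (map (val ch (stages a)) a))) ->
  Dec O2 (D M).
Proof.
  intros HD Hdec HP.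
  pose (R := fun na : nat * list nat => Forall (limit_dom ch) (snd na) /\
    D (A (stages (snd na))) (code (fst na, map (val ch (stages (snd na))) (snd na)))).
  apply (Dec_ext (P := fun x : nat => R (decode x))).
  - intros x. destruct (code_surj (A := nat * list nat) x) as [[n a] <-]. rewrite codeK. unfold R. cbn [fst snd].
    rewrite !HD. split.
    + intros (Ha & n' & a' & E & Hr & Hp).
      change (code (n, map (val ch (stages a)) a)) with ⟨n, code (map (val ch (stages a)) a)⟩ in E.
      rewrite code_list_tuple in E. apply pair_inj in E as [<- E]. apply code_tuple_inj in E as <-.
      apply rel_args_vals in Hr; [|exact (le_n _) | exact Ha].
      exists n, a. split; [now rewrite <- code_list_tuple|]. split; [exact Hr | now apply HP].
    + intros (n' & a' & E & Hr & Hp).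
      change (code (n, a)) with ⟨n, code a⟩ in E.
      rewrite code_list_tuple in E. apply pair_inj in E as [<- E]. apply code_tuple_inj in E as <-.
      pose proof Hr as (_ & _ & Ha). split; [exact Ha|].
      exists n, (map (val ch (stages a)) a). split; [now rewrite <- code_list_tuple|].
      split; [now apply rel_args_vals | now apply HP].
  - refine (Dec_decode (P := R) _). refine (Dec_and _ _); [apply Dec_limit_doms; comp|].
    refine (Dec_comp (f := fun na : nat * list nat => (fst (ch (stages (snd na))),
      code (fst na, map (val ch (stages (snd na))) (snd na)))) Hdec _).
    comp.
Qed.

Lemma limit_rel n a : rel_args M n a ->
  (rel M n a <-> rel (A (stages a)) n (map (val ch (stages a)) a)).
Proof.
  intros (Hn & Hl & Ha). apply (simeq_rel (limit_simeq Hch Ha (le_n _)) Hn Hl).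
Qed.

Lemma fn_limit_unique m a u t : fun_sym L m -> length a = arity L m -> Forall (limit_dom ch) a ->
  limit_dom ch u -> stage u <= t -> stages a <= t ->
  (u = fn M m a <-> val ch t u = fn (A t) m (map (val ch t) a)).
Proof.
  intros Hm Hl Ha Hu Lu La.
  assert (Hua : Forall (limit_dom ch) (u :: a)) by now constructor.
  assert (Ht : stages (u :: a) <= t).
  { apply stages_le. constructor; [exact Lu | now apply stages_le]. }
  exact (simeq_fn (limit_simeq Hch Hua Ht) Hm Hl).
Qed.

Lemma Dec_limit_fun_diagram : Dec O2 (fun_diagram M).
Proof.
  pose (t := fun r : nat * (list nat * nat) => Nat.max (stage (snd (snd r))) (stages (fst (snd r)))).
  assert (Ht : Comp O2 t).
  { unfold t. comp. }
  pose (R := fun r : nat * (list nat * nat) =>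
    Forall (limit_dom ch) (fst (snd r)) /\ limit_dom ch (snd (snd r)) /\
    fun_diagram (A (t r)) (code (fst r, (map (val ch (t r)) (fst (snd r)), val ch (t r) (snd (snd r)))))).
  apply (Dec_ext (P := fun x : nat => R (decode x))).
  - intros x. destruct (code_surj (A := nat * (list nat * nat)) x) as [[m [a u]] <-].
    rewrite codeK. unfold R. cbn [fst snd].
    assert (E : forall m a u, code (m, (a, u)) = ⟨m, ⟨code_tuple a, u⟩⟩).
    { intros. now rewrite <- code_list_tuple. }
    rewrite !E.
    assert (Lu : stage u <= t (m, (a, u))) by (unfold t; simpl; lia).
    assert (La : stages a <= t (m, (a, u))) by (unfold t; simpl; lia).
    split.
    + intros (Ha & Hu & m' & a' & Ex & Hm & Hl & Hd).
      apply pair_inj in Ex as [<- Ex]. apply pair_inj in Ex as [Ex Ef].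
      apply code_tuple_inj in Ex as <-. rewrite length_map in Hl.
      exists m, a. apply fn_limit_unique in Ef; trivial. rewrite <- Ef.
      repeat split; trivial.
    + intros (m' & a' & Ex & Hm & Hl & Ha).
      apply pair_inj in Ex as [<- Ex]. apply pair_inj in Ex as [Ex Ef].
      apply code_tuple_inj in Ex as <-.
      assert (Hu : limit_dom ch u) by (rewrite Ef; exact (fn_dom Hm Hl Ha)).
      split; [exact Ha|]. split; [exact Hu|].
      exists m, (map (val ch (t (m, (a, u)))) a).
      rewrite (fn_limit_unique Hm Hl Ha Hu Lu La) in Ef. rewrite <- Ef.
      split; [reflexivity|]. split; [exact Hm|]. split; [now rewrite length_map|].
      now apply limit_simeq_dom.
  - refine (Dec_decode (P := R) _). refine (Dec_and _ (Dec_and _ _)).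
    + apply Dec_limit_doms; comp.
    + apply Dec_limit_dom; comp.
    + refine (Dec_comp (f := fun r => (fst (ch (t r)),
        code (fst r, (map (val ch (t r)) (fst (snd r)), val ch (t r) (snd (snd r))))))
        (Dec_jump (Dec_fun_diagram hK)) _).
      comp.
Qed.

Lemma limit_computable : computable_structure (Some O2) M.
Proof.
  destruct (@Dec_computable_set O2 (limit_dom ch)) as [d Hd].
  { apply Dec_limit_dom. comp. }
  destruct (@Dec_ce_set O2 (pos_diagram M)) as [p Hp].
  { apply (Dec_rel_diagram (P := fun A n a => rel A n a)); [reflexivity | | exact limit_rel].
    exact (Dec_jump (Dec_pos_diagram hK)). }
  destruct (@Dec_ce_set O2 (neg_diagram M)) as [n Hn].
  { apply (Dec_rel_diagram (P := fun A n a => ~ rel A n a)); [reflexivity | |].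
    - exact (Dec_jump (Dec_neg_diagram hK)).
    - intros i a Ha. now rewrite (limit_rel Ha). }
  destruct (Dec_ce_set Dec_limit_fun_diagram) as [f Hf].
  exists ⟨d, ⟨p, ⟨n, f⟩⟩⟩, d, p, n, f. auto.
Qed.

End LimitComputable.

(** * The age of the limit *)

Lemma is_age_age_of L U (M : structure L U) : is_age (age_of M).
Proof.
  split.
  - intros V B (A & _ & [a [Ha Hg]] & [f [Hf Sf]]). exists (map f a). split.
    + now apply (embedding_dom Hf).
    + intros y. split.
      * intros Hy. destruct (Sf y Hy) as (x & Hx & <-).
        destruct (cl_value (proj1 (Hg x) Hx)) as (t & Ht & <-).
        rewrite <- (embedding_value Hf Ha Ht). apply value_cl. now rewrite length_map.
      * apply cl_dom. now apply (embedding_dom Hf).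
  - intros V W A B (D & HD & Hfg & [f Hf]) [g Hg]. exists D. split; [exact HD|].
    split; [exact Hfg|]. exists (fun x => g (f x)). now apply (isomorphism_comp Hf).
Qed.

(** The image keeps the relations and functions of [M]; only the domain shrinks. Closure holds
    because [f] commutes with the functions. *)
Definition image_structure L (A M : structure L nat) (f : nat -> nat)
  (Hf : embedding A M f) : structure L nat.
Proof.
  refine (@Structure L nat (fun y => exists x, dom A x /\ f x = y) (rel M) (fn M) _).
  intros m b Hm Hl Hb.
  assert (Ha : exists a, Forall (dom A) a /\ map f a = b).
  { clear Hl. induction Hb as [|y b (x & Hx & <-) _ (a & Ha & <-)]; [now exists nil|].
    exists (x :: a). split; [now constructor | reflexivity]. }
  destruct Ha as (a & Ha & <-). rewrite length_map in Hl.
  exists (fn A m a). split; [now apply fn_dom|]. now apply Hf.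
Defined.

Lemma image_structure_isomorphism L (A M : structure L nat) f (Hf : embedding A M f) :
  isomorphism A (image_structure Hf) f.
Proof.
  pose proof Hf as (F1 & F2 & F3 & F4). split; [|intros y Hy; exact Hy].
  split; [|split; [|split]]; auto. intros x Hx. now exists x.
Qed.

Lemma image_structure_substructure L (A M : structure L nat) f (Hf : embedding A M f) :
  substructure (image_structure Hf) M.
Proof.
  split; [|split]; simpl; try easy. intros y (x & Hx & <-). now apply Hf.
Qed.

Lemma fin_gen_isomorphic L U V (A : structure L U) (B : structure L V) :
  fin_gen A -> isomorphic A B -> fin_gen B.
Proof.
  intros HA HAB. apply (proj1 (is_age_age_of A) _ B). exists A.
  split; [now split|]. now split.
Qed.

Lemma embedding_age_of L (A M : structure L nat) f :
  embedding A M f -> fin_gen A -> age_of M A.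
Proof.
  intros Hf HA. exists (image_structure Hf).
  pose proof (image_structure_isomorphism Hf) as Hi.
  destruct (isomorphism_inv 0 Hi) as (g & Hg & _).
  split; [apply image_structure_substructure|].
  split; [apply (fin_gen_isomorphic HA); now exists f | now exists g].
Qed.

Section LimitAge.
Context {L : language} (K : representation L) (C : collection L).
Hypothesis hK : computable_age None K C.
Hypothesis hHP : HP C.
Variable ch : nat -> nat * list nat.
Hypothesis Hch : amalgamation_chain K ch.

(** The hereditary property closes the argument: [A] is pulled back along the embedding [f] to a
    finitely generated substructure of [str K k], which then belongs to [C] and so has a
    representative. *)
Lemma limit_age U (B : structure L U) : age_of (limit Hch) B -> exists i, isomorphic B (str K i).
Proof.
  intros (A & HA & [a [Ha Hg]] & HAB).
  assert (Had : Forall (dom (limit Hch)) a).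
  { revert Ha. apply Forall_impl. intros x. apply HA. }
  destruct (limit_cover Hch Had) as (c & k & w & Hc & Hac & _ & Hw & H).
  (* [A] sits inside the copy of [str K k] generated by [c]. *)
  destruct (simeq_embedding (B := limit Hch) (b := c) 0 Hw Hc (simeq_sym H)) as (f & Hf & Efc).
  assert (Himg : forall x, dom A x -> exists y, dom (str K k) y /\ f y = x).
  { intros x Hx. apply Hg in Hx. induction Hx as [x Hx|m b Hm Hl Hb IH].
    - apply Hac in Hx. rewrite <- Efc in Hx. apply in_map_iff in Hx as (y & E & Hy).
      exists y. split; [|exact E]. pose proof (proj1 Hw) as Hwd. rewrite Forall_forall in Hwd. auto.
    - assert (Hy : exists d, Forall (dom (str K k)) d /\ map f d = b).
      { clear Hl Hb. induction b as [|z b IHb]; [now exists nil|].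
        destruct (IH z (or_introl eq_refl)) as (y & Hy & <-).
        destruct IHb as (d & Hd & <-); [intros z Hz; apply IH; now right|].
        exists (y :: d). split; [now constructor | reflexivity]. }
      destruct Hy as (d & Hd & <-). rewrite length_map in Hl.
      exists (fn (str K k) m d). split; [now apply fn_dom|].
      destruct HA as (HA1 & _ & HA3). rewrite HA3.
      + apply Hf. now repeat split.
      + repeat split; [exact Hm | now rewrite length_map|].
        apply Forall_forall. intros z Hz. apply Hg. auto. }
  pose (g := fun x => epsilon (inhabits 0) (fun y => dom (str K k) y /\ f y = x)).
  assert (Hg' : forall x, dom A x -> dom (str K k) (g x) /\ f (g x) = x).
  { intros x Hx. apply (epsilon_spec (inhabits 0) (fun y => dom (str K k) y /\ f y = x)). auto. }
  assert (Hfg : forall b, Forall (dom A) b -> map f (map g b) = b).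
  { intros b Hb. rewrite map_map. rewrite <- map_id. apply map_ext_in. intros y Hy.
    rewrite Forall_forall in Hb. now apply Hg', Hb. }
  assert (Hgd : forall b, Forall (dom A) b -> Forall (dom (str K k)) (map g b)).
  { intros b Hb. apply Forall_map. revert Hb. apply Forall_impl. intros y Hy. now apply Hg'. }
  pose proof Hf as (F1 & F2 & F3 & F4).
  assert (Hge : embedding A (str K k) g).
  { split; [|split; [|split]].
    - intros x Hx. now apply Hg'.
    - intros x y Hx Hy E. rewrite <- (proj2 (Hg' x Hx)), <- (proj2 (Hg' y Hy)). congruence.
    - intros n b Hb. pose proof Hb as (Hn & Hl & Hd).
      destruct HA as (_ & HA2 & _). rewrite HA2 by exact Hb. rewrite <- (Hfg b Hd) at 1.
      symmetry. apply F3. split; [exact Hn|]. split; [now rewrite length_map | auto].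
    - intros m b Hb. pose proof Hb as (Hm & Hl & Hd).
      apply F2; [now apply Hg', fn_dom | apply fn_dom; [exact Hm | now rewrite length_map | auto]|].
      rewrite F4 by (split; [exact Hm | split; [now rewrite length_map | auto]]).
      rewrite Hfg by exact Hd. rewrite (proj2 (Hg' _ (fn_dom Hm Hl Hd))). now apply HA. }
  pose proof (image_structure_isomorphism Hge) as Hi.
  assert (HC : C (image_structure Hge)).
  { apply (hHP (B := str K k)); [apply (age_str hK) | apply image_structure_substructure|].
    apply (fin_gen_isomorphic (A := A)); [now exists a | now exists g]. }
  destruct (age_represented hK HC) as (i & j & Hj).
  destruct HAB as [h Hh]. destruct (isomorphism_inv 0 Hh) as (h' & Hh' & _).
  exists i. exists (fun x => j (g (h' x))). apply (isomorphism_comp (B := image_structure Hge)); [|exact Hj].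
  now apply (isomorphism_comp Hh').
Qed.

Lemma limit_computable_age Q : computable_age (Some Q) K (age_of (limit Hch)).
Proof.
  split; [apply is_age_age_of|]. split; [|split].
  - destruct hK as (_ & [e He] & _). exists e. now apply ce_index_relativize.
  - intros i. split; [apply structure_index_relativize, (age_structure_index hK)|].
    split; [|apply (age_gen_str hK)].
    destruct (limit_universal Hch (age_gen_str hK) i) as [f Hf].
    apply (embedding_age_of Hf). exists (gen K i). apply (age_gen_str hK).
  - exact limit_age.
Qed.

End LimitAge.

(** * Back and forth *)

(** One biconditional covers being a function and being injective. The nested [Forall] makes it
    decidable by its form. *)
Definition partial_injection (l : list (nat * nat)) : Prop :=
  Forall (fun p => Forall (fun q => fst p = fst q <-> snd p = snd q) l) l.

Lemma partial_injection_iff l : partial_injection l <->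
  forall p q, In p l -> In q l -> (fst p = fst q <-> snd p = snd q).
Proof.
  unfold partial_injection. rewrite Forall_forall. split.
  - intros H p q Hp Hq. specialize (H p Hp). rewrite Forall_forall in H. auto.
  - intros H p Hp. apply Forall_forall. auto.
Qed.

Definition swap (p : nat * nat) : nat * nat := (snd p, fst p).

Lemma map_fst_swap l : map fst (map swap l) = map snd l.
Proof. now rewrite map_map. Qed.

Lemma map_snd_swap l : map snd (map swap l) = map fst l.
Proof. now rewrite map_map. Qed.

Lemma partial_injection_swap l : partial_injection l -> partial_injection (map swap l).
Proof.
  rewrite !partial_injection_iff. intros H p q Hp Hq.
  apply in_map_iff in Hp as (p' & <- & Hp), Hq as (q' & <- & Hq). simpl. symmetry. auto.
Qed.

Lemma simeq_partial_injection L (A B : structure L nat) l :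
  simeq A (map fst l) B (map snd l) -> partial_injection l.
Proof.
  intros H. apply partial_injection_iff. intros p q Hp Hq.
  assert (Hi : incl [p; q] l) by (intros r [<-|[<-|[]]]; assumption).
  pose proof (simeq_pairs H Hi) as H'.
  apply (simeq_value_eq (t := Var 0) (u := Var 1) H'); constructor; simpl; lia.
Qed.

(** The condition that ultrahomogeneity puts on two tuples is thus exactly that their pairing can
    start a back-and-forth between bare sets. *)
Lemma same_pattern_combine l :
  same_pattern (map fst l) (map snd l) <-> partial_injection l.
Proof.
  rewrite partial_injection_iff. unfold same_pattern. rewrite !length_map. split.
  - intros [_ H] p q Hp Hq.
    apply In_nth_error in Hp as [i Hi], Hq as [j Hj].
    assert (Li : i < length l) by (apply nth_error_Some; congruence).
    assert (Lj : j < length l) by (apply nth_error_Some; congruence).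
    specialize (H i j Li Lj). rewrite !nth_error_map, Hi, Hj in H. simpl in H.
    split; intros E; [assert (F : Some (snd p) = Some (snd q)) | assert (F : Some (fst p) = Some (fst q))];
      try congruence; apply H; congruence.
  - intros H. split; [reflexivity|]. intros i j Li Lj. rewrite !nth_error_map.
    apply nth_error_Some in Li, Lj.
    destruct (nth_error l i) as [p|] eqn:Hi; [|congruence].
    destruct (nth_error l j) as [q|] eqn:Hj; [|congruence]. simpl.
    apply nth_error_In in Hi, Hj. pose proof (H p q Hi Hj). split; intros E; f_equal;
      injection E; tauto.
Qed.

Lemma partial_injection_app_one l x y :
  (forall p, In p l -> (fst p = x <-> snd p = y)) -> partial_injection l ->
  partial_injection (l ++ [(x, y)]).
Proof.
  rewrite !partial_injection_iff. intros H Hl p q Hp Hq.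
  apply in_app_iff in Hp as [Hp|[<-|[]]], Hq as [Hq|[<-|[]]]; simpl.
  - auto.
  - auto.
  - specialize (H q Hq). split; intros E; symmetry; apply H; now symmetry.
  - tauto.
Qed.

(* By counting, the range of [l] does not exhaust [P] when its domain does not. *)
Lemma partial_injection_extend (P : nat -> Prop) l x :
  Forall P (map fst l) -> Forall P (map snd l) -> partial_injection l -> P x ->
  exists y, P y /\ partial_injection (l ++ [(x, y)]).
Proof.
  intros H1 H2 Hl Hx. pose proof (proj1 (partial_injection_iff l) Hl) as Hinj.
  destruct (classic (In x (map fst l))) as [Hin|Hout].
  - apply in_map_iff in Hin as ([x' y] & E & Hp). simpl in E. subst x'. exists y. split.
    + rewrite Forall_forall in H2. apply H2, in_map_iff. now exists (x, y).
    + apply partial_injection_app_one; [|exact Hl]. intros p Hp'. now apply (Hinj p (x, y)).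
  - assert (Hy : exists y, P y /\ ~ In y (map snd l)).
    { apply NNPP. intros N.
      assert (Hall : forall y, P y -> In y (map snd l)).
      { intros y Hy. apply NNPP. intros N'. apply N. now exists y. }
      assert (dec : forall p q : nat * nat, {p = q} + {p <> q}) by (repeat decide equality).
      (* Without repeated pairs the first projection has no repetition either, so adding [x] gives
         one more element than the second projection can hold. *)
      set (l' := nodup dec l).
      assert (Hin : forall p, In p l' <-> In p l) by (intros; apply nodup_In).
      assert (Hnd : NoDup (x :: map fst l')).
      { constructor.
        - intros Hx'. apply Hout. apply in_map_iff in Hx' as (p & <- & Hp).
          now apply in_map, Hin.
        - apply NoDup_map_NoDup_ForallPairs; [|apply NoDup_nodup].
          intros p q Hp Hq E. apply Hin in Hp, Hq. pose proof (proj1 (Hinj p q Hp Hq) E).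
          destruct p, q. simpl in *. congruence. }
      assert (Hincl : incl (x :: map fst l') (map snd l')).
      { intros z Hz.
        assert (Pz : P z).
        { destruct Hz as [<-|Hz]; [exact Hx|]. apply in_map_iff in Hz as (p & <- & Hp).
          rewrite Forall_forall in H1. now apply H1, in_map, Hin. }
        specialize (Hall z Pz). apply in_map_iff in Hall as (p & <- & Hp).
        now apply in_map, Hin. }
      pose proof (NoDup_incl_length Hnd Hincl) as Hlen. simpl in Hlen. rewrite !length_map in Hlen. lia. }
    destruct Hy as (y & Py & Hny). exists y. split; [exact Py|].
    apply partial_injection_app_one; [|exact Hl]. intros p Hp. split; intros E; exfalso.
    + apply Hout. rewrite <- E. now apply in_map.
    + apply Hny. rewrite <- E. now apply in_map.
Qed.

Lemma partial_injection_extend_both (P : nat -> Prop) l x :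
  Forall P (map fst l) -> Forall P (map snd l) -> partial_injection l -> P x ->
  exists u, Forall P (map fst u) /\ Forall P (map snd u) /\ partial_injection (l ++ u) /\
    In x (map fst u) /\ In x (map snd u).
Proof.
  intros H1 H2 Hl Hx.
  destruct (partial_injection_extend H1 H2 Hl Hx) as (y & Py & Hy).
  (* Bringing [x] into the range is bringing it into the domain of the inverse. *)
  destruct (@partial_injection_extend P (map swap (l ++ [(x, y)])) x) as (z & Pz & Hz); trivial.
  - rewrite map_fst_swap, map_app. apply Forall_app. split; [exact H2 | now repeat constructor].
  - rewrite map_snd_swap, map_app. apply Forall_app. split; [exact H1 | now repeat constructor].
  - now apply partial_injection_swap.
  - exists [(x, y); (z, x)]. simpl. split; [now repeat constructor|].
    split; [now repeat constructor|]. split; [|tauto].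
    apply partial_injection_swap in Hz. rewrite map_app, map_map in Hz. simpl in Hz.
    rewrite (map_ext _ (fun p => p)), map_id, <- app_assoc in Hz by now intros []. exact Hz.
Qed.

Lemma simeq_values_app L U V (A : structure L U) (B : structure L V) a b s :
  simeq A a B b -> Forall (is_term L (length a)) s ->
  simeq A (map (value A a) s ++ a) B (map (value B b) s ++ b).
Proof.
  intros H Hs.
  rewrite <- (map_value_vars A a) at 2. rewrite <- (map_value_vars B b) at 2.
  rewrite <- (simeq_length H), <- !map_app. apply (simeq_values H).
  apply Forall_app. split; [exact Hs|].
  apply Forall_map, Forall_forall. intros i Hi. apply in_seq in Hi. constructor. lia.
Qed.

Section BackAndForth.
Context {L : language} (K : representation L) (C : collection L).
Hypothesis hK : computable_age None K C.
Variable ch : nat -> nat * list nat.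
Hypothesis Hch : amalgamation_chain K ch.

Local Notation M := (limit Hch).

Lemma limit_tuple a : Forall (limit_dom ch) a -> exists k b,
  Forall (dom (str K k)) b /\ simeq M a (str K k) b.
Proof.
  intros Ha. exists (fst (ch (stages a))), (map (val ch (stages a)) a).
  split; [now apply limit_simeq_dom | now apply limit_simeq].
Qed.

Lemma limit_base_simeq a b : limit_base K ch a -> Forall (limit_dom ch) b -> simeq M a M b ->
  limit_base K ch b.
Proof.
  intros Ha Hb H. pose proof (proj1 Ha) as Hd.
  destruct (limit_tuple Hd) as (k & c & Hc & Hac).
  apply (limit_base_iff Hb Hc (simeq_trans (simeq_sym H) Hac)).
  now apply (limit_base_iff Hd Hc Hac).
Qed.

Lemma limit_base_cl a b : limit_base K ch b -> Forall (cl M b) a -> limit_base K ch (a ++ b).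
Proof.
  intros Hb Hab. pose proof (proj1 Hb) as Hd.
  destruct (limit_tuple Hd) as (k & c & Hc & Hbc).
  destruct (cl_values Hab) as (s & Hs & <-).
  assert (Hs' : Forall (is_term L (length c)) s) by now rewrite <- (simeq_length Hbc).
  apply (limit_base_iff (Hch := Hch) (k := k) (b := map (value (str K k) c) s ++ c)).
  - apply Forall_app. split; [now apply (values_dom (A := M)) | exact Hd].
  - apply Forall_app. split; [now apply values_dom | exact Hc].
  - now apply simeq_values_app.
  - apply (base_cl (b := c)); [exact Hc | | | now apply (limit_base_iff Hd Hc Hbc)].
    + apply Forall_forall. intros x Hx. apply cl_gen, in_app_iff. now right.
    + apply Forall_app. split.
      * apply Forall_map. revert Hs'. apply Forall_impl. intros t. apply value_cl.
      * apply Forall_forall. intros x. apply cl_gen.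
Qed.

Lemma limit_base_cofinal : cofinal_collection M (limit_base K ch).
Proof.
  split; [|split; [|split]].
  - now intros a [Ha _].
  - intros a Ha. destruct (limit_cover Hch Ha) as (c & k & w & Hc & Hac & Hb & [Hw _] & H).
    exists c. split; [now apply (limit_base_iff Hc Hw H)|].
    apply Forall_forall. intros x Hx. apply cl_gen. auto.
  - intros a b. apply limit_base_cl.
  - intros a b Ha Hb H. now apply (limit_base_simeq Ha).
Qed.

(** Adding [x] alone could destroy the base. Instead [x] and [a] are put inside a base [c], and a
    copy of [c] is realized over [b], which is a base because it is similar to [a]. As [c] contains
    [a], the tuple [a ++ c] is again a base and the step can be iterated. *)
Lemma limit_forth a b x : limit_base K ch a -> Forall (limit_dom ch) b -> simeq M a M b ->
  limit_dom ch x -> exists c d, length c = length d /\ Forall (limit_dom ch) d /\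
    limit_base K ch (a ++ c) /\ simeq M (a ++ c) M (b ++ d) /\ In x c.
Proof.
  intros Ha Hb H Hx. pose proof (proj1 Ha) as Hd.
  assert (Hax : Forall (limit_dom ch) (x :: a)) by now constructor.
  destruct (limit_cover Hch Hax) as (c & k & w & Hc & Hac & Hbase & [Hw _] & Hcw).
  apply incl_cons_inv in Hac as [Hxc Hac].
  (* The entries of [a] are given by terms over [c]; the same terms over [w] locate the copy [wa] of
     [a], over which [w] is to be realized. *)
  destruct (incl_values M Hac) as (s & Hs & E).
  pose proof (simeq_values_app Hcw Hs) as Hcw'. rewrite E in Hcw'.
  set (wa := map (value (str K k) w) s) in *.
  assert (Hwa : Forall (dom (str K k)) wa).
  { apply values_dom; [exact Hw | now rewrite <- (simeq_length Hcw)]. }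
  assert (Haw : simeq M a (str K k) wa).
  { apply (simeq_app_l Hcw'). unfold wa. now rewrite <- E, !length_map. }
  destruct (limit_homogeneous (limit_base_simeq Ha Hb H) Hwa (simeq_trans (simeq_sym H) Haw) Hw)
    as (d & Hdd & Hbd).
  exists c, d.
  assert (Hac' : simeq M (a ++ c) M (b ++ d)) by exact (simeq_trans Hcw' (simeq_sym Hbd)).
  split; [|split; [exact Hdd|split; [|split; [exact Hac' | exact Hxc]]]].
  - pose proof (simeq_length Hac') as E1. rewrite !length_app in E1.
    pose proof (simeq_length H). lia.
  - apply limit_base_cl; [now apply (limit_base_iff Hc Hw Hcw)|].
    apply Forall_forall. intros y Hy. apply cl_gen. auto.
Qed.

Lemma combine_fst_snd (a b : list nat) : length a = length b ->
  map fst (combine a b) = a /\ map snd (combine a b) = b.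
Proof.
  revert b. induction a as [|x a IH]; intros [|y b] E; try discriminate; [easy|].
  injection E as E. destruct (IH b E) as [E1 E2]. simpl. split; congruence.
Qed.

(** The second application of [limit_forth] runs in the opposite direction and brings [x] into the
    range. It yields a base on the second side, which similarity moves to the first. *)
Lemma limit_back_and_forth l x : limit_base K ch (map fst l) ->
  Forall (limit_dom ch) (map snd l) -> simeq M (map fst l) M (map snd l) -> limit_dom ch x ->
  exists u, Forall (limit_dom ch) (map snd u) /\ limit_base K ch (map fst (l ++ u)) /\
    simeq M (map fst (l ++ u)) M (map snd (l ++ u)) /\ In x (map fst u) /\ In x (map snd u).
Proof.
  intros Ha Hb H Hx.
  destruct (limit_forth Ha Hb H Hx) as (c & d & Hcd & Hd & Hac & Hs & Hxc).
  assert (Hbd : Forall (limit_dom ch) (map snd l ++ d)) by now apply Forall_app.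
  destruct (limit_forth (limit_base_simeq Hac Hbd Hs) (proj1 Hac) (simeq_sym Hs) Hx)
    as (d' & c' & Hdc' & Hc' & Hbd' & Hs' & Hxd').
  destruct (combine_fst_snd (a := c ++ c') (b := d ++ d')) as [E1 E2].
  { rewrite !length_app. lia. }
  exists (combine (c ++ c') (d ++ d')). rewrite !map_app, E1, E2, !app_assoc.
  pose proof (proj1 Hbd') as Hdd. apply Forall_app in Hdd as [_ Hdd].
  split; [now apply Forall_app|]. split; [|split; [now apply simeq_sym|]].
  - apply (limit_base_simeq Hbd'); [|exact Hs']. apply Forall_app. split; [apply Hac | exact Hc'].
  - rewrite !in_app_iff. tauto.
Qed.

Definition similar (a b : list nat) : Prop :=
  Forall (limit_dom ch) a /\ Forall (limit_dom ch) b /\ simeq M a M b.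

(* The last clause is what makes the union of the states an automorphism; without similarity
   the union only has to be a bijection. *)
Definition valid (ab : list nat * list nat) (l : list (nat * nat)) : Prop :=
  Forall (limit_dom ch) (map fst l) /\ Forall (limit_dom ch) (map snd l) /\
  partial_injection l /\
  (similar (fst ab) (snd ab) ->
    limit_base K ch (map fst l) /\ similar (map fst l) (map snd l)).

Lemma valid_extend ab l x : valid ab l -> limit_dom ch x -> exists u, valid ab (l ++ u) /\
  In x (map fst (l ++ u)) /\ In x (map snd (l ++ u)).
Proof.
  intros (H1 & H2 & Hl & Hs) Hx.
  destruct (classic (similar (fst ab) (snd ab))) as [Hab|Hab].
  - destruct (Hs Hab) as (Hb & _ & _ & H).
    destruct (limit_back_and_forth Hb H2 H Hx) as (u & Hu & Hbu & Hsu & I1 & I2).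
    assert (Hd : Forall (limit_dom ch) (map snd (l ++ u))).
    { rewrite map_app. now apply Forall_app. }
    exists u. split; [|rewrite !map_app, !in_app_iff; tauto].
    split; [apply Hbu|]. split; [exact Hd|]. split; [now apply simeq_partial_injection in Hsu|].
    intros _. split; [exact Hbu|]. split; [apply Hbu|]. now split.
  - destruct (partial_injection_extend_both H1 H2 Hl Hx) as (u & Hu1 & Hu2 & Hu & I1 & I2).
    exists u. split; [|rewrite !map_app, !in_app_iff; tauto].
    split; [|split; [|split; [exact Hu | contradiction]]]; rewrite map_app; now apply Forall_app.
Qed.

Hypothesis ch_computable : Comp (jump (jump (EI K))) ch.
Local Notation O2 := (jump (jump (EI K))).

Lemma Dec_partial_injection T `{encoding T} (l : T -> list (nat * nat)) : Comp O2 l ->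
  Dec O2 (fun x => partial_injection (l x)).
Proof. intros Hl. unfold partial_injection. dec. Qed.

Lemma Dec_valid T `{encoding T} (ab : T -> list nat * list nat) (l : T -> list (nat * nat)) :
  Comp O2 ab -> Comp O2 l -> Dec O2 (fun x => valid (ab x) (l x)).
Proof.
  intros Hab Hl. unfold valid.
  refine (Dec_and _ (Dec_and _ (Dec_and _ (Dec_impl _ (Dec_and _ _))))).
  - refine (Dec_limit_doms ch_computable _). comp.
  - refine (Dec_limit_doms ch_computable _). comp.
  - now apply Dec_partial_injection.
  - refine (Dec_limit_simeq Hch ch_computable _ _); comp.
  - refine (Dec_limit_base hK ch_computable _). comp.
  - refine (Dec_limit_simeq Hch ch_computable _ _); comp.
Qed.

(** A search for a list with the two prescribed projections, in place of a recursion on two lists;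
    nothing is claimed when the lengths differ. *)
Lemma pairing_exists : exists z : list nat * list nat -> list (nat * nat), Comp O2 z /\
  forall a b, length a = length b -> map fst (z (a, b)) = a /\ map snd (z (a, b)) = b.
Proof.
  destruct (@Comp_choice O2 (list nat * list nat) (list (nat * nat)) _ _ (fun ab l =>
    length (fst ab) = length (snd ab) -> map fst l = fst ab /\ map snd l = snd ab)) as (z & Hz & E).
  - dec.
  - intros [a b]. exists (combine a b). apply combine_fst_snd.
  - exists z. split; [exact Hz|]. intros a b. apply (E (a, b)).
Qed.

Definition covered (x : nat) (l : list (nat * nat)) : Prop :=
  limit_dom ch x -> In x (map fst l) /\ In x (map snd l).

Lemma extension_exists : exists F : (list nat * list nat) * (nat * list (nat * nat)) -> list (nat * nat),
  Comp O2 F /\ forall ab n l, valid ab l ->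
    valid ab (l ++ F (ab, (n, l))) /\ covered n (l ++ F (ab, (n, l))).
Proof.
  destruct (@Comp_choice O2 ((list nat * list nat) * (nat * list (nat * nat))) (list (nat * nat)) _ _
    (fun t u => valid (fst t) (snd (snd t)) ->
      valid (fst t) (snd (snd t) ++ u) /\ covered (fst (snd t)) (snd (snd t) ++ u)))
    as (F & HF & E).
  - refine (Dec_impl _ (Dec_and _ _)).
    + apply Dec_valid; comp.
    + apply Dec_valid; comp.
    + unfold covered. refine (Dec_impl _ _); [|dec].
      refine (Dec_limit_dom ch_computable _). comp.
  - intros [ab [n l]]. simpl. destruct (classic (valid ab l)) as [Hv|Hv]; [|now exists nil].
    destruct (classic (limit_dom ch n)) as [Hn|Hn].
    + destruct (valid_extend Hv Hn) as (u & Hu & Hin). exists u. intros _. now split.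
    + exists nil. rewrite app_nil_r. intros _. now split.
  - exists F. split; [exact HF|]. intros ab n l. apply (E (ab, (n, l))).
Qed.

(** State [n] has handled all numbers below [n], so the image of [x] is read off state [S x]. One
    procedure serves all pairs: [valid] is decidable together with its premise of similarity, which
    only strengthens what each state satisfies. *)
Lemma limit_ultrahomogeneous : computably_cofinally_ultrahomogeneous (Some O2) M.
Proof.
  destruct pairing_exists as (z & Hz & Ez). destruct extension_exists as (F & HF & EF).
  pose (st := fun ab n => nat_rect (fun _ => list (nat * nat)) (z ab) (fun n l => l ++ F (ab, (n, l))) n).
  (* [H] looks up the partner of [x] in state [S x]; the premise makes the relation total where [x]
     is unmatched. *)
  destruct (@Comp_choice O2 ((list nat * list nat) * nat) nat _ _ (fun t y =>
    In (snd t) (map fst (st (fst t) (S (snd t)))) -> In (snd t, y) (st (fst t) (S (snd t)))))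
    as (H & HH & EH).
  { assert (Hst : Comp O2 (fun t : (list nat * list nat) * nat => st (fst t) (S (snd t)))).
    { refine (Comp_nat_rect (n := fun t : (list nat * list nat) * nat => S (snd t))
        (f := fun t => z (fst t)) (g := fun t n l => l ++ F (fst t, (n, l))) _ _ _); comp. }
    dec; exact (Comp_comp (f := fst) Hst ltac:(comp)). }
  { intros [ab x]. simpl. destruct (classic (In x (map fst (st ab (S x))))) as [Hin|Hin].
    - apply in_map_iff in Hin as ([x' y] & <- & Hp). now exists y.
    - exists 0. contradiction. }
  pose (P := fun ab : list nat * list nat => limit_base K ch (fst ab) /\
    Forall (limit_dom ch) (snd ab) /\ same_pattern (fst ab) (snd ab)).
  assert (HP : Dec O2 P).
  { apply (Dec_ext (P := fun ab => limit_base K ch (fst ab) /\ Forall (limit_dom ch) (snd ab) /\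
      length (fst ab) = length (snd ab) /\ partial_injection (z ab))).
    - intros [a b]. unfold P. simpl. split; intros (Ha & Hb & Hab);
        (split; [exact Ha | split; [exact Hb|]]).
      + destruct Hab as [Hl Hi]. destruct (Ez a b Hl) as [E1 E2].
        pose proof (same_pattern_combine (z (a, b))) as Q. rewrite E1, E2 in Q. tauto.
      + pose proof (proj1 Hab) as Hl. split; [exact Hl|]. destruct (Ez a b Hl) as [E1 E2].
        pose proof (same_pattern_combine (z (a, b))) as Q. rewrite E1, E2 in Q. tauto.
    - refine (Dec_and _ (Dec_and _ (Dec_and _ _))).
      + refine (Dec_limit_base hK ch_computable _). comp.
      + refine (Dec_limit_doms ch_computable _). comp.
      + dec.
      + apply Dec_partial_injection. exact Hz. }
  (* The index of the bijection becomes a computable function of the pair, and the restriction to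
     [limit_dom] gives it exactly the right domain. *)
  destruct (@s_m_n_index O2 (list nat * list nat) nat nat _ _ _ (fun _ x => limit_dom ch x)
    (fun ab x => H (ab, x))) as (e & He & Hind).
  { refine (Dec_limit_dom ch_computable _). comp. }
  { refine (Comp_comp HH _). comp. }
  assert (Ecode : forall a b, code (a, b) = ⟨code_tuple a, code_tuple b⟩).
  { intros a b. now rewrite <- !code_list_tuple. }
  exists (limit_base K ch). split; [apply limit_base_cofinal|]. split.
  { apply Dec_computable_set.
    apply (Dec_ext (P := fun x : nat => limit_base K ch (decode x))).
    - intros x. destruct (code_surj (A := list nat) x) as [a <-]. rewrite codeK. split.
      + intros Ha. exists a. split; [apply code_list_tuple | exact Ha].
      + intros (b & E & Hb). rewrite code_list_tuple in E. apply code_tuple_inj in E. now subst.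
    - refine (Dec_decode (P := limit_base K ch) _). refine (Dec_limit_base hK ch_computable _). comp. }
  exists (fun x => code (e (decode x))). split.
  { destruct (Comp_computable_map HP He) as (i & p & Ep & Hl & Hp).
    exists i, p. split; [exact Ep|]. split; [exact Hl|]. intros x y. rewrite Hp.
    enough (Q : (exists ab, x = code ab /\ P ab) <-> (exists a b, x = ⟨code_tuple a, code_tuple b⟩ /\
      limit_base K ch a /\ Forall (dom M) b /\ same_pattern a b)) by (now rewrite Q).
    split.
    - intros ([a b] & -> & Hab). exists a, b. now rewrite Ecode.
    - intros (a & b & -> & Hab). exists (a, b). now rewrite Ecode. }
  intros a b (Ha & Hb & Hpat). rewrite <- Ecode, codeK.
  pose (h := fun x => H ((a, b), x)). exists h.
  destruct (Ez a b (proj1 Hpat)) as [E1 E2].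
  assert (Hvalid : forall n, valid (a, b) (st (a, b) n)).
  { induction n as [|n IH]; [|now apply (EF (a, b) n)].
    unfold st, valid. simpl. rewrite E1, E2. split; [apply Ha|]. split; [exact Hb|].
    split; [apply same_pattern_combine; now rewrite E1, E2|]. intros Hs. now split. }
  assert (Hcov : forall n, covered n (st (a, b) (S n))) by (intros n; now apply (EF (a, b) n)).
  assert (Hmono : forall n m, n <= m -> incl (st (a, b) n) (st (a, b) m)).
  { intros n m. induction 1 as [|m _ IH]; [apply incl_refl|].
    apply (incl_tran IH), incl_appl, incl_refl. }
  assert (Hh : forall x n, limit_dom ch x -> x < n -> In (x, h x) (st (a, b) n)).
  { intros x n Hx Hn. apply (Hmono (S x) n Hn). apply (EH ((a, b), x)). now apply Hcov. }
  assert (Hinj : forall n p q, In p (st (a, b) n) -> In q (st (a, b) n) ->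
    (fst p = fst q <-> snd p = snd q)).
  { intros n. apply partial_injection_iff. apply Hvalid. }
  assert (Hdom : forall n p, In p (st (a, b) n) -> limit_dom ch (fst p) /\ limit_dom ch (snd p)).
  { intros n p Hp. destruct (Hvalid n) as (D1 & D2 & _). rewrite Forall_forall in D1, D2.
    split; [apply D1 | apply D2]; now apply in_map. }
  assert (Hval : forall n p, In p (st (a, b) n) -> h (fst p) = snd p).
  { intros n p Hp. set (m := Nat.max n (S (fst p))).
    assert (Hx : In (fst p, h (fst p)) (st (a, b) m)) by (apply Hh; [now apply (Hdom n p)|lia]).
    apply (Hinj m (fst p, h (fst p)) p Hx); [|reflexivity]. apply (Hmono n m); [lia | exact Hp]. }
  split; [|split; [|split; [|split; [|split]]]].
  - destruct (Hind (a, b)) as (p & Ep & Hl & Hp). exists p. split; [exact Ep|]. split; [exact Hl|].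
    intros x y. rewrite Hp. split.
    + intros (x' & -> & Hx). exact Hx.
    + intros Hx. now exists x.
  - intros x Hx. apply (Hdom (S x) (x, h x)), Hh; [exact Hx | lia].
  - intros x y Hx Hy E. set (n := S (Nat.max x y)).
    apply (Hinj n (x, h x) (y, h y)); try exact E; apply Hh; trivial; lia.
  - intros y Hy. destruct (Hcov y Hy) as [_ Hin]. apply in_map_iff in Hin as (p & <- & Hp).
    exists (fst p). split; [now apply (Hdom _ p Hp) | now apply (Hval _ p Hp)].
  - transitivity (map h (map fst (z (a, b)))); [now rewrite E1|].
    transitivity (map snd (z (a, b))); [|exact E2].
    rewrite map_map. apply map_ext_in. intros p Hp. now apply (Hval 0).
  - intros Hs.
    assert (Hsim : forall c, Forall (limit_dom ch) c -> simeq M c M (map h c)).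
    (* Every entry of [c] is below [n], so the graph of [h] on [c] lies within a single state, whose
       two sides are similar. *)
    { intros c Hc. set (n := S (list_max c)).
      destruct (Hvalid n) as (_ & _ & _ & Hn).
      destruct Hn as (_ & _ & _ & Hn); [split; [apply Ha | now split]|].
      assert (Hi : incl (map (fun x => (x, h x)) c) (st (a, b) n)).
      { intros p Hp. apply in_map_iff in Hp as (x & <- & Hx).
        pose proof (proj1 (list_max_le c (list_max c)) (le_n _)) as Hle.
        rewrite Forall_forall in Hc, Hle. apply Hh; [auto|]. specialize (Hle x Hx). lia. }
      pose proof (simeq_pairs Hn Hi) as G. rewrite !map_map in G. simpl in G.
      now rewrite map_id in G. }
    split; [split; [|split; [|split]]|].
    + intros x Hx. apply (Hdom (S x) (x, h x)), Hh; [exact Hx | lia].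
    + intros x y Hx Hy E. set (n := S (Nat.max x y)).
      apply (Hinj n (x, h x) (y, h y)); try exact E; apply Hh; trivial; lia.
    + intros n c (Hn & Hl & Hc). exact (simeq_rel (Hsim c Hc) Hn Hl).
    (* With the value adjoined to the arguments, commuting with the symbol is the preservation of
       one atomic formula. *)
    + intros m c (Hm & Hl & Hc).
      assert (Hc' : Forall (limit_dom ch) (fn M m c :: c)).
      { constructor; [exact (fn_dom Hm Hl Hc) | exact Hc]. }
      now apply (simeq_fn (Hsim _ Hc') Hm Hl).
    + intros y Hy. destruct (Hcov y Hy) as [_ Hin]. apply in_map_iff in Hin as (p & <- & Hp).
      exists (fst p). split; [now apply (Hdom _ p Hp) | now apply (Hval _ p Hp)].
Qed.

End BackAndForth.

Theorem corollary6p22 (L : language) (K : representation L) (C : collection L)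
    (hK : computable_age None K C) (hHP : HP C) (hJEP : JEP C) (hCAP : CAP C) :
  exists M : structure L nat,
    computable_cofinal_fraisse_limit (Some (jump (jump (EI K)))) M K.
Proof.
  destruct (amalgamation_chain_exists hK hJEP hCAP) as (ch & Hcomp & Hch).
  exists (limit Hch). split; [|split].
  - exact (limit_computable hK Hch Hcomp).
  - exact (limit_ultrahomogeneous hK Hch Hcomp).
  - exact (limit_computable_age hK hHP Hch _).
Qed.
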